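(* For every $\varepsilon>0$ and every positive integer $m$ there is a constant $c=c(\varepsilon,m)>0$ such that the following holds. Let $G$ be a nontrivial finite $\varepsilon$-quasirandom group and let $S\subseteq G$ be a subset with $|S|=m$ and $G=\langle S\rangle$. Then $$\mathrm{gap}(G,S)\ \ge\ c\cdot\min\{\mathrm{gap}(G/N,S) : N \text{ a maximal normal subgroup of } G\}.$$
   Context: A finite group $G$ is $\varepsilon$-quasirandom if every nontrivial irreducible complex representation of $G$ has degree at least $|G|^{\varepsilon}$. A maximal normal subgroup is a proper normal subgroup that is maximal among proper normal subgroups. For a finite group $G$ and a finite nonempty multiset $S$ of elements of $G$, the Cayley graph $\mathrm{Cay}(G,S)$ is the undirected graph with vertex set $G$ and edges $(g,s^{\pm1}g)$ for $g\in G$, $s\in S$, counted with multiplicity (multiple edges and loops allowed), so that it is $2|S|$-regular. $\mathrm{gap}(G,S)$ is the spectral gap $1-\lambda_2$ of its normalized adjacency matrix, i.e. of the operator $f\mapsto \frac{1}{2|S|}\sum_{s\in S}\big(f(sg)+f(s^{-1}g)\big)$ on functions $f:G\to\mathbb{C}$, where $1=\lambda_1\ge\lambda_2\ge\cdots$ are its eigenvalues with multiplicity. Thus $\mathrm{gap}(G,S)>0$ iff $G=\langle S\rangle$. For $N\trianglelefteq G$, $\mathrm{gap}(G/N,S)$ is the spectral gap of the Cayley graph of $G/N$ with respect to the image of $S$ in $G/N$, regarded as a multiset of size $|S|$. *)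

(* Defs.v *)
From HB Require Import structures.
From mathcomp Require Import all_boot all_order all_algebra.
From mathcomp Require Import all_fingroup all_solvable all_character.
From mathcomp Require Import complex.
From mathcomp Require Import all_classical all_reals exp.

Set Implicit Arguments.
Unset Strict Implicit.
Unset Printing Implicit Defensive.

Import Order.TTheory GRing.Theory Num.Theory.

Local Open Scope ring_scope.
Local Open Scope complex_scope.

(* A representation is trivial when its kernel is the whole of G; for an
   irreducible one this forces degree 1. *)
Definition quasirandom (R : realType) (eps : R) (gT : finGroupType)
    (G : {group gT}) : Prop :=
  forall (n : nat) (rG : mx_representation R[i] G n),
    mx_irreducible rG -> rker rG :!=: G -> powR #|G|%:R eps <= n%:R.

(* Matrix of f |-> (g |-> (2 |s|)^-1 * \sum_(x <- s) (f (x g) + f (x^-1 g)))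
   acting on column vectors indexed by G through enum_val. Multisets of
   elements of G are represented by sequences. *)
Definition cayley_mx (R : realType) (gT : finGroupType) (G : {group gT})
    (s : seq gT) : 'M[R[i]]_#|G| :=
  \matrix_(i, j)
    ((2 * size s)%N%:R^-1 *
     \sum_(x <- s) ((enum_val j == (x * enum_val i)%g)%:R
                    + (enum_val j == (x^-1 * enum_val i)%g)%:R)).

(* Complex eigenvalues, repeated according to algebraic multiplicity. *)
Definition eigenvalues (R : realType) (n : nat) (A : 'M[R[i]]_n) : seq R[i] :=
  sval (closed_field_poly_normal (char_poly A)).

(* cayley_mx is real symmetric when s consists of elements of G, so its
   eigenvalues are real and taking real parts loses nothing; lambda_2 is entry 1
   (counting from 0) of the nonincreasing list. It is meaningful only for
   nontrivial G: for the trivial group the default value 0 is read. *)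
Definition gap (R : realType) (gT : finGroupType) (G : {group gT})
    (s : seq gT) : R :=
  1 - nth 0 (sort >=%R [seq complex.Re z | z <- eigenvalues (cayley_mx R G s)]) 1.

(* The image of S is taken with map, not as a set, so multiplicities are kept. *)
Definition quotient_gap (R : realType) (gT : finGroupType)
    (G N : {group gT}) (S : {set gT}) : R :=
  gap R (G / N)%G [seq coset N x | x <- enum S].

(* The infimum of a finite set, nonempty as soon as G is nontrivial, hence a
   minimum. [maxnormal N G G]: N is maximal among the proper subgroups of G
   normalised by G. *)
Definition min_quotient_gap (R : realType) (gT : finGroupType)
    (G : {group gT}) (S : {set gT}) : R :=
  inf [set quotient_gap R G N S | N in [set N : {group gT} | maxnormal N G G]]%classic.

(* Main.v *)
(** Idea of the proof. Let n = |G|, let gamma be the smallest gap of the G/N, and suppose that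
    the gap of G is far below gamma.

    A mean zero eigenvector of the walk on G has at least n^eps independent right translates, so
    the return probability of the lazy walk stays above n^(eps - 1) for a time that is long
    compared with 1/gamma times log n. At some scale in between the walk distribution u is nearly
    flat and moves, under one step, by at most a small multiple of gamma. Replacing u(x) by
    u(x)u(xg) a bounded number of times makes the support closed, up to small powers of n, under
    popular differences, and yields an approximate subgroup D, of size at most n^(1-c), which has
    a large intersection with each of its conjugates by elements of S. The spectral gap of G/N
    and Gowers' trick force a small power of D to map onto every G/N.

    If D^4 and g X^4 g^-1 meet in a set of intermediate size, the cube of that set replaces X; it
    still maps onto all G/N. When no intermediate size is left, "large intersection" passes from
    g to gs, hence holds for all g in G. Consequently the law phi of a random conjugate of a
    random element of X^4 gives D^4 mass at least n^(-c').

    This is impossible, because phi is central: it acts on mean zero functions through averages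
    of normalised class functions r, and quasirandomness makes r(g h^x) concentrate around
    r(g)r(h) for random x. Comparing the products of 2j, 4j and 6j random conjugates of y and its
    inverse shows that |r(y)| is either 1, which happens only on a proper normal subgroup, or at
    most n^(-c''); and phi gives little mass to proper normal subgroups. *)

Require Import Defs.
From HB Require Import structures.
From mathcomp Require Import all_boot all_order all_algebra.
From mathcomp Require Import all_fingroup all_solvable all_character.
From mathcomp Require Import complex.
From mathcomp Require Import all_classical all_reals exp.
From mathcomp Require Import fintype finset ring lra zify.

Set Implicit Arguments.
Unset Strict Implicit.
Unset Printing Implicit Defensive.

Import Order.TTheory GRing.Theory Num.Theory.

(** * Products of sets in a finite group *)

(** Losses are harmless as long as the number of rounds is bounded in terms of eps alone. Sizes are
    therefore measured in a unit that is a fixed small power of n: a quantity between 1 and n can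
    change by a factor of the unit only boundedly often. This bounds the doublings of time, the
    products u(x)u(xg) and the descents, and gamma is lost only by a factor exponential in these
    numbers. If the unit is too small to absorb the numerical constants, then n is bounded and a
    crude estimate of the gap is enough.

    The main obstacle is that a large intersection with the conjugates by generators says little
    about conjugates by long words, since the loss compounds from letter to letter. An empty range
    between |X|/t^3 and |X|/t cures this: one letter cannot take the intersection below the range,
    so it is back above the range before the next letter.

    Surjectivity onto all G/N is carried through the descent because it keeps the central law away
    from proper normal subgroups, on which a normalised class function may have modulus 1. *)

Lemma fiber_card_le (T U : finType) (f : T -> U) (A : {set T}) (B : {set U}) (c : nat) :
  {in A, forall x, f x \in B} ->
  {in B, forall b, #|[set x in A | f x == b]| <= c} -> #|A| <= #|B| * c.
Proof.
move=> fAB fc; rewrite -sum1_card (partition_big f [in B]) //=.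
rewrite -sum_nat_const leq_sum // => b Bb; rewrite sum1_card.
by apply: leq_trans (fc b Bb); rewrite subset_leq_card //; apply/subsetP => x; rewrite !inE.
Qed.

(** Stated without division: the fibres over [B] have at least [a / k] elements. Later comparisons
    of sizes are multiplied out in the same way, so that they stay in [nat]. *)
Lemma fiber_card_ge (T U : finType) (f : T -> U) (A : {set T}) (B : {set U}) (a k : nat) :
  {in B, forall b, a <= k * #|[set x in A | f x == b]|} -> #|B| * a <= k * #|A|.
Proof.
move=> h; apply: leq_trans (_ : \sum_(b in B) k * #|[set x in A | f x == b]| <= _).
  by rewrite -sum_nat_const; apply: leq_sum.
rewrite -big_distrr /= leq_mul2l; apply/orP; right.
apply: leq_trans (_ : #|[set x in A | f x \in B]| <= _); last first.
  by apply: subset_leq_card; apply/subsetP => x; rewrite inE => /andP[].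
rewrite -[leqRHS]sum1_card (partition_big f [in B]) /=; last by move=> x; rewrite inE => /andP[].
apply: leq_sum => b Bb; rewrite sum1_card; apply: subset_leq_card; apply/subsetP => x.
by rewrite inE => /andP[Ax /eqP fx]; rewrite -topredE /= inE Ax fx Bb eqxx.
Qed.

Lemma sum_nat_sqr_le (T : finType) (Q : {set T}) (r : T -> nat) :
  (\sum_(q in Q) r q) ^ 2 <= #|Q| * \sum_(q in Q) r q ^ 2.
Proof.
rewrite -(leq_pmul2l (_ : 0 < 2)) // -mulnn big_distrlr /=.
have -> : (2 * (#|Q| * \sum_(q in Q) r q ^ 2) = \sum_(q in Q) \sum_(p in Q) (r q ^ 2 + r p ^ 2))%N.
  under [RHS]eq_bigr do rewrite big_split /= sum_nat_const.
  rewrite big_split /= -big_distrr /= sum_nat_const; ring.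
rewrite big_distrr; apply: leq_sum => q _; rewrite big_distrr; apply: leq_sum => p _.
exact: nat_Cauchy.
Qed.

Section Sets.
Local Open Scope group_scope.
Variable gT : finGroupType.
Implicit Types A B D E F X Z : {set gT}.

(** Ruzsa's covering argument: [Z] is a maximal subset of [A] with disjoint translates [z *: B].
    Packing them into [A * B] bounds [#|Z|], and by maximality each [a *: B] meets some [z *: B]. *)
Lemma ruzsa_cover A B : B != set0 ->
  exists Z, [/\ Z \subset A, #|Z| * #|B| <= #|A * B| & A \subset Z * (B * B^-1)].
Proof.
case/set0Pn => b0 Bb0; pose P Z := (Z \subset A) &&
  [forall x in Z, forall y in Z, (x != y) ==> [disjoint x *: B & y *: B]].
have P0 : P set0.
  by rewrite /P sub0set; apply/forall_inP => x; rewrite inE.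
have [Z /maxsetP [/andP[ZA /forall_inP dZ] maxZ] _] := maxset_exists P0.
exists Z; split=> //.
  rewrite -cardsX -(@card_in_imset _ _ (fun p : gT * gT => p.1 * p.2)); last first.
    move=> [x b] [y d]; rewrite !inE /= => /andP[Zx Bb] /andP[Zy Bd] e.
    have xy : x = y.
      apply/eqP; apply: contraT => nxy.
      have /forall_inP /(_ y Zy) := dZ x Zx; rewrite nxy /= => /pred0P /(_ (x * b)).
      by rewrite /= mem_lcoset mulKg Bb e mem_lcoset mulKg Bd.
    by move: e; rewrite xy => /mulgI ->.
  apply: subset_leq_card; apply/subsetP => _ /imsetP[[x b] /[!inE] /= /andP[Zx Bb] ->].
  by apply: mem_mulg => //; apply: (subsetP ZA).
apply/subsetP => a Aa.
have [/exists_inP[z Zz]|/exists_inPn h] := boolP [exists z in Z, ~~ [disjoint a *: B & z *: B]].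
  case/pred0Pn => w /=; rewrite !mem_lcoset => /andP[Bw Bz].
  apply/mulsgP; exists z (z^-1 * a) => //; last by rewrite mulKVg.
  apply/mulsgP; exists (z^-1 * w) (w^-1 * a) => //; first by rewrite mem_invg invMg invgK.
  by rewrite mulgA mulgK.
have nZa : a \notin Z.
  apply/negP => /h; rewrite negbK => /pred0P /(_ (a * b0)).
  by rewrite /= mem_lcoset mulKg Bb0.
have dj z : z \in Z -> [disjoint a *: B & z *: B] by move/h; rewrite negbK.
case/negP: nZa; rewrite -(maxZ (a |: Z)) ?setU11 ?subsetUr //.
rewrite /P subUset sub1set Aa ZA /=.
apply/forall_inP => x /setU1P[->|Zx]; apply/forall_inP => y /setU1P[->|Zy]; apply/implyP.
- by rewrite eqxx.
- by move=> _; apply: dj.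
- by rewrite disjoint_sym => _; apply: dj.
by move=> nxy; have /forall_inP /(_ y Zy) /implyP /(_ nxy) := dZ x Zx.
Qed.

(** A bound on a single high power; since [1 \in D] it controls all lower ones. Each passage to an
    intersection lowers the admissible [k], so the descent starts from a large one. *)
Definition approx K k D := [/\ 1 \in D, D^-1 = D & #|D ^+ k| <= K * #|D|].

Lemma expg_inv D k : D^-1 = D -> (D ^+ k)^-1 = D ^+ k.
Proof. by move=> sD; elim: k => [|k IH]; rewrite ?invg1 // expgSr invMg sD IH -expgS expgSr. Qed.

Lemma expg_mem1 D k : 1 \in D -> 1 \in D ^+ k.
Proof.
move=> D1; elim: k => [|k IH]; first by rewrite expg0 inE.
by rewrite expgS -[1]mulg1 mem_mulg.
Qed.

Lemma expg_leS D i j : 1 \in D -> i <= j -> D ^+ i \subset D ^+ j.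
Proof.
move=> D1 /subnK <-; rewrite expgD; apply/subsetP => x Dx.
by rewrite -[x]mul1g mem_mulg // expg_mem1.
Qed.

Lemma expgSS D E k : D \subset E -> D ^+ k \subset E ^+ k.
Proof. by move=> DE; elim: k => [|k IH]; rewrite ?expg0 // !expgS mulgSS. Qed.

Lemma expg_subG (G : {group gT}) D k : D \subset G -> D ^+ k \subset G.
Proof.
by move=> DG; elim: k => [|k IH]; rewrite ?expg0 ?sub1G // expgS mul_subG.
Qed.

Lemma approx_le K k D j : approx K k D -> j <= k -> #|D ^+ j| <= K * #|D|.
Proof.
by case=> D1 sD h jk; apply: leq_trans h; rewrite subset_leq_card // expg_leS.
Qed.

Lemma approx_leq K k K' k' D : approx K k D -> K <= K' -> k' <= k -> approx K' k' D.
Proof.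
move=> aD KK kk; have [D1 sD _] := aD; split=> //.
by apply: leq_trans (approx_le aD kk) _; rewrite leq_mul2r KK orbT.
Qed.

Lemma conjsXg D x k : (D ^+ k) :^ x = (D :^ x) ^+ k.
Proof. by elim: k => [|k IH]; rewrite ?expg0 ?conjs1g // !expgS conjsMg IH. Qed.

Lemma approx_conj K k D x : approx K k D -> approx K k (D :^ x).
Proof.
case=> D1 sD h; split; first by rewrite -(conj1g x) memJ_conjg.
  by apply/setP => y; rewrite mem_invg !mem_conjg conjVg -mem_invg sD.
by rewrite -conjsXg !cardJg.
Qed.

(* Both powers are covered by few translates of squares, and two points in the same pair of
   translates differ by an element of both fourth powers. *)
Lemma inter_growth KD KX k D X : approx KD k.+1 D -> approx KX k.+1 X ->
  #|D ^+ k :&: X ^+ k| <= KD * KX * #|D ^+ 4 :&: X ^+ 4|.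
Proof.
have cover K Y : approx K k.+1 Y ->
    exists2 Z : {set gT}, #|Z| <= K & Y ^+ k \subset Z * Y ^+ 2.
  move=> aY; have [Y1 sY hY] := aY.
  have Y0 : Y != set0 by apply/set0Pn; exists 1.
  have [Z [_ hZ cZ]] := ruzsa_cover (Y ^+ k) Y0.
  exists Z; last by rewrite sY in cZ; rewrite expgS expg1.
  have Y0' : 0 < #|Y| by rewrite card_gt0.
  by rewrite -(leq_pmul2r Y0') (leq_trans hZ) // -expgSr.
move=> aD aX; have [_ sD _] := aD; have [_ sX _] := aX.
have [Z hZ cZ] := cover _ _ aD; have [W hW cW] := cover _ _ aX.
pose f (Z V : {set gT}) p := [pick z in Z | p \in z *: V].
have fP (V Y : {set gT}) p : p \in Y * V -> exists2 z, z \in Y & f Y V p = Some z /\ p \in z *: V.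
  case/mulsgP => y v Yy Vv ->; rewrite /f; case: pickP => [z /andP[Yz pz]|/(_ y)].
    by exists z.
  by rewrite Yy mem_lcoset mulKg Vv.
apply: (@leq_trans (#|setX Z W| * #|D ^+ 4 :&: X ^+ 4|)); last first.
  by rewrite leq_mul2r cardsX leq_mul ?orbT.
apply: (@fiber_card_le _ _ (fun p => (odflt 1 (f Z (D ^+ 2) p), odflt 1 (f W (X ^+ 2) p)))).
  move=> p /setIP[/(subsetP cZ) /fP[z Zz [-> _]] /(subsetP cW) /fP[w Ww [-> _]]].
  by rewrite inE Zz.
move=> [z w] /setXP[/= Zz Ww].
have [->|/set0Pn[p0]] := eqVneq [set x in D ^+ k :&: X ^+ k | (odflt 1 (f Z (D ^+ 2) x),
  odflt 1 (f W (X ^+ 2) x)) == (z, w)] set0.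
  by rewrite cards0.
have fib p : p \in [set x in D ^+ k :&: X ^+ k | (odflt 1 (f Z (D ^+ 2) x),
  odflt 1 (f W (X ^+ 2) x)) == (z, w)] -> p \in z *: D ^+ 2 /\ p \in w *: X ^+ 2.
  rewrite !inE => /andP[/andP[/(subsetP cZ) /fP[z' _ [-> pz]] /(subsetP cW) /fP[w' _ [-> pw]]]].
  by case/andP => /= /eqP <- /eqP <-.
move=> /fib[p0z p0w].
rewrite -(card_lcoset _ p0^-1); apply: subset_leq_card; apply/subsetP => q.
rewrite mem_lcoset invgK => /fib[qz qw].
have sq (V : {set gT}) a : V^-1 = V -> p0 \in a *: V ^+ 2 -> p0 * q \in a *: V ^+ 2 -> q \in V ^+ 4.
  move=> sV; rewrite !mem_lcoset => h1 h2.
  have -> : q = (a^-1 * p0)^-1 * (a^-1 * (p0 * q)) by rewrite invMg invgK -!mulgA mulKVg mulKg.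
  by rewrite -[4]/(2 + 2)%N expgD mem_mulg // -(expg_inv 2 sV) mem_invg invgK.
by rewrite inE (sq D z) ?(sq X w).
Qed.

End Sets.

(** * Descent to a set all of whose conjugates meet the approximate group *)

Section Descent.
Local Open Scope group_scope.
Variables (gT : finGroupType) (G : {group gT}) (S : {set gT}) (Dl : nat).
Implicit Types D F X : {set gT}.
Hypothesis genS : <<S>> = G.

Definition full X := forall N : {group gT}, maxnormal N G G -> X / N = G / N.

Hypothesis gowers : forall N : {group gT}, maxnormal N G G ->
  forall Y : {set coset_of N}, Y \subset G / N ->
  #|G / N| ^ 3 < Dl * #|Y| ^ 3 -> Y ^+ 3 = G / N.

Lemma maxnormal_normal (N : {group gT}) : maxnormal N G G -> N <| G.
Proof. by move/maxgroupp/andP => [/proper_sub sN nN]; apply/andP. Qed.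

(** [X] contains a representative [x] of every coset of [N], and the translates of [X ^+ j :&: N] by
    these [x] lie in different cosets and in [X ^+ j.+1]. *)
Lemma card_expg_cap_quotient X (N : {group gT}) j : maxnormal N G G ->
  X \subset G -> full X -> #|X ^+ j :&: N| * #|G / N| <= #|X ^+ j.+1|.
Proof.
move=> maxN XG fX; rewrite mulnC -[leqRHS]mul1n; apply: (@fiber_card_ge _ _ (coset N)) => b.
rewrite -(fX N maxN) => /morphimP[x Nx Xx ->] /=.
rewrite mul1n -(card_lcoset _ x); apply: subset_leq_card; apply/subsetP => y.
rewrite mem_lcoset => /setIP[Xy Ny]; rewrite -(mulKVg x y) in_set.
rewrite expgS mem_mulg //=; apply/eqP.
exact: coset_kerr.
Qed.

(** Two elements of [F] in one coset of [N] differ by an element of [F^-1 * F = F ^+ 2] lying in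
    [N]. *)
Lemma card_le_quotient F (N : {group gT}) : F \subset 'N(N) -> F^-1 = F ->
  #|F| <= #|F / N| * #|F ^+ 2 :&: N|.
Proof.
move=> nF sF; apply: (@fiber_card_le _ _ (coset N)).
  by move=> x Fx; apply: mem_morphim => //; apply: (subsetP nF).
move=> b _; have [->|/set0Pn[p]] := eqVneq [set x in F | coset N x == b] set0.
  by rewrite cards0.
rewrite inE => /andP[Fp /eqP pb]; rewrite -(card_lcoset _ p^-1).
apply: subset_leq_card; apply/subsetP => q; rewrite mem_lcoset invgK inE.
case/andP => Fq /eqP qb; rewrite inE expgS expg1; apply/andP; split.
  by rewrite -(mulKg p q) mem_mulg // -sF mem_invg invgK.
have nq : q \in 'N(N).
  have np := subsetP nF p Fp; have := subsetP nF _ Fq.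
  by rewrite groupMl.
rewrite coset_idr //; apply: (mulgI (coset N p)).
by rewrite mulg1 -morphM ?qb ?pb //; apply: (subsetP nF).
Qed.

(** [F] still fills a fixed proportion of every [G / N]: the fibres have size at most
    [#|F ^+ 2 :&: N|], and [F ^+ 2] lies in a conjugate of [X ^+ 8], which meets [N] in at most
    [#|X ^+ 9| / #|G / N|] elements. Gowers' trick makes the cube surjective. *)
Lemma full_cube KX t X F h : h \in G -> approx KX 9 X -> X \subset G -> full X ->
  F \subset (X :^ h) ^+ 4 -> F^-1 = F -> 1 \in F -> #|X| <= t * #|F| ->
  (KX * t) ^ 3 < Dl -> full (F ^+ 3).
Proof.
move=> Gh aX XG fX FX sF F1 Xt lt N maxN.
have FG : F \subset G.
  by apply: subset_trans FX _; apply: expg_subG; rewrite -(conjGid Gh) conjSg.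
have /andP[NG nN] := maxnormal_normal maxN.
have nF : F \subset 'N(N) by apply: subset_trans nN.
have FN0 : 0 < #|F| by rewrite (cardD1 1) F1.
have QF : #|G / N| <= KX * t * #|F / N|.
  rewrite -(leq_pmul2r FN0); apply: leq_trans (_ : #|F / N| * (#|X ^+ 8 :&: N| * #|G / N|) <= _).
    rewrite mulnA [leqLHS]mulnC leq_mul2r; apply/orP; right.
    apply: leq_trans (card_le_quotient nF sF) _; rewrite leq_mul2l; apply/orP; right.
    rewrite -(cardJg (X ^+ 8 :&: N) h) conjIg (normsP nN h Gh) conjsXg subset_leq_card //.
    by rewrite setSI // (_ : 8 = 4 * 2)%N // expgM expgSS.
  rewrite [(KX * t * _)%N]mulnC -[leqRHS]mulnA leq_mul2l; apply/orP; right.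
  apply: leq_trans (card_expg_cap_quotient 8 maxN XG fX) _.
  by have [_ _ h9] := aX; apply: leq_trans h9 _; rewrite -mulnA leq_mul2l Xt orbT.
have -> : F ^+ 3 / N = (F / N) ^+ 3.
  by rewrite !expgS !expg0 !mulg1 !quotientMl.
apply: gowers => //; first exact: quotientS.
apply: leq_ltn_trans (_ : (KX * t * #|F / N|) ^ 3 < _); first by rewrite leq_exp2r.
rewrite expnMn ltn_pmul2r // expn_gt0 card_gt0; apply/orP; left.
by apply/set0Pn; exists (coset N 1); apply: mem_morphim; rewrite ?group1.
Qed.

(* If a b = a' b' with a, a' in the conjugate by [s] of the old intersection and b, b' in
   [D :&: D :^ s], then a^-1 a' = b b'^-1 lies in [D ^+ 2] and in the new conjugate. *)
Lemma card_conj_cap_shift K KX t X D g s :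
  approx K 9 D -> approx KX 9 X -> #|D| <= K * #|D :&: D :^ s| ->
  #|X| <= t * #|D ^+ 4 :&: (X :^ g) ^+ 4| ->
  #|X| <= t * (K ^ 3 * KX) * #|D ^+ 4 :&: (X :^ (g * s)) ^+ 4|.
Proof.
move=> aD aX DK Xt; have [D1 sD _] := aD.
pose Y := X :^ (g * s); have aY : approx KX 9 Y by apply: approx_conj.
have [Y1 sY _] := aY.
pose E1 := (D ^+ 4 :&: (X :^ g) ^+ 4) :^ s; pose E2 := D :&: D :^ s.
have E1E : E1 = (D :^ s) ^+ 4 :&: Y ^+ 4 by rewrite /E1 conjIg !conjsXg -conjsgM.
have cE : #|E1| * #|E2| <= (K * #|D|) * #|D ^+ 2 :&: Y ^+ 8|.
  rewrite -cardsX; apply: leq_trans (_ : #|E1 * E2| * #|D ^+ 2 :&: Y ^+ 8| <= _); last first.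
    rewrite leq_mul2r; apply/orP; right.
    apply: leq_trans (approx_le aD (_ : 5 <= 9)) => //.
    rewrite -(cardJg (D ^+ 5) s) conjsXg subset_leq_card // expgSr mulgSS // ?E1E ?subsetIl //.
    exact: subsetIr.
  apply: (@fiber_card_le _ _ (fun p : gT * gT => p.1 * p.2)).
    by move=> [a b] /setXP[/= ? ?]; apply: mem_mulg.
  move=> z _; set P := [set _ in _ | _].
  have [->|/set0Pn[[a0 b0]]] := eqVneq P set0; first by rewrite cards0.
  rewrite !inE /= => /andP[/andP[Ea0 /andP[Db0 _]] /eqP z0].
  rewrite -(@card_in_imset _ _ (fun p : gT * gT => a0^-1 * p.1)).
    apply: subset_leq_card; apply/subsetP => _ /imsetP[[a b] Pab ->] /=.
    move: Pab; rewrite !inE /= => /andP[/andP[Ea /andP[Db _]] /eqP z1]; apply/andP; split.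
      have -> : a0^-1 * a = b0 * b^-1 by apply: (mulgI a0); apply: (mulIg b);
        rewrite mulKVg !mulgA mulgKV z0.
      by rewrite expgS expg1 mem_mulg // -sD mem_invg invgK.
    move: Ea0 Ea; rewrite E1E => /setIP[_ Ya0] /setIP[_ Ya].
    by rewrite (_ : 8 = 4 + 4)%N // expgD mem_mulg // -(expg_inv 4 sY) mem_invg invgK.
  move=> [a b] [a' b']; rewrite !inE /= => /andP[_ /eqP z1] /andP[_ /eqP z2] /mulgI e.
  by move: z2; rewrite -e -z1 => /mulgI ->.
have D0 : 0 < #|D| by rewrite (cardD1 1) D1.
have XE1 : #|X| <= t * #|E1| by rewrite cardJg.
rewrite -(leq_pmul2r D0); apply: leq_trans (leq_mul XE1 DK) _.
have -> : (t * #|E1| * (K * #|E2|) = t * K * (#|E1| * #|E2|))%N by ring.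
apply: leq_trans (leq_mul (leqnn _) cE) _.
have := inter_growth aD aY.
have : #|D ^+ 2 :&: Y ^+ 8| <= #|D ^+ 8 :&: Y ^+ 8|.
  by rewrite subset_leq_card // setSI // expg_leS.
move=> h1 h2; have h3 := leq_trans h1 h2.
apply: leq_trans (leq_mul (leqnn _) (leq_mul (leqnn _) h3)) _.
by apply: eq_leq; ring.
Qed.

(** If for some [h] the intersection has size between [#|X| / t ^ 3] and [#|X| / t], its cube
    replaces [X]. The cube is smaller than [X] by a factor [sigma], because cubing costs at most
    [K ^ (I + 2)]; so this happens at most [I] times. When no size is intermediate, a letter of a
    word costs at most [t ^ 2] and the dichotomy restores the bound [#|X| / t]. *)
Lemma conjugate_intersections (I K t sigma : nat) D :
  approx K (9 * 13 ^ I) D -> D \subset G -> full D ->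
  {in S, forall s, #|D| <= K * #|D :&: D :^ s|} ->
  K ^ (I + 2) * sigma <= t -> K ^ (I + 4) <= t ^ 2 ->
  (K ^ (I + 1) * t ^ 3) ^ 3 < Dl -> #|G| < sigma ^ I ->
  exists X, [/\ approx (K ^ (I + 1)) 9 X, X \subset G, full X &
    {in G, forall g, #|X| <= t * #|D ^+ 4 :&: (X :^ g) ^+ 4|}].
Proof.
move=> aD DG fD DS Kt Kt2 tDl nI; have [D1 sD _] := aD.
have K0 : 0 < K.
  rewrite lt0n; apply/eqP => K0; have [_ _] := aD; rewrite K0 mul0n leqn0 cards_eq0.
  by move/eqP => D0; have := expg_mem1 (9 * 13 ^ I) D1; rewrite D0 inE.
have leK i j : i <= j -> K ^ i <= K ^ j by move=> ij; rewrite leq_pexp2l.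
(* [r] counts the descents still available: [X] has shrunk by [sigma ^ (I - r)], its constant has
   grown to [K ^ (I - r + 1)], and powers up to [9 * 13 ^ r] remain controlled. The inclusion in
   [D ^+ 12] starts the induction on words at [g = 1]. *)
suff main r X : r <= I -> approx (K ^ (I - r + 1)) (9 * 13 ^ r) X -> X \subset G ->
    full X -> X \subset D ^+ 12 -> #|X| * sigma ^ (I - r) <= #|G| ->
    exists X, [/\ approx (K ^ (I + 1)) 9 X, X \subset G, full X &
    {in G, forall g, #|X| <= t * #|D ^+ 4 :&: (X :^ g) ^+ 4|}].
  apply: (main I D); rewrite ?subnn ?expn1 ?muln1 ?subset_leq_card //.
  by rewrite -{1}[D]expg1 expg_leS.
elim: r X => [|r IH] X rI aX XG fX XD Xn; have [X1 sX _] := aX.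
  have : sigma ^ I <= #|G|.
    by apply: leq_trans Xn; rewrite subn0 leq_pmull // (cardD1 1) X1.
  by rewrite leqNgt nI.
(* Thirteen is 12 + 1: the cube of an intersection of fourth powers lies in twelfth powers, and
   [inter_growth] asks for one power more. The same count lowers [9 * 13 ^ r.+1] to [9 * 13 ^ r]. *)
have k9 : 13 <= 9 * 13 ^ r.+1 by rewrite expnS mulnCA leq_pmulr // muln_gt0 expn_gt0.
have kI : 13 <= 9 * 13 ^ I by apply: leq_trans k9 _; rewrite leq_mul2l leq_pexp2l.
pose F h := D ^+ 4 :&: (X :^ h) ^+ 4.
have aD9 : approx K 9 D by apply: approx_leq aD (leqnn _) (leq_trans _ kI).
have aX9 : approx (K ^ (I - r.+1 + 1)) 9 X by apply: approx_leq aX (leqnn _) (leq_trans _ k9).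
have [/exists_inP[h Gh /andP[lo hi]]|/exists_inPn gap] :=
  boolP [exists h in G, (t * #|F h| < #|X|) && (#|X| <= t ^ 3 * #|F h|)].
  have F1 : 1 \in F h.
    by rewrite inE !expg_mem1 // -(conj1g h) memJ_conjg.
  have sF : (F h)^-1 = F h.
    have [_ sXh _] := approx_conj h aX9.
    by rewrite /F invIg !expg_inv.
  have XhG : X :^ h \subset G by rewrite -(conjGid Gh) conjSg.
  have F0 : 0 < #|F h| by rewrite (cardD1 1) F1.
  have aF : approx (K ^ (I - r + 1)) (9 * 13 ^ r) (F h ^+ 3).
    split; [exact: expg_mem1 | exact: expg_inv |].
    rewrite -expgM; set k := (_ * _)%N.
    have k13 : (4 * k).+1 <= 9 * 13 ^ r.+1 by rewrite /k expnS; have := expn_gt0 13 r; lia.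
    have aX' : approx (K ^ (I - r.+1 + 1)) (4 * k).+1 (X :^ h).
      by apply: approx_conj; apply: approx_leq aX (leqnn _) k13.
    have aD' : approx K (4 * k).+1 D.
      apply: approx_leq aD (leqnn _) (leq_trans k13 _).
      by rewrite leq_mul2l leq_pexp2l.
    apply: leq_trans (_ : #|D ^+ (4 * k) :&: (X :^ h) ^+ (4 * k)| <= _).
      rewrite subset_leq_card // !expgM subsetI !expgSS // ?subsetIl //.
      exact: subsetIr.
    apply: leq_trans (inter_growth aD' aX') _.
    have -> : (I - r + 1 = (I - r.+1 + 1).+1)%N by lia.
    rewrite -expnS leq_mul2l; apply/orP; right; apply: subset_leq_card.
    by rewrite -{1}[D ^+ 4 :&: _]expg1; apply: expg_leS.
  have tX : #|F h ^+ 3| * sigma <= #|X|.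
    have h13 : (13 <= 13 ^ r.+1 * 9) by lia.
    have aX' : approx (K ^ (I - r.+1 + 1)) 13 (X :^ h).
      by apply: approx_conj; apply: approx_leq aX (leqnn _) k9.
    have aD' : approx K 13 D by apply: approx_leq aD (leqnn _) kI.
    have FK : #|F h ^+ 3| <= K ^ (I + 2) * #|F h|.
      apply: leq_trans (_ : #|D ^+ 12 :&: (X :^ h) ^+ 12| <= _).
        rewrite subset_leq_card // -[12]/(4 * 3)%N !expgM subsetI !expgSS // ?subsetIl //.
        exact: subsetIr.
      apply: leq_trans (inter_growth aD' aX') _.
      by rewrite leq_mul2r -expnS leK ?orbT //; lia.
    apply: leq_trans (leq_mul FK (leqnn sigma)) (leq_trans _ (ltnW lo)).
    by rewrite mulnAC leq_mul2r Kt orbT.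
  apply: (IH (F h ^+ 3)) => //.
  - exact: ltnW.
  - by apply: expg_subG; apply: subset_trans (subsetIr _ _) _; apply: expg_subG.
  - apply: (full_cube Gh aX9 XG fX (subsetIr _ _) sF F1 hi).
    apply: leq_ltn_trans tDl; rewrite leq_exp2r // leq_mul2r leK ?orbT //; lia.
  - by rewrite -[12]/(4 * 3)%N expgM expgSS // subsetIl.
  apply: leq_trans Xn; have -> : (I - r = (I - r.+1).+1)%N by lia.
  by rewrite expnS mulnA leq_mul2r tX orbT.
exists X; split=> //; first by apply: approx_leq aX9 _ _ => //; apply: leK; lia.
have gap' h : h \in G -> #|X| <= t ^ 3 * #|F h| -> #|X| <= t * #|F h|.
  by move=> Gh hi; have := gap h Gh; rewrite hi andbT -leqNgt.
move=> g; rewrite -{1}genS => /gen_prodgP[l [c Sc ->]].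
(* Induction on the length of [g] as a word in [S]: a letter leaves the size above [#|X| / t ^ 3],
   and [gap'] lifts it back to [#|X| / t]. *)
elim: l c Sc => [|l IHl] c Sc.
  rewrite big_ord0 conjsg1.
  have aX13 := approx_leq aX (leqnn _) k9; have aD13 := approx_leq aD (leqnn _) kI.
  apply: leq_trans (_ : #|D ^+ 12 :&: X ^+ 12| <= _).
    by rewrite subset_leq_card // subsetI XD -{1}[X]expg1 expg_leS.
  apply: leq_trans (inter_growth aD13 aX13) _; rewrite leq_mul2r -expnS; apply/orP; right.
  have s0 : 0 < sigma.
    by rewrite lt0n; apply: contraTneq nI => ->; rewrite -leqNgt exp0n //; lia.
  apply: leq_trans Kt; apply: leq_trans (leq_pmulr _ s0); apply: leK; lia.
rewrite big_ord_recr /=; set p := \prod_(i < l) _.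
have Gp : p \in G.
  by rewrite -genS; apply: group_prod => i _; apply: mem_gen; apply: Sc.
have Gps : p * c ord_max \in G by rewrite groupM // -genS mem_gen.
apply: gap' => //.
apply: leq_trans (card_conj_cap_shift aD9 aX9 (DS _ (Sc ord_max)) (IHl (fun i => c (widen_ord
  (leqnSn l) i)) (fun i => Sc _))) _.
rewrite /F leq_mul2r [(t ^ 3)%N]expnS leq_mul2l -expnD; apply/orP; right; apply/orP; right.
apply: leq_trans Kt2; apply: leK; lia.
Qed.

End Descent.

Section GroupSums.
Variables (gT : finGroupType) (G : {group gT}).
Local Open Scope ring_scope.

Lemma sum_mulgl (V : nmodType) (F : gT -> V) x : x \in G ->
  \sum_(y in G) F (x * y)%g = \sum_(y in G) F y.
Proof.
move=> Gx; rewrite [RHS](reindex_inj (mulgI x)) /=.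
by apply: eq_bigl => y; rewrite groupMl.
Qed.

Lemma sum_mulgr (V : nmodType) (F : gT -> V) x : x \in G ->
  \sum_(y in G) F (y * x)%g = \sum_(y in G) F y.
Proof.
move=> Gx; rewrite [RHS](reindex_inj (mulIg x)) /=.
by apply: eq_bigl => y; rewrite groupMr.
Qed.

Lemma sum_invg (V : nmodType) (F : gT -> V) :
  \sum_(y in G) F y^-1%g = \sum_(y in G) F y.
Proof.
rewrite [RHS](reindex_inj invg_inj) /=.
by apply: eq_bigl => y; rewrite groupV.
Qed.

End GroupSums.

(** * Popular differences *)

Section PopularDifferences.
Local Open Scope group_scope.
Variables (gT : finGroupType) (G : {group gT}) (A : {set gT}) (K0 K1 : nat).
Hypothesis AG : A \subset G.
Hypothesis A0 : 0 < #|A|.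
Hypothesis K00 : 0 < K0.
Hypothesis A1 : #|A^-1 * A| <= K1 * #|A|.
Let K2 := (2 * K0 ^ 2 * K1)%N.
Implicit Types E : {set gT}.

Let K10 : 0 < K1.
Proof.
rewrite lt0n; apply: contraTneq A1 => ->; rewrite mul0n -ltnNge card_gt0.
have /card_gt0P[a Aa] := A0; apply/set0Pn; exists (a^-1 * a).
by rewrite mem_mulg // mem_invg invgK.
Qed.

Let K20 : 0 < K2. Proof. by rewrite !muln_gt0 K00 K10. Qed.

(** The threshold refers to [#|A|] for every [E], which makes the set increasing in [E]. The factor
    2 in [K2] ensures that unpopular elements account for at most half of the energy in
    [card_popular_differences]. *)
Definition popular_differences (E : {set gT}) : {set gT} :=
  [set g in G | #|A| <= K2 * #|E :&: g *: E|].
Local Notation D := (popular_differences A).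

Lemma popular_differencesS E E' : E \subset E' ->
  popular_differences E \subset popular_differences E'.
Proof.
move=> EE; apply/subsetP => g; rewrite !inE => /andP[-> h] /=; apply: leq_trans h _.
by rewrite leq_mul2l subset_leq_card ?orbT // setISS // lcosetS.
Qed.

Lemma popular_differences_sub E : popular_differences E \subset G.
Proof. by apply/subsetP => g; rewrite inE => /andP[]. Qed.

Lemma popular_differences1 : 1 \in D.
Proof.
rewrite inE group1 /=; have -> : 1 *: A = A by apply/setP => x; rewrite mem_lcoset invg1 mul1g.
by rewrite setIid leq_pmull.
Qed.

Lemma popular_differencesV : D^-1 = D.
Proof.
apply/setP => g; rewrite mem_invg !inE groupV; congr (_ && (_ <= _ * _)).
rewrite -(card_lcoset (A :&: g^-1 *: A) g); congr #|pred_of_set _|.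
by apply/setP => x; rewrite mem_lcoset !inE !mem_lcoset invgK mulKVg andbC.
Qed.

Let pairs d : d \in D -> #|A| <= K2 * #|[set c in A | d * c \in A]|.
Proof.
rewrite inE => /andP[_ h]; apply: leq_trans h _; rewrite leq_mul2l; apply/orP; right.
rewrite -(card_lcoset (A :&: d *: A) d^-1); apply: subset_leq_card; apply/subsetP => x.
by rewrite mem_lcoset invgK !inE mem_lcoset mulKg andbC.
Qed.

(* Writing d = a c^-1 in [#|A| / K2] ways, each [b * d] is a quotient of elements of [B * A] and
   [A] in as many ways. *)
Lemma card_mul_popular (B : {set gT}) : #|B * D| <= K2 * #|B * A|.
Proof.
rewrite -(leq_pmul2r A0) -mulnA -[X in _ <= _ * X]cardsX.
apply: (@fiber_card_ge _ _ (fun p : gT * gT => p.1 * p.2^-1)) => x.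
case/mulsgP => b d Bb Dd ->; apply: leq_trans (pairs Dd) _.
rewrite leq_mul2l; apply/orP; right.
rewrite -(@card_in_imset _ _ (fun c => (b * (d * c), c))); last by move=> c c' _ _ [].
apply: subset_leq_card; apply/subsetP => _ /imsetP[c /setIdP[Ac Adc] ->].
by rewrite !inE /= mem_mulg //= Ac /= !mulgA mulgK.
Qed.

(** With [d = (d c) c^-1], the product [b d a] splits as [b (d c)] in [B * A] times [c^-1 a] in
    [A^-1 * A]. Keeping a factor [A] at the right end lets the bound be iterated over powers of
    [D]. *)
Lemma card_mul_popular_mul (B : {set gT}) : #|B * D * A| <= K1 * K2 * #|B * A|.
Proof.
rewrite -(leq_pmul2r A0).
apply: leq_trans (_ : K2 * #|setX (B * A) (A^-1 * A)| <= _); last first.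
  rewrite cardsX; have -> : (K1 * K2 * #|(B * A)%g| * #|A| =
    K2 * (#|(B * A)%g| * (K1 * #|A|)))%N by ring.
  by rewrite !leq_mul2l A1 !orbT.
apply: (@fiber_card_ge _ _ (fun p : gT * gT => p.1 * p.2)) => x.
case/mulsgP => _ a /mulsgP[b d Bb Dd ->] Aa ->; apply: leq_trans (pairs Dd) _.
rewrite leq_mul2l; apply/orP; right.
rewrite -(@card_in_imset _ _ (fun c => (b * (d * c), c^-1 * a))); last first.
  by move=> c c' _ _ [] /mulgI /mulgI.
apply: subset_leq_card; apply/subsetP => _ /imsetP[c /setIdP[Ac Adc] ->].
rewrite in_set in_setX /= mem_mulg //= mem_mulg ?mem_invg ?invgK //=.
by rewrite !mulgA mulgK.
Qed.

Lemma card_expg_popular k : #|D ^+ k * A| <= (K1 * K2) ^ k * #|A|.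
Proof.
elim: k => [|k IH]; first by rewrite expg0 mul1g expn0 mul1n.
rewrite expgSr expnS -mulnA; apply: leq_trans (card_mul_popular_mul _) _.
by rewrite leq_mul2l IH orbT.
Qed.

Lemma card_expgS_popular k : #|D ^+ k.+1| <= K2 * (K1 * K2) ^ k * #|A|.
Proof.
rewrite expgSr; apply: leq_trans (card_mul_popular _) _.
by rewrite -mulnA leq_mul2l card_expg_popular orbT.
Qed.

(** The quotients [x^-1 y] of [E] lie in a set of size at most [K1 * #|A|], so by Cauchy-Schwarz the
    multiplicative energy is at least [#|E| ^ 4 / (K1 * #|A|)]. Elements with few representations
    [x y^-1] provide at most half of it. *)
Lemma card_popular_differences (E : {set gT}) : E \subset A -> #|A| <= K0 * #|E| ->
  #|A| <= K2 * #|popular_differences E|.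
Proof.
move=> EA AE; have EG := subset_trans EA AG.
pose e x : nat := (x \in E).
pose r g := (\sum_(x in G) e x * e (g^-1 * x)%g)%N.
pose r' q := (\sum_(x in G) e x * e (x * q)%g)%N.
have rE g : r g = #|E :&: g *: E|.
  rewrite /r -sum1_card big_mkcond [RHS]big_mkcond; apply: eq_bigr => x _.
  rewrite inE mem_lcoset /e; case: (boolP (x \in E)) => [Ex|_]; last by rewrite mul0n; case: ifP.
  by rewrite (subsetP EG) //= mul1n; case: (_ \in E).
have sumE : (\sum_(x in G) e x = #|E|)%N.
  rewrite -sum1_card big_mkcond [RHS]big_mkcond; apply: eq_bigr => x _; rewrite /e.
  by case: (boolP (x \in E)) => [Ex|_]; [rewrite (subsetP EG) | case: ifP].
have sumr : (\sum_(g in G) r g = #|E| ^ 2)%N.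
  rewrite exchange_big /= -mulnn -{1}sumE big_distrl /=; apply: eq_bigr => x Gx.
  rewrite -big_distrr /=; congr (_ * _)%N.
  rewrite -sum_invg; under eq_bigr do rewrite invgK.
  by rewrite (sum_mulgr e) // sumE.
have sumr' : (\sum_(q in G) r' q = #|E| ^ 2)%N.
  rewrite exchange_big /= -mulnn -{1}sumE big_distrl /=; apply: eq_bigr => x Gx.
  by rewrite -big_distrr /= (sum_mulgl e) // sumE.
(* Both sides count quadruples: [x y^-1 = z w^-1] exactly when [z^-1 x = w^-1 y]. *)
have energy : (\sum_(g in G) r g ^ 2 = \sum_(q in G) r' q ^ 2)%N.
  transitivity (\sum_(x in G) \sum_(q in G) \sum_(g in G)
      e x * e (g^-1 * x)%g * (e (x * q)%g * e (g^-1 * (x * q))%g))%N.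
    under eq_bigr do rewrite -mulnn big_distrlr /=.
    rewrite exchange_big /=; apply: eq_bigr => x Gx; rewrite exchange_big /=.
    by rewrite -[LHS](sum_mulgl _ Gx).
  rewrite exchange_big /=; apply: eq_bigr => q Gq; rewrite -mulnn big_distrlr /=.
  apply: eq_bigr => x Gx.
  rewrite -sum_invg -[LHS](sum_mulgr _ (groupVr Gx)); apply: eq_bigr => z _.
  by rewrite !invgK mulgKV mulgA mulgKV; ring.
pose Q := E^-1 * E.
have cQ : #|Q| <= K1 * #|A|.
  apply: leq_trans A1; apply: subset_leq_card; apply: mulgSS => //.
  by apply/subsetP => x; rewrite !mem_invg; apply: (subsetP EA).
have QG : Q \subset G.
  by apply: mul_subG => //; apply/subsetP => x; rewrite mem_invg => /(subsetP EG); rewrite groupV.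
have r'Q q : q \in G -> q \notin Q -> r' q = 0%N.
  move=> Gq nQ; apply: big1 => x _; rewrite /e; case: (boolP (x \in E)) => //= Ex.
  case: (boolP (_ \in E)) => // Exq; case/negP: nQ.
  by rewrite -(mulKg x q) mem_mulg // mem_invg invgK.
have QE (F : gT -> nat) : (forall q, q \in G -> q \notin Q -> F q = 0%N) ->
    (\sum_(q in G) F q = \sum_(q in Q) F q)%N.
  move=> F0; rewrite (big_setID Q) /= (setIidPr QG) [X in _ + X]big1 ?addn0 // => q.
  by rewrite inE => /andP[nQ Gq]; apply: F0.
have cs : (#|E| ^ 4 <= K1 * #|A| * \sum_(g in G) r g ^ 2)%N.
  rewrite energy (QE (fun q => r' q ^ 2)%N) => [|q Gq nQ]; last by rewrite r'Q.
  have := sum_nat_sqr_le Q r'; rewrite -QE // sumr' -expnM => h; apply: leq_trans h _.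
  by rewrite leq_mul2r cQ orbT.
set P := popular_differences E.
have PG : P \subset G := popular_differences_sub E.
have split : (K2 * \sum_(g in G) r g ^ 2 <= #|E| ^ 2 * (K2 * #|P| + #|A|))%N.
  rewrite (big_setID P) /= (setIidPr PG) mulnDr mulnDr leq_add //.
    rewrite mulnCA leq_mul2l; apply/orP; right; rewrite mulnC -sum_nat_const.
    apply: leq_sum => g _; rewrite leq_exp2r // rE; apply: subset_leq_card; exact: subsetIl.
  rewrite big_distrr /= -sumr big_distrl /=.
  rewrite [leqRHS](big_setID P) /=; apply: leq_trans (leq_addl _ _).
  apply: leq_sum => g; rewrite !inE => /andP[+ Gg]; rewrite Gg /= -ltnNge -rE => h.
  by rewrite -mulnn mulnCA leq_mul2l ltnW ?orbT.
have E0 : 0 < #|E| by rewrite lt0n; apply: contraTneq AE => ->; rewrite muln0 -ltnNge.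
have key : (K2 * #|E| ^ 2 <= K1 * #|A| * (K2 * #|P| + #|A|))%N.
  have E20 : 0 < #|E| ^ 2 by rewrite expn_gt0 E0.
  rewrite -(leq_pmul2r E20).
  have -> : (K2 * #|E| ^ 2 * #|E| ^ 2 = K2 * #|E| ^ 4)%N by ring.
  have -> : (K1 * #|A| * (K2 * #|P| + #|A|) * #|E| ^ 2 =
    K1 * #|A| * (#|E| ^ 2 * (K2 * #|P| + #|A|)))%N by ring.
  by apply: leq_trans (leq_mul (leqnn K2) cs) _; rewrite mulnCA leq_mul2l split orbT.
have low : (2 * K1 * #|A| ^ 2 <= K2 * #|E| ^ 2)%N.
  have -> : (K2 * #|E| ^ 2 = 2 * K1 * (K0 * #|E|) ^ 2)%N by rewrite /K2; ring.
  by rewrite leq_mul2l leq_exp2r // AE orbT.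
have K1A : 0 < K1 * #|A| by rewrite muln_gt0 K10.
have : (2 * #|A| <= K2 * #|P| + #|A|)%N.
  rewrite -(leq_pmul2l K1A); apply: leq_trans (leq_trans low key).
  by apply: eq_leq; ring.
by rewrite mul2n -addnn leq_add2r.
Qed.

(** A popular difference [g] of [A :&: s *: A] is popular for [A], and so is [g ^ s], because [s^-1]
    carries both ends of a difference from [s *: A] into [A]. *)
Lemma card_popular_conj s : s \in G -> #|A| <= K0 * #|A :&: s *: A| ->
  #|A| <= K2 * #|D :&: D :^ s|.
Proof.
move=> Gs h; apply: leq_trans (card_popular_differences (subsetIl A (s *: A)) h) _.
rewrite leq_mul2l; apply/orP; right.
rewrite -(cardJg _ s); apply: subset_leq_card; apply/subsetP => x.
rewrite mem_conjg => Px; rewrite inE mem_conjg; apply/andP; split; last first.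
  by apply: (subsetP (popular_differencesS (subsetIl A (s *: A)))).
move: Px; rewrite !inE groupJr ?groupV // => /andP[-> hx] /=; apply: leq_trans hx _.
rewrite leq_mul2l; apply/orP; right.
rewrite -(card_lcoset _ s^-1); apply: subset_leq_card; apply/subsetP => w.
rewrite mem_lcoset invgK !inE !mem_lcoset !inE !mem_lcoset mulKg.
case/andP=> /andP[_ ->] /andP[_]; rewrite conjgE invgK !invMg invgK => h2 /=.
by move: h2; rewrite !mulgA mulgKV mulVg mul1g.
Qed.

End PopularDifferences.

Local Open Scope ring_scope.

(** * Hermitian kernels and mixing *)

Lemma le_of_eq (R : numDomainType) (x y : R) : x = y -> x <= y.
Proof. by move->. Qed.


Section Spectral.
Local Open Scope sesquilinear_scope.
Variable R : rcfType.
Local Notation C := R[i]%C.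

(** The spectral theorem in coordinates. The characteristic polynomial is included because [gap]
    reads the eigenvalues off its roots. *)
Lemma hermitian_spectral n (A : 'M[C]_n) :
  (forall x y, A y x = (A x y)^*) ->
  exists (e : 'I_n -> 'I_n -> C) (d : 'I_n -> R),
  [/\ forall i j, \sum_x e i x * (e j x)^* = (i == j)%:R,
      forall x y, \sum_i e i x * (e i y)^* = (x == y)%:R,
      forall i x, \sum_y A x y * e i y = (d i)%:C%C * e i x &
      char_poly A = \prod_i ('X - ((d i)%:C%C)%:P)].
Proof.
move=> hA.
have hermA : A \is hermsymmx.
  apply/is_hermitianmxP; rewrite expr0 scale1r; apply/matrixP => x y.
  by rewrite !mxE -hA.
have /orthomx_spectralP := hermitian_normalmx hermA.
have dR := hermitian_spectral_diag_real hermA.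
have uP := spectral_unitarymx A.
move: (spectralmx A) (spectral_diag A) dR uP => P D dR uP.
rewrite (invmx_unitary uP) => eA.
pose d i := complex.Re (D 0 i).
have dE i : (d i)%:C%C = D 0 i.
  by rewrite /d RRe_real //; move/mxOverP: dR; apply.
exists (fun i x => (P i x)^*), d; split.
- move=> i j; have /unitarymxP /matrixP /(_ j i) := uP.
  rewrite !mxE eq_sym => <-; apply: eq_bigr => x _.
  by rewrite !mxE conjCK mulrC.
- move=> x y.
  have uP' : P^t* *m P = 1%:M.
    by rewrite -(invmx_unitary uP) mulVmx // unitarymx_unit.
  have /matrixP /(_ x y) := uP'.
  rewrite !mxE => <-; apply: eq_bigr => i _.
  by rewrite !mxE conjCK.
- move=> i x; rewrite dE.
  have : A *m P^t* = P^t* *m diag_mx D.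
    by rewrite {1}eA -!mulmxA (unitarymxP uP) mulmx1.
  move/matrixP => /(_ x i); rewrite mul_mx_diag !mxE mulrC => <-.
  by apply: eq_bigr => y _; rewrite !mxE.
rewrite -(eq_bigr _ (fun i _ => congr1 (fun z => 'X - z%:P) (esym (dE i)))).
have -> : \prod_i ('X - (D 0 i)%:P) = char_poly (diag_mx D).
  rewrite char_poly_trig ?diag_mx_is_trig //.
  by apply: eq_bigr => i _; rewrite mxE eqxx mulr1n.
pose P' := P^t*.
have eA' : A = P' *m diag_mx D *m P by [].
have PP : map_mx polyC P' *m map_mx polyC P = 1%:M.
  by rewrite -map_mxM /P' -(invmx_unitary uP) mulVmx ?unitarymx_unit // map_scalar_mx.
rewrite /char_poly.
have -> : char_poly_mx A = map_mx polyC P' *m char_poly_mx (diag_mx D)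
                           *m map_mx polyC P.
  rewrite /char_poly_mx mulmxBr mulmxBl scalar_mxC -(mulmxA _%:M) PP mulmx1.
  by rewrite {1}eA' !map_mxM.
rewrite !det_mulmx mulrAC -det_mulmx PP det1 mul1r.
by [].
Qed.
End Spectral.

Section Sqn.
Variable R : rcfType.
Local Notation C := R[i]%C.

(** The squared modulus as an element of [R], so that estimates are real inequalities. *)
Definition sqn (z : C) : R := complex.Re z ^+ 2 + complex.Im z ^+ 2.

Lemma sqnE (z : C) : (sqn z)%:C%C = z * z^*.
Proof. by rewrite /sqn add_Re2_Im2 normCK. Qed.

Lemma sqn_ge0 z : 0 <= sqn z.
Proof. by rewrite addr_ge0 ?sqr_ge0. Qed.

Lemma sqn0 : sqn 0 = 0.
Proof. by rewrite /sqn /= expr0n /= addr0. Qed.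

Lemma sqn_eq0 z : (sqn z == 0) = (z == 0).
Proof.
by rewrite -(inj_eq (@complexI R)) sqnE mulf_eq0 conjC_eq0 orbb.
Qed.

Lemma sqnM z w : sqn (z * w) = sqn z * sqn w.
Proof. by apply: (@complexI R); rewrite rmorphM /= !sqnE rmorphM /=; ring. Qed.

Lemma sqnC z : sqn z^* = sqn z.
Proof. by apply: (@complexI R); rewrite !sqnE conjCK mulrC. Qed.

Lemma sqnR (x : R) : sqn x%:C%C = x ^+ 2.
Proof. by rewrite /sqn /= expr0n /= addr0. Qed.

Lemma sum_real_complex (I : Type) (r : seq I) (P : pred I) (F : I -> R) :
  (\sum_(i <- r | P i) F i)%:C%C = \sum_(i <- r | P i) (F i)%:C%C.
Proof. exact: rmorph_sum. Qed.

End Sqn.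

Section Spectral.
Variable R : rcfType.
Local Notation C := R[i]%C.

Lemma hermitian_spectral_fun (T : finType) (k : T -> T -> C) :
  (forall x y, k y x = (k x y)^*) ->
  exists (e : T -> T -> C) (d : T -> R),
  [/\ forall i j, \sum_x e i x * (e j x)^* = (i == j)%:R,
      forall x y, \sum_i e i x * (e i y)^* = (x == y)%:R &
      forall i x, \sum_y k x y * e i y = (d i)%:C%C * e i x].
Proof.
move=> hk.
pose A : 'M[C]_#|T| := \matrix_(i, j) k (enum_val i) (enum_val j).
have [|e [d [h1 h2 h3 _]]] := @hermitian_spectral _ _ A.
  by move=> x y; rewrite !mxE -hk.
have bij P := onW_bij P (enum_rank_bij T).
exists (fun i x => e (enum_rank i) (enum_rank x)), (fun i => d (enum_rank i)).
split.
- by move=> i j; rewrite -(inj_eq enum_rank_inj) -h1 (reindex _ (bij _)).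
- by move=> x y; rewrite -(inj_eq enum_rank_inj) -h2 (reindex _ (bij _)).
- move=> i x; rewrite -h3 (reindex _ (bij _)) /=.
  by apply: eq_bigr => y _; rewrite mxE !enum_rankK.
Qed.

End Spectral.

Section Parseval.
Variables (R : rcfType) (T : finType) (k : T -> T -> R[i]%C).
Variables (e : T -> T -> R[i]%C) (d : T -> R).
Hypothesis e2 : forall x y, \sum_i e i x * (e i y)^* = (x == y)%:R.
Hypothesis e3 : forall i x, \sum_y k x y * e i y = (d i)%:C%C * e i x.

Lemma kernel_expansion x y : k x y = \sum_i (d i)%:C%C * e i x * (e i y)^*.
Proof.
under eq_bigr do rewrite -e3 mulr_suml.
rewrite exchange_big /= (bigD1 y) //= [X in _ + X]big1 ?addr0 => [|v nv].
  by under eq_bigr do rewrite -mulrA; rewrite -mulr_sumr e2 eqxx mulr1.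
by under eq_bigr do rewrite -mulrA; rewrite -mulr_sumr e2 (negPf nv) mulr0.
Qed.

Lemma kernel_form (h : T -> R[i]%C) :
  \sum_x \sum_y k x y * h y * (h x)^* =
  (\sum_i d i * sqn (\sum_x e i x * (h x)^*))%:C%C.
Proof.
rewrite sum_real_complex.
under eq_bigr do under eq_bigr do rewrite kernel_expansion !mulr_suml.
under eq_bigr do rewrite exchange_big /=.
rewrite exchange_big /=; apply: eq_bigr => i _; rewrite rmorphM /= sqnE.
rewrite rmorph_sum big_distrlr mulr_sumr /=; apply: eq_bigr => x _.
rewrite mulr_sumr; apply: eq_bigr => y _.
by rewrite rmorphM /= conjCK; ring.
Qed.

Lemma parseval (h : T -> R[i]%C) :
  \sum_i sqn (\sum_x e i x * (h x)^*) = \sum_x sqn (h x).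
Proof.
apply: (@complexI R); rewrite !sum_real_complex.
transitivity (\sum_x \sum_y \sum_i e i x * (e i y)^* * (h x)^* * h y).
  under eq_bigr do rewrite sqnE rmorph_sum big_distrlr /=.
  rewrite exchange_big /=; apply: eq_bigr => x _.
  rewrite exchange_big /=; apply: eq_bigr => y _.
  by apply: eq_bigr => i _; rewrite rmorphM /= conjCK; ring.
apply: eq_bigr => x _; rewrite (bigD1 x) //= [X in _ + X]big1 ?addr0 => [|y ny].
  by rewrite -!mulr_suml e2 eqxx mul1r sqnE mulrC.
by rewrite -!mulr_suml e2 eq_sym (negPf ny) !mul0r.
Qed.

End Parseval.

(* The top eigenspace of the kernel [k] below is a representation of [G] without invariant
   vectors, hence has dimension at least [Delta]; compare with the trace of [k]. *)
Section Mixing.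
Variables (R : rcfType) (gT : finGroupType) (G : {group gT}) (Delta : R).
Local Notation C := R[i]%C.

Definition min_degree :=
  forall (n : nat) (rG : mx_representation C G n),
    mx_irreducible rG -> rker rG :!=: G -> Delta <= n%:R.

Hypothesis minD : min_degree.

Variables (T : finType) (act : gT -> T -> T).
Hypothesis act1 : forall w, act 1%g w = w.
Hypothesis actM :
  {in G &, forall x y, forall w, act (x * y)%g w = act x (act y w)}.

Lemma act_inj x : x \in G -> injective (act x).
Proof.
move=> Gx; apply: (can_inj (g := act x^-1%g)) => w.
by rewrite -actM ?groupV // mulVg act1.
Qed.

Variables f : T -> C.
Hypothesis f0 : forall w, \sum_(x in G) f (act x w) = 0.

Let k (w w' : T) : C := \sum_(x in G) f (act x w) * (f (act x w'))^*.

Let kH w w' : k w' w = (k w w')^*.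
Proof.
by rewrite /k rmorph_sum; apply: eq_bigr => x _; rewrite rmorphM /= conjCK mulrC.
Qed.

Let kG g w w' : g \in G -> k (act g w) (act g w') = k w w'.
Proof.
move=> Gg; rewrite /k [RHS](reindex_inj (mulIg g)) /=.
apply: eq_big => [x|x Gx]; first by rewrite groupMr.
by rewrite !actM.
Qed.

Lemma mixing_top_eigenspace (e : T -> T -> C) (d : T -> R) (mu : R) :
  (forall i j, \sum_x e i x * (e j x)^* = (i == j)%:R) ->
  (forall x y, \sum_i e i x * (e i y)^* = (x == y)%:R) ->
  (forall i x, \sum_y k x y * e i y = (d i)%:C%C * e i x) ->
  mu != 0 -> (exists i, d i = mu) ->
  Delta <= #|[set i | d i == mu]|%:R.
Proof.
move=> e1 e2 e3 mu0 [i0 di0].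
set I := [set i | d i == mu].
(* Matrix coefficients of the action in the eigenbasis. As the action preserves [k], they vanish
   between different eigenvalues, so the [mu]-eigenspace spanned by [I] is a representation. *)
pose c g i j := \sum_w e i (act g w) * (e j w)^*.
have expand g i w : e i (act g w) = \sum_j c g i j * e j w.
  rewrite /c; under eq_bigr do rewrite mulr_suml.
  rewrite exchange_big /= (bigD1 w) //=.
  under eq_bigr do rewrite -mulrA [_^* * _]mulrC.
  rewrite -mulr_sumr e2 eqxx mulr1 big1 ?addr0 // => v nv.
  under eq_bigr do rewrite -mulrA [_^* * _]mulrC.
  by rewrite -mulr_sumr e2 eq_sym (negPf nv) mulr0.
have dc g i j : g \in G -> c g i j * (d j)%:C%C = (d i)%:C%C * c g i j.
  move=> Gg; rewrite /c mulr_suml mulr_sumr.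
  transitivity (\sum_w \sum_v e i (act g w) * ((k w v)^* * (e j v)^*)).
    apply: eq_bigr => w _; rewrite -mulr_sumr -mulrA; congr (_ * _).
    have -> : (e j w)^* * (d j)%:C%C = ((d j)%:C%C * e j w)^*.
      rewrite rmorphM /= mulrC; congr (_ * _).
      by apply/esym/CrealP; apply/complex_realP; exists (d j).
    rewrite -e3 rmorph_sum; apply: eq_bigr => v _; exact: rmorphM.
  rewrite exchange_big /=; apply: eq_bigr => v _.
  rewrite mulrA -e3 mulr_suml.
  rewrite [RHS](reindex_inj (act_inj Gg)) /=.
  by apply: eq_bigr => w _; rewrite kG // (kH w v); ring.
have c0 g i j : g \in G -> i \in I -> j \notin I -> c g i j = 0.
  move=> Gg; rewrite !inE => /eqP di dj; have := dc g i j Gg.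
  rewrite di mulrC => /eqP; rewrite -subr_eq0 -mulrBl mulf_eq0 => /orP[|/eqP //].
  by rewrite -rmorphB /= (fmorph_eq0 (real_complex R)) subr_eq0 (negPf dj).
have expandI g i w : g \in G -> i \in I ->
    e i (act g w) = \sum_(j in I) c g i j * e j w.
  move=> Gg Ii; rewrite expand (bigID [in I]) /= [X in _ + X]big1 ?addr0 //.
  by move=> j nj; rewrite c0 // mul0r.
pose rho g : 'M[C]_#|I| := \matrix_(a, b) c g (enum_val a) (enum_val b).
have rhoP : mx_repr G rho.
  split=> [|g h Gg Gh]; apply/matrixP => a b; rewrite !mxE.
    rewrite /c; under eq_bigr do rewrite act1.
    by rewrite e1 (inj_eq enum_val_inj).
  rewrite {1}/c; under eq_bigr do rewrite actM // expandI ?enum_valP //.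
  under eq_bigr do rewrite mulr_suml.
  rewrite exchange_big /= big_enum_val /=.
  apply: eq_bigr => j _; rewrite !mxE [c h _ _]/c mulr_sumr.
  by apply: eq_bigr => w _; rewrite mulrA.
pose rG := MxRepresentation rhoP.
have Ii0 : i0 \in I by rewrite inE di0.
have I0 : (1%:M : 'M[C]_#|I|) != 0.
  apply/eqP => /matrixP /(_ (enum_rank_in Ii0 i0) (enum_rank_in Ii0 i0)).
  by rewrite !mxE eqxx => /eqP; rewrite oner_eq0.
(* If a simple submodule had kernel [G], a nonzero row [v] of it would be fixed by [G] and yield an
   invariant function [u] in the eigenspace. *)
apply: (mxsimple_exists (mxmodule1 rG) I0) => -[M simM _].
have modM := mxsimple_module simM.
have irr : mx_irreducible (submod_repr modM) by apply/submod_mx_irr.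
apply: le_trans (_ : (\rank M)%:R <= _); last by rewrite ler_nat rank_leq_row.
apply: (minD irr); apply/negP => /eqP kerG.
have [_ nzM _] := simM.
have [j nzj] : exists j, row j M != 0.
  by apply/existsP; apply: contraR nzM; rewrite negb_exists => /forallP h;
     apply/eqP/row_matrixP => j; rewrite row0; apply/eqP; rewrite -[_ == _]negbK h.
pose v := row j M.
have vg g : g \in G -> v *m rho g = v.
  move=> Gg; have : g \in rker (submod_repr modM) by rewrite kerG.
  rewrite inE Gg /= mul1mx => /eqP rg1.
  have sv : (v <= M)%MS by apply: row_sub.
  rewrite -[in LHS](in_submodK sv) -[RHS](in_submodK sv).
  have -> : rho g = rG g by [].
  by rewrite -(val_submodJ modM) // rg1 mulmx1.
pose u w := \sum_(i in I) v 0 (enum_rank_in Ii0 i) * e i w.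
have ug g w : g \in G -> u (act g w) = u w.
  move=> Gg; rewrite /u.
  under eq_bigr => i Hi do rewrite expandI // mulr_sumr.
  rewrite exchange_big /=; apply: eq_bigr => l Il.
  under eq_bigr do rewrite mulrA.
  rewrite -mulr_suml; congr (_ * _).
  have /matrixP /(_ 0 (enum_rank_in Ii0 l)) := vg g Gg.
  rewrite mxE => <-; rewrite big_enum_val; apply: eq_bigr => a _.
  by rewrite enum_valK_in; congr (_ * _); rewrite /rho mxE enum_rankK_in.
have ku w : \sum_w' k w w' * u w' = mu%:C%C * u w.
  rewrite /u mulr_sumr; under eq_bigr do rewrite mulr_sumr.
  rewrite exchange_big /=; apply: eq_bigr => i; rewrite inE => /eqP di.
  under eq_bigr do rewrite mulrCA.
  by rewrite -mulr_sumr e3 di; ring.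
(* For invariant [u] the pairing of a translate of [f] with [u] does not depend on [x]; it factors
   out of the sum over the orbit, which vanishes by [f0]. As [mu != 0], [u] is zero. *)
have ku0 w : \sum_w' k w w' * u w' = 0.
  under eq_bigr do rewrite /k mulr_suml.
  rewrite exchange_big /=.
  transitivity (\sum_(x in G) f (act x w) * \sum_w' (f w')^* * u w').
    apply: eq_bigr => x Gx; rewrite [in RHS](reindex_inj (act_inj Gx)) mulr_sumr.
    by apply: eq_bigr => w' _; rewrite ug // mulrA.
  by rewrite -mulr_suml f0 mul0r.
have u0 w : u w = 0.
  apply/eqP; have /eqP := ku0 w; rewrite ku mulf_eq0.
  by rewrite (fmorph_eq0 (real_complex R)) (negPf mu0).
case/negP: nzj; apply/eqP/rowP => a; rewrite [RHS]mxE.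
have : \sum_w u w * (e (enum_val a) w)^* = v 0 a.
  under eq_bigr do rewrite /u mulr_suml.
  rewrite exchange_big /= (bigD1 (enum_val a)) ?enum_valP //=.
  under eq_bigr do rewrite -mulrA.
  rewrite -mulr_sumr e1 eqxx mulr1 enum_valK_in big1 ?addr0 // => i /andP[_ ni].
  under eq_bigr do rewrite -mulrA.
  by rewrite -mulr_sumr e1 (negPf ni) mulr0.
by rewrite big1 => [<-//|w _]; rewrite u0 mul0r.
Qed.

Lemma mixing (h : T -> C) : 0 <= Delta ->
  Delta * \sum_(x in G) sqn (\sum_w f (act x w) * (h w)^*)
  <= #|G|%:R * (\sum_w sqn (f w)) * (\sum_w sqn (h w)).
Proof.
move=> D0; have [e [d [e1 e2 e3]]] := hermitian_spectral_fun kH.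
have dE i : d i = \sum_(x in G) sqn (\sum_w f (act x w) * (e i w)^*).
  apply: (@complexI R); rewrite sum_real_complex.
  have -> : (d i)%:C%C = \sum_w (d i)%:C%C * e i w * (e i w)^*.
    by under eq_bigr do rewrite -mulrA; rewrite -mulr_sumr e1 eqxx mulr1.
  under eq_bigr do rewrite -e3 mulr_suml.
  under eq_bigr do under eq_bigr do rewrite /k !mulr_suml.
  under eq_bigr do rewrite exchange_big /=.
  rewrite exchange_big /=; apply: eq_bigr => x Gx; rewrite sqnE rmorph_sum.
  rewrite big_distrlr /=; apply: eq_bigr => w _; apply: eq_bigr => w' _.
  by rewrite rmorphM /= conjCK; ring.
have d_ge0 i : 0 <= d i by rewrite dE sumr_ge0 // => x _; apply: sqn_ge0.
have sumd : \sum_i d i = #|G|%:R * \sum_w sqn (f w).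
  apply: (@complexI R); rewrite sum_real_complex.
  transitivity (\sum_w k w w).
    under [RHS]eq_bigr do rewrite (kernel_expansion e2 e3).
    rewrite exchange_big /=; apply: eq_bigr => i _.
    by under eq_bigr do rewrite -mulrA; rewrite -mulr_sumr e1 eqxx mulr1.
  rewrite /k exchange_big /= rmorphM /= rmorph_nat.
  transitivity (\sum_(x in G) (\sum_w sqn (f w))%:C%C).
    apply: eq_bigr => x Gx; rewrite sum_real_complex.
    rewrite [RHS](reindex_inj (act_inj Gx)) /=.
    by apply: eq_bigr => w _; rewrite sqnE.
  by rewrite sumr_const mulr_natl.
have hE : \sum_(x in G) sqn (\sum_w f (act x w) * (h w)^*)
    = \sum_i d i * sqn (\sum_w e i w * (h w)^*).
  apply: (@complexI R); rewrite -(kernel_form e2 e3) sum_real_complex.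
  under [RHS]eq_bigr do under eq_bigr do rewrite /k !mulr_suml.
  under [RHS]eq_bigr do rewrite exchange_big /=.
  rewrite [RHS]exchange_big /=; apply: eq_bigr => x Gx; rewrite sqnE rmorph_sum.
  rewrite big_distrlr /=; apply: eq_bigr => w _; apply: eq_bigr => w' _.
  by rewrite rmorphM /= conjCK; ring.
rewrite hE -sumd -(parseval e2 h).
have [w0 _|T0] := pickP (@predT T); last first.
  by rewrite big1 ?mulr0 ?mulr_ge0 ?sumr_ge0 // => i _; rewrite ?sqn_ge0 //; have := T0 i.
have [i0 i0max] : exists i0, forall i, d i <= d i0.
  by case: (@arg_maxP _ _ _ w0 predT d isT) => i0 _ h0; exists i0 => i; apply: h0.
have [mu0|mu0] := eqVneq (d i0) 0.
  rewrite big1 ?mulr0 ?mulr_ge0 ?sumr_ge0 // => i _; rewrite ?sqn_ge0 //.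
  have := i0max i; rewrite mu0 => di.
  by rewrite (le_anti (_ : d i <= 0 <= d i)) ?mul0r // di d_ge0.
have D := @mixing_top_eigenspace e d (d i0) e1 e2 e3 mu0 (ex_intro _ i0 erefl).
have muD : Delta * d i0 <= \sum_i d i.
  apply: le_trans (_ : #|[set i | d i == d i0]|%:R * d i0 <= _).
    by rewrite ler_wpM2r.
  rewrite [leRHS](bigID (fun i => d i == d i0)) /=.
  rewrite -[leLHS]addr0 lerD ?sumr_ge0 //.
  rewrite (eq_bigr (fun=> d i0)) => [|i /eqP //].
  rewrite mulr_natl -sumr_const; apply: le_of_eq.
  by apply: eq_bigl => i; rewrite inE.
apply: le_trans (_ : Delta * (d i0 * \sum_i sqn (\sum_w e i w * (h w)^*)) <= _).
  rewrite ler_wpM2l // mulr_sumr ler_sum // => i _.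
  by rewrite ler_wpM2r ?sqn_ge0 // i0max.
by rewrite mulrA ler_wpM2r // sumr_ge0 // => i _; apply: sqn_ge0.
Qed.

End Mixing.

(** * The spectral gap *)

Section SecondEigenvalue.
Variable R : realType.
Local Notation C := R[i]%C.

(** Links the sorted list in [gap] with an eigenbasis: [i0] and [i1] index the first two entries. *)
Lemma sorted_eigenvalues n (A : 'M[C]_n) (d : 'I_n -> R) : (1 < n)%N ->
  char_poly A = \prod_i ('X - ((d i)%:C%C)%:P) ->
  exists i0 i1 : 'I_n, [/\ i0 != i1,
    nth 0 (sort >=%R [seq complex.Re z | z <- eigenvalues A]) 1 = d i1,
    d i1 <= d i0 & forall i, i != i0 -> d i <= d i1].
Proof.
move=> n1 cpA.
have eigE : perm_eq (eigenvalues A) [seq (d i)%:C%C | i <- enum 'I_n].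
  apply: prod_XsubC_eq; rewrite /eigenvalues.
  case: (closed_field_poly_normal _) => /= r rE.
  have := rE; rewrite (monicP (char_poly_monic A)) scale1r => <-.
  by rewrite cpA big_map big_enum.
pose r : rel 'I_n := fun i j => d i >= d j.
pose s := sort r (enum 'I_n).
have ps : perm_eq s (enum 'I_n) by rewrite perm_sort.
have szs : size s = n by rewrite size_sort size_enum_ord.
have us : uniq s by rewrite sort_uniq enum_uniq.
have ss : sorted r s.
  by apply: sort_sorted => i j; rewrite /r; apply: le_total.
have rtr : transitive r by move=> i j k; rewrite /r => h1 h2; apply: le_trans h1.
pose z0 : 'I_n := Ordinal (ltnW n1).
exists (nth z0 s 0), (nth z0 s 1); split.
- by rewrite nth_uniq ?szs // (ltnW n1).
- have -> : sort >=%R [seq complex.Re z | z <- eigenvalues A] = map d s.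
    apply: (@sorted_eq _ >=%R).
    + by move=> x y z h1 h2; apply: le_trans h1.
    + by move=> x y; rewrite andbC => /le_anti.
    + by apply: sort_sorted => x y; rewrite /= orbC le_total.
    + by rewrite sorted_map.
    rewrite perm_sort; apply: (perm_trans (perm_map _ eigE)).
    rewrite -map_comp (eq_map (_ : _ =1 d)) //.
    by rewrite perm_sym perm_map.
  by rewrite (nth_map z0) ?szs.
- by apply: (sorted_leq_nth rtr (fun x => lexx _) z0 ss); rewrite ?inE ?szs // (ltnW n1).
move=> i ni; have ins : i \in s by rewrite mem_sort mem_enum.
rewrite -(nth_index z0 ins).
apply: (sorted_leq_nth rtr (fun x => lexx _) z0 ss); rewrite ?inE ?szs //.
  by apply: leq_trans (_ : size s <= n)%N; rewrite ?index_mem ?szs.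
rewrite lt0n; apply: contra ni => /eqP ix.
by rewrite -(nth_index z0 ins) ix.
Qed.

Variables (n : nat) (A : 'M[C]_n).
Hypothesis hA : forall x y, A y x = (A x y)^*.
Hypothesis A1 : forall x, \sum_y A x y = 1.
Hypothesis n1 : (1 < n)%N.
Definition qform (v : 'I_n -> C) := \sum_x \sum_y A x y * v y * (v x)^*.
Hypothesis A_le : forall v, `|complex.Re (qform v)| <= \sum_x sqn (v x).

Let spec : exists (e : 'I_n -> 'I_n -> C) (d : 'I_n -> R),
  [/\ forall i j, \sum_x e i x * (e j x)^* = (i == j)%:R,
      forall x y, \sum_i e i x * (e i y)^* = (x == y)%:R,
      forall i x, \sum_y A x y * e i y = (d i)%:C%C * e i x,
      (forall v, complex.Re (qform v) = \sum_i d i * sqn (\sum_x e i x * (v x)^*)) &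
      char_poly A = \prod_i ('X - ((d i)%:C%C)%:P)].
Proof.
have [e [d [e1 e2 e3 cA]]] := hermitian_spectral hA.
exists e, d; split=> // v.
by rewrite /qform (kernel_form e2 e3 v).
Qed.

Let basis_coef (e : 'I_n -> 'I_n -> C) (a : C) i j :
  (forall i j, \sum_x e i x * (e j x)^* = (i == j)%:R) ->
  \sum_x e i x * (a * e j x)^* = a^* * (i == j)%:R.
Proof.
move=> e1; rewrite -e1 mulr_sumr; apply: eq_bigr => x _.
by rewrite rmorphM /=; ring.
Qed.

Let l2 := nth 0 (sort >=%R [seq complex.Re z | z <- eigenvalues A]) 1.

(** The span of the two top eigenvectors is two-dimensional, hence contains a nonzero vector of mean
    zero, and on this span the form is at least [l2] times the norm. *)
Lemma second_eigenvalue_vector :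
  exists v : 'I_n -> C, [/\ \sum_x v x = 0, 0 < \sum_x sqn (v x) &
    l2 * \sum_x sqn (v x) <= complex.Re (qform v)].
Proof.
have [e [d [e1 e2 e3 eq cA]]] := spec.
have [i0 [i1 [ni l2E le10 _]]] := sorted_eigenvalues n1 cA.
pose a := \sum_x e i0 x; pose b := \sum_x e i1 x.
have [p [q [pq0 pqab]]] : exists p q : C, (p != 0) || (q != 0) /\ p * a + q * b = 0.
  have [b0|b0] := eqVneq b 0.
    by exists 0, 1; rewrite oner_eq0 orbT b0 mul0r mulr0 addr0.
  by exists b, (- a); rewrite b0 /=; split=> //; ring.
pose v x := p * e i0 x + q * e i1 x.
have vc i : \sum_x e i x * (v x)^* = p^* * (i == i0)%:R + q^* * (i == i1)%:R.
  rewrite -(basis_coef p i i0 e1) -(basis_coef q i i1 e1) -big_split.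
  by apply: eq_bigr => x _; rewrite rmorphD /= mulrDr.
have vn (g : 'I_n -> R) : \sum_i g i * sqn (\sum_x e i x * (v x)^*)
    = g i0 * sqn p + g i1 * sqn q.
  have ni' : i1 != i0 by rewrite eq_sym.
  rewrite (bigD1 i0) //= [X in _ + X](bigD1 i1) //=.
  rewrite !vc !eqxx (negPf ni) (negPf ni') !mulr0 !mulr1 addr0 add0r !sqnC.
  rewrite big1 ?addr0 // => i /andP[h0 h1].
  by rewrite vc (negPf h0) (negPf h1) !mulr0 addr0 sqn0 mulr0.
have nv : \sum_x sqn (v x) = sqn p + sqn q.
  rewrite -(parseval e2) -[RHS]mul1r mulrDr -(vn (fun=> 1)).
  by under [RHS]eq_bigr do rewrite mul1r.
exists v; split.
- by rewrite big_split /= -!mulr_sumr.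
- rewrite nv; have := sqn_ge0 p; have := sqn_ge0 q.
  case/orP: pq0; rewrite -sqn_eq0 => h; rewrite lt0r.
    by move=> q0 p0; rewrite addr_ge0 // paddr_eq0 // (negPf h).
  by move=> q0 p0; rewrite addr_ge0 // paddr_eq0 // (negPf h) andbF.
rewrite eq vn nv mulrDr /l2 l2E lerD2r ler_wpM2r ?sqn_ge0 //.
Qed.

Let d_le (e : 'I_n -> 'I_n -> C) (d : 'I_n -> R) i :
  (forall i j, \sum_x e i x * (e j x)^* = (i == j)%:R) ->
  (forall x y, \sum_i e i x * (e i y)^* = (x == y)%:R) ->
  (forall v, complex.Re (qform v) = \sum_i d i * sqn (\sum_x e i x * (v x)^*)) ->
  `|d i| <= 1.
Proof.
move=> e1 e2 eq; have := A_le (e i).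
rewrite eq -(parseval e2) (bigD1 i) //= [X in _ <= X](bigD1 i) //= e1 eqxx.
rewrite !big1 => [|j nj|j nj]; first by rewrite /sqn /= expr0n expr1n !addr0 mulr1.
  by rewrite e1 (negPf nj) sqn0.
by rewrite e1 (negPf nj) sqn0 mulr0.
Qed.

(** If the first two eigenvalues agree, [l2] is the maximum of the form. Otherwise all eigenvalues
    but that of [e i0] are below 1, while constants have eigenvalue 1; so constants are multiples of
    [e i0], and [v] has no component along it. *)
Lemma second_eigenvalue_max (v : 'I_n -> C) : \sum_x v x = 0 ->
  complex.Re (qform v) <= l2 * \sum_x sqn (v x).
Proof.
move=> v0; have [e [d [e1 e2 e3 eq cA]]] := spec.
have [i0 [i1 [ni l2E le10 le1]]] := sorted_eigenvalues n1 cA.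
rewrite eq -(parseval e2) mulr_sumr /l2 l2E; apply: ler_sum => i _.
have [->{i}|ni0] := eqVneq i i0; last by rewrite ler_wpM2r ?sqn_ge0 // le1.
have [le01|lt10] := leP (d i0) (d i1); first by rewrite ler_wpM2r ?sqn_ge0.
suff -> : \sum_x e i0 x * (v x)^* = 0 by rewrite sqn0 !mulr0.
pose c i := \sum_x e i x.
have dc i : (d i)%:C%C * c i = c i.
  rewrite /c mulr_sumr; under eq_bigr do rewrite -e3.
  rewrite exchange_big /=; apply: eq_bigr => y _.
  rewrite -mulr_suml (_ : \sum_x A x y = 1) ?mul1r //.
  have -> : \sum_x A x y = (\sum_x A y x)^*.
    by rewrite rmorph_sum; apply: eq_bigr => x _; apply: hA.
  by rewrite A1 rmorph1.
have c0 i : i != i0 -> c i = 0.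
  move=> nii; have /eqP := dc i.
  rewrite -subr_eq0 -[X in _ - X]mul1r -mulrBl mulf_eq0 => /orP[|/eqP//].
  rewrite -(rmorph1 (real_complex R)) -rmorphB fmorph_eq0 subr_eq0 => /eqP di.
  have := le1 i nii; rewrite di => h.
  have := d_le i0 e1 e2 eq; rewrite ler_norml => /andP[_ h'].
  by have := le_lt_trans h (lt_le_trans lt10 h'); rewrite ltxx.
have oneE y : 1 = \sum_i (c i)^* * e i y.
  transitivity (\sum_x \sum_i e i y * (e i x)^*).
    by rewrite (eq_bigr _ (fun x _ => e2 y x)) (bigD1 y) //= eqxx big1 ?addr0 // => x;
       rewrite eq_sym => /negPf ->.
  rewrite exchange_big /=; apply: eq_bigr => i _.
  by rewrite -mulr_sumr -rmorph_sum mulrC.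
have oneE0 y : 1 = (c i0)^* * e i0 y.
  rewrite {1}(oneE y) (bigD1 i0) //= big1 ?addr0 // => i nii.
  by rewrite (c0 _ nii) conjC0 mul0r.
have ci0 : (c i0)^* != 0.
  apply/eqP => h; have := oneE0 (Ordinal (ltnW n1)).
  by rewrite h mul0r => /eqP; rewrite oner_eq0.
apply: (mulfI ci0); rewrite mulr0 mulr_sumr.
under eq_bigr do rewrite mulrA -oneE0 mul1r.
by rewrite -rmorph_sum v0 rmorph0.
Qed.

Lemma second_eigenvalue_bounds : -1 <= l2 <= 1.
Proof.
have [e [d [e1 e2 e3 eq cA]]] := spec.
have [i0 [i1 [ni l2E _ _]]] := sorted_eigenvalues n1 cA.
by rewrite /l2 l2E -ler_norml (d_le i1 e1 e2 eq).
Qed.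

End SecondEigenvalue.

Lemma sqnD (R : rcfType) (a b : R[i]%C) :
  sqn (a + b) = sqn a + sqn b + complex.Re (a * b^* + b * a^*).
Proof. by case: a b => [a1 a2] [b1 b2]; rewrite /sqn /=; ring. Qed.

Lemma sqnB (R : rcfType) (a b : R[i]%C) :
  sqn (a - b) = sqn a + sqn b - complex.Re (a * b^* + b * a^*).
Proof. by case: a b => [a1 a2] [b1 b2]; rewrite /sqn /=; ring. Qed.

Section CayleyGap.
Variables (R : realType) (hT : finGroupType) (H : {group hT}) (s : seq hT).
Local Notation C := R[i]%C.
Hypothesis sH : {subset s <= H}.
Hypothesis s0 : (0 < size s)%N.
Hypothesis H1 : (1 < #|H|)%N.

Local Notation A := (cayley_mx R H s).
Let c : C := (2 * size s)%N%:R^-1.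

Let hA x y : A y x = (A x y)^*.
Proof.
rewrite !mxE rmorphM /= fmorphV rmorph_nat; congr (_ * _).
rewrite rmorph_sum; apply: eq_bigr => z _; rewrite rmorphD /= !rmorph_nat addrC.
have sym (a b u : hT) : (a == u * b)%g = (b == u^-1 * a)%g.
  by apply/eqP/eqP => ->; rewrite ?mulKg ?mulKVg.
by congr ((nat_of_bool _)%:R + (nat_of_bool _)%:R); rewrite sym ?invgK.
Qed.

Let row_sum (f : hT -> C) g : g \in H ->
  \sum_j A (enum_rank_in (group1 H) g) j * f (enum_val j)
  = c * \sum_(x <- s) (f (x * g)%g + f (x^-1 * g)%g).
Proof.
move=> Hg; under eq_bigr do rewrite mxE -mulrA.
rewrite -mulr_sumr enum_rankK_in //; congr (_ * _).
under eq_bigr do rewrite mulr_suml.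
rewrite exchange_big /= big_seq [RHS]big_seq; apply: eq_bigr => x /sH Hx.
rewrite -(big_enum_val (fun g' => ((g' == x * g)%g%:R + (g' == x^-1 * g)%g%:R) * f g')).
have pick y : y \in H -> \sum_(g' in H) (g' == y)%:R * f g' = f y.
  move=> Hy; rewrite (bigD1 y) //= eqxx mul1r big1 ?addr0 // => z /andP[_ nz].
  by rewrite (negPf nz) mul0r.
under eq_bigr do rewrite mulrDl.
by rewrite big_split /= !pick ?groupM ?groupV.
Qed.

Let A1 i : \sum_j A i j = 1.
Proof.
have := row_sum (fun=> 1) (enum_valP i); rewrite enum_valK_in.
under eq_bigr do rewrite mulr1.
move=> ->; rewrite big_const_seq count_predT iter_addr_0 /c.
rewrite (_ : (1 + 1) *+ size s = (2 * size s)%N%:R :> C); last by rewrite natrM mulr_natr.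
by rewrite mulVf // pnatr_eq0 -lt0n muln_gt0.
Qed.

Let mean (f : hT -> C) := \sum_(x <- s) \sum_(g in H) (f (x * g)%g + f (x^-1 * g)%g) * (f g)^*.

Let qformE (f : hT -> C) : qform A (fun i => f (enum_val i)) = c * mean f.
Proof.
rewrite /mean exchange_big mulr_sumr /= big_enum_val; apply: eq_bigr => i _.
rewrite -mulr_suml; have := row_sum f (enum_valP i); rewrite enum_valK_in => ->.
by rewrite -mulrA mulr_suml.
Qed.

Let shift_sum (g : hT -> R) x : x \in H ->
  \sum_(y in H) g (x * y)%g = \sum_(y in H) g y.
Proof.
move=> Hx; rewrite [RHS](reindex_inj (mulgI x)) /=.
by apply: eq_bigl => y; rewrite groupMl.
Qed.

(** The Dirichlet form: [2 * size s] times the form of the identity minus [cayley_mx]. The term of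
    [x] accounts for both [x] and [x^-1]. *)
Definition displacement (f : hT -> C) :=
  \sum_(x <- s) \sum_(g in H) sqn (f (x * g)%g - f g).

Let mean_inv (f : hT -> C) : mean f =
  (\sum_(x <- s) \sum_(g in H)
    complex.Re (f (x * g)%g * (f g)^* + f g * (f (x * g)%g)^* ))%:C%C.
Proof.
rewrite /mean sum_real_complex; rewrite big_seq [RHS]big_seq.
apply: eq_bigr => x /sH Hx.
rewrite sum_real_complex.
under eq_bigr do rewrite mulrDl.
rewrite big_split /= [X in _ + X](reindex_inj (mulgI x)) /=.
rewrite [X in _ + X](eq_bigl [in H]) => [|y]; last by rewrite groupMl.
rewrite -big_split /=; apply: eq_bigr => y _; rewrite mulKg.
apply/esym/RRe_real/CrealP.
by rewrite rmorphD !rmorphM /= !conjCK addrC mulrC [X in _ + X]mulrC.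
Qed.

Let m0 : 0 < 2 * (size s)%:R :> R.
Proof. by rewrite mulr_gt0 ?ltr0n. Qed.

Let qform_Re (f : hT -> C) : 2 * (size s)%:R * complex.Re (qform A (fun i => f (enum_val i)))
  = \sum_(x <- s) \sum_(g in H)
      complex.Re (f (x * g)%g * (f g)^* + f g * (f (x * g)%g)^* ).
Proof.
have cE : c = (((2 * size s)%N%:R)^-1 : R)%:C%C by rewrite fmorphV rmorph_nat.
have ReM (a b : R) : complex.Re (a%:C%C * b%:C%C) = a * b by rewrite -rmorphM.
rewrite qformE mean_inv cE ReM natrM mulrA mulfV ?mul1r //.
by rewrite lt0r_neq0.
Qed.

Let sqn_sum (f : hT -> C) : 2 * (size s)%:R * (\sum_(g in H) sqn (f g)) =
  \sum_(x <- s) \sum_(g in H) (sqn (f (x * g)%g) + sqn (f g)).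
Proof.
have -> : 2 * (size s)%:R * (\sum_(g in H) sqn (f g)) = \sum_(x <- s) 2 * (\sum_(g in H) sqn (f g)).
  by rewrite big_const_seq count_predT iter_addr_0 -mulr_natr; ring.
rewrite big_seq [RHS]big_seq; apply: eq_bigr => x /sH Hx.
rewrite [RHS]big_split /=.
have := shift_sum (fun g => sqn (f g)) Hx => /= ->.
by rewrite -[X in _ = X + X]mul1r -mulrDl.
Qed.

Let displacementE (f : hT -> C) : displacement f =
  2 * (size s)%:R * (\sum_(g in H) sqn (f g) - complex.Re (qform A (fun i => f (enum_val i)))).
Proof.
rewrite mulrBr qform_Re sqn_sum -sumrB; apply: eq_bigr => x _.
by rewrite -sumrB; apply: eq_bigr => g _; rewrite sqnB.
Qed.

Let qform_le (v : 'I_#|H| -> C) : `|complex.Re (qform A v)| <= \sum_x sqn (v x).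
Proof.
pose f g := v (enum_rank_in (group1 H) g).
have vE : (fun i => f (enum_val i)) =1 v by move=> i; rewrite /f enum_valK_in.
have -> : qform A v = qform A (fun i => f (enum_val i)).
  by apply: eq_bigr => i _; apply: eq_bigr => j _; rewrite !vE.
have -> : \sum_x sqn (v x) = \sum_(g in H) sqn (f g).
  by rewrite [RHS]big_enum_val; apply: eq_bigr => i _; rewrite -vE.
rewrite ler_norml -subr_ge0 -[X in _ && X]subr_ge0 opprK.
rewrite -(pmulr_rge0 _ m0) -[X in _ && X](pmulr_rge0 _ m0) -displacementE.
rewrite mulrDr qform_Re sqn_sum -big_split /=; apply/andP; split; last first.
  by apply: sumr_ge0 => x _; apply: sumr_ge0 => g _; apply: sqn_ge0.
apply: sumr_ge0 => x _; rewrite -big_split; apply: sumr_ge0 => g _ /=.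
by rewrite addrC -sqnD sqn_ge0.
Qed.

Lemma gap_bounds : 0 <= gap R H s <= 2.
Proof.
have /andP[l1 l2] := second_eigenvalue_bounds hA H1 qform_le.
rewrite /gap subr_ge0 l2 lerBlDr -lerBlDl.
by have -> : 1 - 2 = -1 :> R by ring.
Qed.

Lemma gap_vector : exists f : hT -> C,
  [/\ forall g, g \notin H -> f g = 0, \sum_(g in H) f g = 0,
      0 < \sum_(g in H) sqn (f g) &
      displacement f <= 2 * (size s)%:R * gap R H s * \sum_(g in H) sqn (f g)].
Proof.
have [v [v0 nv vq]] := second_eigenvalue_vector hA H1.
pose f g := if g \in H then v (enum_rank_in (group1 H) g) else 0.
have vE i : f (enum_val i) = v i by rewrite /f enum_valP enum_valK_in.
have nE : \sum_(g in H) sqn (f g) = \sum_i sqn (v i).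
  by rewrite big_enum_val; apply: eq_bigr => i _; rewrite vE.
exists f; split=> [g /negPf Hg | | |]; first by rewrite /f Hg.
- by rewrite big_enum_val -[RHS]v0; apply: eq_bigr => i _; rewrite vE.
- by rewrite nE.
rewrite displacementE -[leRHS]mulrA (ler_pM2l m0) nE [leRHS]mulrBl mul1r lerD2l lerN2.
apply: le_trans vq _; apply: le_of_eq.
by congr complex.Re; apply: eq_bigr => i _; apply: eq_bigr => j _; rewrite !vE.
Qed.

Lemma gap_poincare (F : hT -> R) : \sum_(g in H) F g = 0 ->
  2 * (size s)%:R * gap R H s * \sum_(g in H) F g ^+ 2 <=
  \sum_(x <- s) \sum_(g in H) (F (x * g)%g - F g) ^+ 2.
Proof.
move=> F0; pose f g := (F g)%:C%C.
have nE : \sum_(g in H) sqn (f g) = \sum_(g in H) F g ^+ 2.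
  by apply: eq_bigr => g _; apply: sqnR.
have <- : displacement f = \sum_(x <- s) \sum_(g in H) (F (x * g)%g - F g) ^+ 2.
  apply: eq_bigr => x _; apply: eq_bigr => g _; rewrite -sqnR; congr sqn.
  by rewrite rmorphB.
rewrite displacementE -[leLHS]mulrA (ler_pM2l m0) nE [leLHS]mulrBl mul1r lerD2l lerN2.
have := second_eigenvalue_max hA A1 H1 qform_le (v := fun i => f (enum_val i)).
rewrite -(big_enum_val f) -(big_enum_val (fun g => sqn (f g))) nE; apply.
by rewrite -sum_real_complex F0.
Qed.

End CayleyGap.

Lemma conj_real_complex (R : rcfType) (a : R) : (a%:C%C)^* = a%:C%C.
Proof. by apply/CrealP/complex_realP; exists a. Qed.

(** * Cauchy-Schwarz inequalities, convolution and laws of random conjugates *)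

Section Ineq.
Variables (R : rcfType) (T : finType) (P : pred T).

(** Lagrange's identity: the double sum of squares is twice the difference of the two sides. *)
Lemma cauchy_schwarz (f g : T -> R[i]%C) :
  sqn (\sum_(i | P i) f i * (g i)^*) <= (\sum_(i | P i) sqn (f i)) * (\sum_(i | P i) sqn (g i)).
Proof.
have : 0 <= \sum_(i | P i) \sum_(j | P j) sqn (f i * g j - f j * g i).
  by apply: sumr_ge0 => i _; apply: sumr_ge0 => j _; apply: sqn_ge0.
suff -> : \sum_(i | P i) \sum_(j | P j) sqn (f i * g j - f j * g i) =
  2 * ((\sum_(i | P i) sqn (f i)) * (\sum_(i | P i) sqn (g i)) - sqn (\sum_(i | P i) f i * (g
    i)^*)).
  by rewrite pmulr_rge0 ?ltr0n // subr_ge0.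
apply: (@complexI R).
set a := \sum_(i | P i) sqn (f i); set b := \sum_(i | P i) sqn (g i).
set c := \sum_(i | P i) f i * (g i)^*.
have -> : (2 * (a * b - sqn c))%:C%C = a%:C%C * b%:C%C + b%:C%C * a%:C%C - c * c^* - c^* * c.
  by rewrite -sqnE [c^* * c]mulrC -sqnE -!rmorphM -rmorphD -!rmorphB; congr (_%:C%C); ring.
rewrite /a /b /c !sum_real_complex rmorph_sum !big_distrlr /= -big_split -!sumrB /=.
apply: eq_bigr => i _; rewrite sum_real_complex -big_split -!sumrB /=.
apply: eq_bigr => j _.
by rewrite !sqnE !rmorphB !rmorphM /= !conjCK; ring.
Qed.

Lemma real_cauchy_schwarz (f g : T -> R) :
  (\sum_(i | P i) f i * g i) ^+ 2 <= (\sum_(i | P i) f i ^+ 2) * (\sum_(i | P i) g i ^+ 2).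
Proof.
have := cauchy_schwarz (fun x => (f x)%:C%C) (fun x => (g x)%:C%C).
under eq_bigr do rewrite conj_real_complex -rmorphM; rewrite -sum_real_complex sqnR.
under [X in _ <= X * _]eq_bigr do rewrite sqnR.
by under [X in _ <= _ * X]eq_bigr do rewrite sqnR.
Qed.

Lemma weighted_cauchy_schwarz (mu f : T -> R) : (forall i, P i -> 0 <= mu i) ->
  (\sum_(i | P i) mu i * f i) ^+ 2 <= (\sum_(i | P i) mu i) * (\sum_(i | P i) mu i * f i ^+ 2).
Proof.
move=> mu0.
have : 0 <= \sum_(i | P i) \sum_(j | P j) mu i * mu j * (f i - f j) ^+ 2.
  by apply: sumr_ge0 => i Pi; apply: sumr_ge0 => j Pj; apply: mulr_ge0 (sqr_ge0 _);
    apply: mulr_ge0; apply: mu0.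
suff -> : \sum_(i | P i) \sum_(j | P j) mu i * mu j * (f i - f j) ^+ 2 =
  2 * ((\sum_(i | P i) mu i) * (\sum_(i | P i) mu i * f i ^+ 2) - (\sum_(i | P i) mu i * f i) ^+ 2).
  by rewrite pmulr_rge0 ?ltr0n // subr_ge0.
set a := \sum_(i | P i) mu i; set b := \sum_(i | P i) mu i * f i ^+ 2.
set c := \sum_(i | P i) mu i * f i.
have -> : 2 * (a * b - c ^+ 2) = a * b + b * a - c * c - c * c by ring.
rewrite /a /b /c !big_distrlr /= -big_split -!sumrB /=; apply: eq_bigr => i _.
by rewrite -big_split -!sumrB /=; apply: eq_bigr => j _; ring.
Qed.

End Ineq.

Section Convolution.
Variables (R : rcfType) (gT : finGroupType) (G : {group gT}).
Implicit Types (a b mu : gT -> R).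

Definition conv a b (x : gT) : R := \sum_(y in G) a y * b (y^-1 * x)%g.
Definition revf a (x : gT) : R := a x^-1%g.
Definition delta1 (x : gT) : R := (x == 1%g)%:R.

Lemma convA a b c x : conv a (conv b c) x = conv (conv a b) c x.
Proof.
rewrite /conv; under eq_bigr do rewrite mulr_sumr.
under [RHS]eq_bigr do rewrite mulr_suml.
rewrite [RHS]exchange_big /=; apply: eq_bigr => y Gy.
rewrite -[RHS](sum_mulgl _ Gy) /=; apply: eq_bigr => z _.
by rewrite invMg mulKg -!mulgA mulrA.
Qed.

Lemma eq_conv a a' b b' : a =1 a' -> b =1 b' -> conv a b =1 conv a' b'.
Proof. by move=> ea eb x; apply: eq_bigr => y _; rewrite ea eb. Qed.

Lemma eq_conv_in a a' b b' : {in G, a =1 a'} -> {in G, b =1 b'} ->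
  {in G, conv a b =1 conv a' b'}.
Proof.
by move=> ea eb x Gx; apply: eq_bigr => y Gy; rewrite ea // eb // groupM ?groupV.
Qed.

Lemma conv_delta1r a x : x \in G -> conv a delta1 x = a x.
Proof.
move=> Gx; rewrite /conv (bigD1 x) //= /delta1 mulVg eqxx mulr1.
rewrite big1 ?addr0 // => y /andP[_ nyx].
by rewrite -eq_mulVg1 (negPf nyx) mulr0.
Qed.

Lemma conv_delta1 a x : conv delta1 a x = a x.
Proof.
rewrite /conv (bigD1 1%g) ?group1 //= /delta1 eqxx invg1 mul1g mul1r.
by rewrite big1 ?addr0 // => y /andP[_ /negPf ->]; rewrite mul0r.
Qed.

Lemma conv_rev a b x : x \in G -> revf (conv a b) x = conv (revf b) (revf a) x.
Proof.
move=> Gx; rewrite /revf /conv -[RHS](sum_mulgl _ Gx) /=.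
apply: eq_bigr => y _.
by rewrite !invMg !invgK mulgA mulVg mul1g mulrC.
Qed.

Lemma conv_ge0 a b : (forall x, 0 <= a x) -> (forall x, 0 <= b x) -> forall x, 0 <= conv a b x.
Proof. by move=> a0 b0 x; apply: sumr_ge0 => y _; apply: mulr_ge0. Qed.

Lemma sum_conv a b (F : gT -> R[i]%C) :
  \sum_(x in G) (conv a b x)%:C%C * F x =
  \sum_(y in G) (a y)%:C%C * \sum_(z in G) (b z)%:C%C * F (y * z)%g.
Proof.
rewrite /conv; under eq_bigr do rewrite sum_real_complex mulr_suml.
rewrite exchange_big /=; apply: eq_bigr => y Gy.
rewrite -(sum_mulgl _ Gy) mulr_sumr /=; apply: eq_bigr => z _.
by rewrite mulKg rmorphM /= mulrA.
Qed.

(** The law of a uniformly random conjugate of [h]. *)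
Definition class_law (h x : gT) : R := #|G|%:R^-1 * \sum_(z in G) (x == h ^ z)%g%:R.

Lemma class_law_ge0 h x : 0 <= class_law h x.
Proof. by rewrite mulr_ge0 ?invr_ge0 ?sumr_ge0 ?ler0n. Qed.

Lemma rev_class_law h x : revf (class_law h) x = class_law h^-1%g x.
Proof.
rewrite /revf /class_law; congr (_ * _); apply: eq_bigr => z _.
by rewrite conjVg -(inj_eq invg_inj) invgK.
Qed.

Lemma sum_class_law h (F : gT -> R[i]%C) : h \in G ->
  \sum_(x in G) (class_law h x)%:C%C * F x = #|G|%:R^-1 * \sum_(z in G) F (h ^ z)%g.
Proof.
move=> Gh; rewrite /class_law.
under eq_bigr do rewrite rmorphM /= fmorphV rmorph_nat -mulrA sum_real_complex mulr_suml.
rewrite -mulr_sumr exchange_big /=; congr (_ * _); apply: eq_bigr => z Gz.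
rewrite (bigD1 (h ^ z)%g) ?groupJ //= eqxx rmorph1 mul1r big1 ?addr0 // => y /andP[_ /negPf ->].
by rewrite rmorph0 mul0r.
Qed.

Lemma conv_rev_le (p : gT -> R) x : x \in G ->
  conv p (revf p) x <= conv p (revf p) 1%g.
Proof.
move=> Gx; have E : conv p (revf p) 1%g = \sum_(y in G) p y ^+ 2.
  by apply: eq_bigr => y _; rewrite /revf mulg1 invgK expr2.
rewrite E -(ler_pM2l (ltr0n _ 2)).
have -> : 2 * (\sum_(y in G) p y ^+ 2) =
    \sum_(y in G) (p y ^+ 2 + p (x^-1 * y)%g ^+ 2).
  by rewrite big_split /= (sum_mulgl (fun y => p y ^+ 2) (groupVr Gx)) mulr_natl mulr2n.
rewrite /conv mulr_sumr; apply: ler_sum => y _.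
rewrite /revf invMg invgK -subr_ge0.
have -> : p y ^+ 2 + p (x^-1 * y)%g ^+ 2 - 2 * (p y * p (x^-1 * y)%g) =
  (p y - p (x^-1 * y)%g) ^+ 2 by ring.
exact: sqr_ge0.
Qed.

Lemma conv_rev_1 (p : gT -> R) : conv p (revf p) 1%g = \sum_(y in G) p y ^+ 2.
Proof. by apply: eq_bigr => y _; rewrite /revf mulg1 invgK expr2. Qed.

End Convolution.

(** * Normalised class functions *)

Section ClassVector.
Variables (R : rcfType) (gT : finGroupType) (G : {group gT}) (Delta : R).
Local Notation C := R[i]%C.
Hypothesis minD : min_degree G Delta.
Hypothesis Delta1 : 1 < Delta.
Variable z : gT -> C.

(** For [z] an irreducible character divided by its norm this is the normalised character at [y^-1].
    By the hypothesis [zr] below it is also the eigenvalue on [z] of averaging translations over the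
    class of [y]. *)
Definition corr (y : gT) : C := \sum_x z (y^-1 * x)%g * (z x)^*.
Local Notation r := corr.

Hypothesis zG : forall x, x \notin G -> z x = 0.
Hypothesis zJ : forall x g, g \in G -> z (x ^ g)%g = z x.
Hypothesis z0 : \sum_(x in G) z x = 0.
Hypothesis z1 : \sum_x sqn (z x) = 1.
Hypothesis zr : forall y x, y \in G ->
  \sum_(h in G) z ((y ^ h)^-1 * x)%g = #|G|%:R * r y * z x.

Let n0 : #|G|%:R != 0 :> R.
Proof. by rewrite pnatr_eq0 -lt0n cardG_gt0. Qed.

Let z1C : \sum_x z x * (z x)^* = 1.
Proof.
by under eq_bigr do rewrite -sqnE; rewrite -sum_real_complex z1.
Qed.

Lemma corr1 : r 1%g = 1.
Proof. by rewrite /r; under eq_bigr do rewrite invg1 mul1g; exact: z1C. Qed.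

Lemma corrE a b : r (a^-1 * b)%g = \sum_x z (b^-1 * x)%g * (z (a^-1 * x)%g)^*.
Proof.
rewrite /r (reindex_inj (mulgI a^-1%g)) /=; apply: eq_bigr => x _.
by rewrite invMg invgK mulgA -[(b^-1 * a * _)%g]mulgA mulgV mulg1.
Qed.

Lemma corrV y : r y^-1%g = (r y)^*.
Proof.
rewrite -[y^-1%g]mulg1 corrE /r rmorph_sum; apply: eq_bigr => x _.
by rewrite rmorphM /= conjCK invg1 mul1g mulrC.
Qed.

Lemma corrJ y h : h \in G -> r (y ^ h)%g = r y.
Proof.
move=> Gh; rewrite /r (reindex_inj (conjg_inj h)) /=; apply: eq_bigr => x _.
by rewrite -conjVg -conjMg !zJ.
Qed.

Let shift2 y : \sum_x sqn (z (y^-1 * x)%g - r y * z x) = 1 - sqn (r y).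
Proof.
apply: (@complexI R); rewrite sum_real_complex rmorphB rmorph1 /=.
transitivity (\sum_x (z (y^-1 * x)%g * (z (y^-1 * x)%g)^* + r y * (r y)^* * (z x * (z x)^*)
   - (r y)^* * (z (y^-1 * x)%g * (z x)^*) - r y * (z x * (z (y^-1 * x)%g)^*))).
  by apply: eq_bigr => x _; rewrite sqnE rmorphB rmorphM /=; ring.
rewrite !sumrB big_split /= -!mulr_sumr z1C mulr1 sqnE.
have -> : \sum_x z (y^-1 * x)%g * (z (y^-1 * x)%g)^* = 1.
  by rewrite -corrE mulVg corr1.
have -> : \sum_x z x * (z (y^-1 * x)%g)^* = (r y)^*.
  rewrite -corrV -[y^-1%g in RHS]mulg1 corrE; apply: eq_bigr => x _.
  by rewrite invg1 mul1g.
by rewrite -/(r y); ring.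
Qed.

Lemma corr_le1 y : sqn (r y) <= 1.
Proof. by rewrite -subr_ge0 -shift2; apply: sumr_ge0 => x _; apply: sqn_ge0. Qed.

Lemma corr_eq1 y x : sqn (r y) = 1 -> z (y^-1 * x)%g = r y * z x.
Proof.
move=> ry; have := shift2 y; rewrite ry subrr => /eqP.
rewrite psumr_eq0 => [|i _]; last exact: sqn_ge0.
by move/allP/(_ x); rewrite mem_index_enum sqn_eq0 subr_eq0 => /(_ isT) /eqP.
Qed.

Let corr_pair a : \sum_x z x * (z (a^-1 * x)%g)^* = r a^-1%g.
Proof.
rewrite -[in RHS](mulg1 a^-1%g) corrE; apply: eq_bigr => x _.
by rewrite invg1 mul1g.
Qed.

Lemma sum_corrJ g h : h \in G -> \sum_(x in G) r (g * h ^ x)%g = #|G|%:R * (r g * r h).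
Proof.
move=> Gh; rewrite -[g]invgK.
under eq_bigr do rewrite corrE.
rewrite exchange_big /=.
under eq_bigr do rewrite -mulr_suml zr // -mulrA.
by rewrite -mulr_sumr corr_pair invgK; ring.
Qed.

(** Mixing for the conjugation action. Both translates of [z] are freed of their component along
    [z]: the first then averages to zero over orbits, and the squared norms become
    [1 - sqn (corr z h)] and [1 - sqn (corr z g)]. These factors keep the estimate effective when
    the modulus is close to 1. *)
Lemma sum_sqn_corrJ g h : h \in G ->
  Delta * \sum_(x in G) sqn (r (g * h ^ x)%g - r g * r h)
  <= #|G|%:R * (1 - sqn (r h)) * (1 - sqn (r g)).
Proof.
move=> Gh; pose act (x w : gT) := (w ^ x^-1)%g.
have act1 w : act 1%g w = w by rewrite /act invg1 conjg1.
have actM : {in G &, forall x y, forall w, act (x * y)%g w = act x (act y w)}.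
  by move=> x y _ _ w; rewrite /act invMg conjgM.
pose f w := z (h^-1 * w)%g - r h * z w.
pose k w := z (g^-1^-1 * w)%g - r g^-1%g * z w.
have fact x w : x \in G -> f (act x w) = z ((h ^ x)^-1 * w)%g - r h * z w.
  move=> Gx; rewrite /f /act (zJ _ (groupVr Gx)); congr (_ - _).
  by rewrite -[RHS](zJ _ (groupVr Gx)) conjMg -conjVg conjgK.
have f0 w : \sum_(x in G) f (act x w) = 0.
  under eq_bigr => x Gx do rewrite fact //.
  by rewrite sumrB zr // sumr_const -mulr_natl; ring.
have pair x : x \in G -> \sum_w f (act x w) * (k w)^* = r (g * h ^ x)%g - r g * r h.
  move=> Gx; transitivity (\sum_w (z ((h ^ x)^-1 * w)%g * (z (g^-1^-1 * w)%g)^*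
     - r h * (z w * (z (g^-1^-1 * w)%g)^*) - r g * (z ((h ^ x)^-1 * w)%g * (z w)^*)
     + r g * r h * (z w * (z w)^*))).
    apply: eq_bigr => w _; rewrite fact // /k corrV rmorphB rmorphM /= conjCK; ring.
  rewrite big_split /= !sumrB -!mulr_sumr z1C -corrE corr_pair !invgK.
  by rewrite -/(r (h ^ x)%g) corrJ //; ring.
have := mixing minD act1 actM f0 k (ltW (lt_trans ltr01 Delta1)).
rewrite shift2 shift2 corrV sqnC; congr (_ <= _); congr (_ * _).
by apply: eq_bigr => x Gx; rewrite pair.
Qed.

Lemma mean_sqn_corrJ g h : h \in G ->
  Delta * (#|G|%:R^-1 * \sum_(x in G) sqn (r (g * h ^ x)%g) - sqn (r g) * sqn (r h))
  <= (1 - sqn (r h)) * (1 - sqn (r g)).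
Proof.
move=> Gh; have n1 : 0 < #|G|%:R :> R by rewrite ltr0n.
rewrite -(ler_pM2l n1) [leRHS]mulrA; apply: le_trans (sum_sqn_corrJ g Gh).
apply: le_of_eq.
rewrite mulrCA; congr (_ * _); apply: (@complexI R).
rewrite mulrBr mulrA divff // mul1r rmorphB rmorphM rmorph_nat /= !sum_real_complex.
transitivity (\sum_(x in G) ((sqn (r (g * h ^ x)%g))%:C%C - r (g * h ^ x)%g * (r g * r h)^*
   - (r g * r h) * (r (g * h ^ x)%g)^* + (r g * r h) * (r g * r h)^*)); last first.
  by apply: eq_bigr => x _; rewrite !sqnE rmorphB /=; ring.
have sC : \sum_(x in G) (r (g * h ^ x)%g)^* = (#|G|%:R * (r g * r h))^*.
  by rewrite -sum_corrJ // rmorph_sum.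
rewrite big_split /= !sumrB -mulr_suml -mulr_sumr sC sum_corrJ // sumr_const.
by rewrite -sqnM sqnE -[_ *+ #|G|]mulr_natl !rmorphM rmorph_nat /=; ring.
Qed.

(** The analogue of the centre of a character, where its modulus equals its degree. *)
Definition corr_ker := [set y in G | sqn (r y) == 1].

Lemma corr_ker_group : group_set corr_ker.
Proof.
apply/group_setP; split; first by rewrite inE group1 corr1 sqnR expr1n eqxx.
move=> a b; rewrite !inE => /andP[Ga /eqP ra] /andP[Gb /eqP rb].
rewrite groupM //=; have -> : r (a * b)%g = r a * r b.
  rewrite /r; under eq_bigr do rewrite invMg -mulgA corr_eq1 // corr_eq1 //.
  by under eq_bigr do rewrite mulrA -mulrA; rewrite -mulr_sumr z1C mulr1 mulrC.
by rewrite sqnM ra rb mulr1.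
Qed.

Canonical corr_ker_Group := Group corr_ker_group.

Lemma corr_ker_normal : (corr_ker <| G)%g.
Proof.
apply/andP; split; first by apply/subsetP => x; rewrite inE => /andP[].
apply/subsetP => g Gg; rewrite inE; apply/subsetP => x.
rewrite mem_conjg !inE groupJr ?groupV // corrJ ?groupV //.
Qed.

(** Were the modulus 1 on all of [G], every translate of the mean zero function [z] would correlate
    fully with [z], against mixing for left translation. *)
Lemma corr_ker_proper : corr_ker \proper G.
Proof.
rewrite properEneq normal_sub ?corr_ker_normal // andbT.
apply/eqP => kG; have Gr y : y \in G -> sqn (r y) = 1.
  by rewrite -kG inE => /andP[_ /eqP].
have := @mixing _ _ G _ minD _ (fun x w => x * w)%g (fun w => mul1g w)
  (fun x y _ _ w => esym (mulgA x y w)) z _ z (ltW (lt_trans ltr01 Delta1)).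
rewrite z1 !mulr1 => /(_ _) h.
have : Delta * #|G|%:R <= #|G|%:R.
  apply: le_trans (h _) => [|w]; last first.
    have [Gw|nGw] := boolP (w \in G); first by rewrite sum_mulgr.
    by rewrite big1 // => x Gx; rewrite zG // groupMl.
  rewrite ler_wpM2l ?(ltW (lt_trans _ Delta1)) // -sum1_card natr_sum.
  apply: ler_sum => x Gx.
  suff -> : \sum_w z (x * w)%g * (z w)^* = r x^-1%g by rewrite Gr ?groupV.
  by rewrite /r; under [RHS]eq_bigr do rewrite invgK.
by rewrite -[leRHS]mul1r ler_pM2r ?ltr0n // leNgt Delta1.
Qed.

End ClassVector.

Lemma addn_sqr_le k : (k + k ^ 2 <= k.+1 ^ 2)%N.
Proof. by nia. Qed.

Lemma sum_weighted_complex (R : rcfType) (T : finType) (P : pred T) (mu : T -> R) (f :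
  T -> R[i]%C) :
  \sum_(x | P x) (mu x)%:C%C * f x =
  (\sum_(x | P x) mu x * complex.Re (f x))%:C%C +
    'i%C * (\sum_(x | P x) mu x * complex.Im (f x))%:C%C.
Proof.
rewrite !sum_real_complex mulr_sumr -big_split /=; apply: eq_bigr => x _.
by rewrite [in LHS](complexE (f x)) !rmorphM /=; ring.
Qed.

(** * Decay of normalised class functions off the subgroup where their modulus is 1 *)

Section Decay.
Variables (R : rcfType) (gT : finGroupType) (G : {group gT}) (Delta : R).
Local Notation C := R[i]%C.
Variable r : gT -> C.
Hypothesis D0 : 0 < Delta.
Hypothesis r1 : r 1%g = 1.
Hypothesis rV : forall y, r y^-1%g = (r y)^*.
Hypothesis rJ : forall g h, h \in G ->
  \sum_(x in G) r (g * h ^ x)%g = #|G|%:R * (r g * r h).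
Hypothesis rJ2 : forall g h, h \in G ->
  Delta * (#|G|%:R^-1 * \sum_(x in G) sqn (r (g * h ^ x)%g) - sqn (r g) * sqn (r h))
  <= (1 - sqn (r h)) * (1 - sqn (r g)).

Variable y : gT.
Hypothesis Gy : y \in G.
Let rho := sqn (r y).
Let theta := 1 - rho.
Hypothesis rho1 : rho < 1.

Let n0 : #|G|%:R != 0 :> R.
Proof. by rewrite pnatr_eq0 -lt0n cardG_gt0. Qed.

Let n0C : #|G|%:R != 0 :> C.
Proof. by rewrite pnatr_eq0 -lt0n cardG_gt0. Qed.

Let rho0 : 0 <= rho. Proof. exact: sqn_ge0. Qed.

(** Meant for the law of a product of [k] independent random conjugates of elements with
    [sqn (r h) = rho]. The factor [theta ^+ 2] cancels later against the squared distance of two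
    such means. *)
Definition spread (k : nat) (mu : gT -> R) :=
  [/\ forall x, 0 <= mu x, \sum_(x in G) mu x = 1,
      sqn (\sum_(x in G) (mu x)%:C%C * r x) = rho ^+ k &
      Delta * (\sum_(x in G) mu x * sqn (r x) - rho ^+ k) <= (k ^ 2)%N%:R * theta ^+ 2].

Lemma sum_class_conv mu h (F : gT -> C) : h \in G ->
  \sum_(x in G) (conv G mu (class_law R G h) x)%:C%C * F x =
  #|G|%:R^-1 * \sum_(g in G) (mu g)%:C%C * \sum_(x in G) F (g * h ^ x)%g.
Proof.
move=> Gh; rewrite sum_conv mulr_sumr; apply: eq_bigr => g Gg.
by rewrite (sum_class_law (fun z => F (g * z)%g)) // mulrCA.
Qed.

Lemma bernoulli (x : R) k : 0 <= x <= 1 -> 1 - x ^+ k <= k%:R * (1 - x).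
Proof.
case/andP=> x0 x1; elim: k => [|k IH]; first by rewrite expr0 mul0r subrr.
have := exprn_ge0 k x0; have := exprn_ile1 k x0 x1; rewrite -[in X in _ -> _ -> X]natr1 exprS; nra.
Qed.

Lemma mean_conv mu h : h \in G ->
  \sum_(x in G) (conv G mu (class_law R G h) x)%:C%C * r x =
  (\sum_(x in G) (mu x)%:C%C * r x) * r h.
Proof.
move=> Gh; rewrite sum_class_conv //.
under eq_bigr do rewrite rJ // mulrCA.
rewrite -mulr_sumr mulrA mulVf // mul1r mulr_suml.
by apply: eq_bigr => g _; rewrite mulrA.
Qed.

(** Convolving with a class multiplies the mean by [r h]. With [q] and [q'] the old and new second
    moments, [rJ2] gives [Delta * (q' - rho * q) <= theta * (1 - q)]; Jensen and Bernoulli give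
    [1 - q <= 1 - rho ^+ k <= k * theta], and [k + k ^ 2 <= k.+1 ^ 2] closes the induction. *)
Lemma spread_step k mu h : h \in G -> sqn (r h) = rho -> spread k mu ->
  spread k.+1 (conv G mu (class_law R G h)).
Proof.
move=> Gh rh [mu0 mu1 mE mV]; split.
- by apply: conv_ge0 => // x; apply: class_law_ge0.
- apply: (@complexI R); rewrite sum_real_complex -[RHS](congr1 (real_complex R) mu1).
  have := sum_class_conv mu (fun=> 1) Gh.
  under eq_bigr do rewrite mulr1; move=> ->.
  under eq_bigr do rewrite sumr_const mulrC.
  by rewrite -mulr_sumr mulrA mulVf // mul1r -sum_real_complex.
- by rewrite mean_conv // sqnM mE rh exprSr.
have qE : \sum_(x in G) conv G mu (class_law R G h) x * sqn (r x) =
    \sum_(g in G) mu g * (#|G|%:R^-1 * \sum_(x in G) sqn (r (g * h ^ x)%g)).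
  apply: (@complexI R); rewrite !sum_real_complex.
  under eq_bigr do rewrite rmorphM /=.
  rewrite (sum_class_conv mu (fun x => (sqn (r x))%:C%C)) // mulr_sumr.
  apply: eq_bigr => g _; rewrite !rmorphM /= fmorphV rmorph_nat sum_real_complex.
  by rewrite mulrCA.
have step : Delta * (\sum_(x in G) conv G mu (class_law R G h) x * sqn (r x)
     - rho * \sum_(x in G) mu x * sqn (r x)) <= theta * (1 - \sum_(x in G) mu x * sqn (r x)).
  rewrite qE.
  apply: le_trans (_ : \sum_(g in G) mu g * (theta * (1 - sqn (r g))) <= _); last first.
    rewrite mulrBr mulr1 -{2}[theta]mulr1 -[in leRHS]mu1 !mulr_sumr -sumrB.
    by apply: le_of_eq; apply: eq_bigr => g _; ring.
  rewrite mulr_sumr -sumrB mulr_sumr; apply: ler_sum => g Gg.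
  have := ler_wpM2l (mu0 g) (rJ2 g Gh); rewrite rh -/theta.
  by move: (_ * \sum_(x in G) _) (mu g) (sqn (r g)) => a b c; lra.
set q' := \sum_(x in G) conv _ _ _ _ * _ in step *.
set q := \sum_(x in G) mu x * _ in mV step *.
have jensen : rho ^+ k <= q.
  rewrite -mE.
  rewrite sum_weighted_complex.
  set a := \sum_(x in G) _; set b := \sum_(x in G) _.
  have -> : sqn (a%:C%C + 'i%C * b%:C%C) = a ^+ 2 + b ^+ 2 by rewrite /sqn /=; ring.
  have ha := weighted_cauchy_schwarz (fun x => complex.Re (r x)) (fun x (_ : x \in G) => mu0 x).
  have hb := weighted_cauchy_schwarz (fun x => complex.Im (r x)) (fun x (_ : x \in G) => mu0 x).
  apply: le_trans (lerD ha hb) _; rewrite mu1 !mul1r -big_split /=.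
  by apply: ler_sum => x _; rewrite -mulrDr.
have := bernoulli k (_ : 0 <= rho <= 1); rewrite rho0 (ltW rho1) => /(_ isT) bern.
have t0 : 0 < theta by rewrite subr_gt0.
have qt : 1 - q <= k%:R * theta by apply: le_trans bern; rewrite lerD2l lerN2.
have e1 : Delta * (q' - rho * q) <= k%:R * theta ^+ 2.
  by apply: le_trans step _; rewrite expr2 mulrCA ler_pM2l.
have k0 : 0 <= k%:R :> R by [].
have e2 : rho * (Delta * (q - rho ^+ k)) <= rho * ((k ^ 2)%N%:R * theta ^+ 2) by rewrite ler_wpM2l.
have e3 : rho * ((k ^ 2)%N%:R * theta ^+ 2) <= (k ^ 2)%N%:R * theta ^+ 2.
  by rewrite ler_piMl ?mulr_ge0 ?sqr_ge0 // ltW.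
have -> : Delta * (q' - rho ^+ k.+1) = Delta * (q' - rho * q) + rho * (Delta * (q - rho ^+ k)).
  by rewrite exprS; ring.
apply: le_trans (lerD e1 (le_trans e2 e3)) _.
rewrite -mulrDl ler_wpM2r ?sqr_ge0 // -natrD ler_nat addn_sqr_le //.
Qed.

Let m := conv G (class_law R G y) (class_law R G y^-1%g).

(** Pairing [y] with [y^-1] makes the law symmetric and its mean the real number [rho ^+ j];
    [walk j] is the law of a product of [2 * j] conjugates. *)
Fixpoint walk (j : nat) : gT -> R :=
  if j is i.+1 then conv G (walk i) m else (@delta1 R gT).

Lemma walk_ge0 j x : 0 <= walk j x.
Proof.
elim: j x => [|j IH] x; first exact: ler0n.
by apply: conv_ge0 => // z; apply: conv_ge0 => w; apply: class_law_ge0.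
Qed.

Lemma walkD i j : {in G, walk (i + j) =1 conv G (walk i) (walk j)}.
Proof.
elim: j => [|j IH] x Gx; first by rewrite addn0 conv_delta1r.
rewrite addnS /= convA; apply: eq_conv_in => // z Gz; exact: IH.
Qed.

Lemma rev_m : {in G, revf m =1 m}.
Proof.
move=> x Gx; rewrite conv_rev //; apply: eq_conv => z; rewrite rev_class_law ?invgK //.
Qed.

Lemma walk_rev j : {in G, revf (walk j) =1 walk j}.
Proof.
elim: j => [|j IH] x Gx.
  by rewrite /revf /= /delta1 -[1%g in LHS]invg1 (inj_eq invg_inj).
rewrite [LHS](conv_rev _ _ Gx) (eq_conv_in rev_m IH) //.
transitivity (walk (1 + j) x); last by [].
rewrite walkD //; apply: eq_conv_in => // z Gz /=.
by rewrite conv_delta1.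
Qed.

Lemma walk_spread j : spread (j.*2) (walk j).
Proof.
elim: j => [|j IH].
  split=> [x|||]; rewrite ?expr0 ?mul0r ?expn0.
  - exact: ler0n.
  - rewrite (bigD1 1%g) ?group1 //= /delta1 eqxx big1 ?addr0 // => z /andP[_ /negPf -> //].
  - rewrite (bigD1 1%g) ?group1 //= /delta1 eqxx r1 mulr1 big1 ?addr0.
      by rewrite sqnR expr1n.
    by move=> z /andP[_ /negPf ->]; rewrite rmorph0 mul0r.
  - rewrite (bigD1 1%g) ?group1 //= /delta1 eqxx r1 mul1r big1 ?addr0.
      by rewrite sqnR expr1n subrr mulr0.
    by move=> z /andP[_ /negPf ->]; rewrite mul0r.
have := spread_step (groupVr Gy) _ (spread_step Gy erefl IH).
rewrite rV sqnC doubleS => /(_ erefl) [h1 h2 h3 h4].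
have E x : walk j.+1 x = conv G (conv G (walk j) (class_law R G y)) (class_law R G y^-1%g) x.
  exact: convA.
by split=> [x|||]; [rewrite E | under eq_bigr do rewrite E |
  under eq_bigr do rewrite E | under eq_bigr do rewrite E].
Qed.

Lemma walk_mean j : \sum_(x in G) (walk j x)%:C%C * r x = (rho ^+ j)%:C%C.
Proof.
elim: j => [|j IH].
  rewrite (bigD1 1%g) ?group1 //= /delta1 eqxx r1 mulr1 big1 ?addr0 ?expr0 //.
  by move=> z /andP[_ /negPf ->]; rewrite rmorph0 mul0r.
transitivity (\sum_(x in G) (conv G (conv G (walk j) (class_law R G y)) (class_law R G y^-1%g)
  x)%:C%C * r x).
  by apply: eq_bigr => x _; rewrite -convA.
rewrite mean_conv ?groupV // mean_conv // IH rV -mulrA -sqnE -rmorphM exprSr //.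
Qed.

Lemma walk_variance j :
  Delta * \sum_(x in G) walk j x * sqn (r x - (rho ^+ j)%:C%C) <= (j.*2 ^ 2)%N%:R * theta ^+ 2.
Proof.
have [w0 w1 wm] := walk_spread j; have wE := walk_mean j; apply: le_trans.
rewrite ler_pM2l //; apply: le_of_eq.
have reE : \sum_(x in G) walk j x * complex.Re (r x) = rho ^+ j.
  move: wE; rewrite sum_weighted_complex => /(congr1 (@complex.Re R)) /= <-.
  by ring.
transitivity (\sum_(x in G) (walk j x * sqn (r x) - 2 * rho ^+ j * (walk j x * complex.Re (r x))
  + walk j x * rho ^+ j ^+ 2)).
  by apply: eq_bigr => x _; case: (r x) => a b; rewrite /sqn /=; ring.
rewrite big_split sumrB /= -mulr_sumr -mulr_suml reE w1 -mul2n mulnC exprM; ring.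
Qed.

Lemma walk_le_1 j x : x \in G -> walk (j.*2) x <= walk (j.*2) 1%g.
Proof.
move=> Gx; have E z : z \in G -> walk j.*2 z = conv G (walk j) (revf (walk j)) z.
  move=> Gz; rewrite -addnn walkD //; apply: eq_conv_in => // w Gw.
  by rewrite walk_rev.
by rewrite !E ?group1 // conv_rev_le.
Qed.

Lemma walk_1_ge j : 1 <= #|G|%:R * walk (j.*2) 1%g.
Proof.
have -> : walk j.*2 1%g = \sum_(x in G) walk j x ^+ 2.
  rewrite -conv_rev_1 -addnn walkD //; apply: eq_conv_in => // w Gw.
  by rewrite walk_rev.
have [w0 w1 _ _] := walk_spread j.
have := weighted_cauchy_schwarz (walk j) (fun (x : gT) (_ : x \in G) => @ler01 R).
by under eq_bigr do rewrite mul1r; under [X in _ <= _ * X]eq_bigr do rewrite mul1r;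
   rewrite w1 expr1n sumr_const.
Qed.

(* The correlation [r] is close to [A] on most of [walk J] and to [A ^+ 2] on most of
   [walk J.*2], so these two laws are nearly singular and [walk (3 * J)] has little mass at 1. *)
Lemma walk_decay j : (0 < j)%N -> Delta * rho ^+ (j.*2).*2 * walk (3 * j.*2) 1%g
   <= (80 * j.*2 ^ 2)%N%:R * walk (j.*2) 1%g.
Proof.
move=> j0; set J := j.*2; pose A := rho ^+ J; pose eta := (A - A ^+ 2) / 2.
have A0 : 0 <= A by apply: exprn_ge0.
have At : A * theta <= 2 * eta.
  rewrite /eta mulrCA mulfV ?mulr1 ?pnatr_eq0 // expr2 -{2}[A]mulr1 -mulrBr ler_wpM2l //.
  by rewrite lerD2l lerN2 /A -(prednK (_ :
    0 < J)%N) ?double_gt0 // exprS ler_piMr // exprn_ile1 // ltW.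
have t0 : 0 < theta by rewrite subr_gt0.
have eta0 : 0 <= eta by have := mulr_ge0 A0 (ltW t0); lra.
have W1 : walk (3 * J) 1%g = \sum_(x in G) walk (J.*2) x * walk J x.
  have -> : (3 * J = J.*2 + J)%N by rewrite -addnn !mulSn mul0n addn0 addnA.
  rewrite walkD //; apply: eq_bigr => x Gx; rewrite mulg1; congr (_ * _).
  exact: walk_rev.
pose p := walk J 1%g.
have p0 : 0 <= p by apply: walk_ge0.
have le1 x : x \in G -> walk J x <= p by apply: walk_le_1.
have le2 x : x \in G -> walk J.*2 x <= p.
  move=> Gx; rewrite -addnn walkD //; have [w0 w1 _ _] := walk_spread J.
  rewrite -[p]mul1r -w1 mulr_suml; apply: ler_sum => z Gz.
  by rewrite ler_wpM2l // le1 // groupM ?groupV.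
have bound : eta ^+ 2 * walk (3 * J) 1%g <= p * (\sum_(x in G) walk J x * sqn (r x - A%:C%C))
    + p * (\sum_(x in G) walk J.*2 x * sqn (r x - (A ^+ 2)%:C%C)).
  rewrite W1 !mulr_sumr -big_split /=; apply: ler_sum => x Gx.
  have w1 := walk_ge0 J x; have w2 := walk_ge0 J.*2 x.
  have s1 := sqn_ge0 (r x - A%:C%C); have s2 := sqn_ge0 (r x - (A ^+ 2)%:C%C).
  have [hE|hE] := leP (eta ^+ 2) (sqn (r x - A%:C%C)).
    apply: le_trans (_ : p * (walk J x * sqn (r x - A%:C%C)) <= _); last first.
      by rewrite lerDl !mulr_ge0.
    have -> : eta ^+ 2 * (walk J.*2 x * walk J x) = walk J.*2 x * (walk J x * eta ^+ 2) by ring.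
    exact: ler_pM w2 (mulr_ge0 w1 (sqr_ge0 _)) (le2 x Gx) (ler_wpM2l w1 hE).
  have hE2 : eta ^+ 2 <= sqn (r x - (A ^+ 2)%:C%C).
    rewrite leNgt; apply/negP => hE2; move: hE hE2.
    have lt1 (a b e : R) : 0 <= e -> a ^+ 2 + b ^+ 2 < e ^+ 2 -> `|a| < e.
      move=> e0 h; rewrite -(ltr_pXn2r (n := 2)) ?nnegrE //.
      by rewrite real_normK ?num_real //; apply: le_lt_trans h; rewrite lerDl sqr_ge0.
    rewrite /sqn => /(lt1 _ _ _ eta0); rewrite ltr_norml => /andP[h1 _].
    move/(lt1 _ _ _ eta0); rewrite ltr_norml => /andP[_ h2].
    move: h1 h2; rewrite /eta; case: (r x) => a b /=; lra.
  apply: le_trans (_ : p * (walk J.*2 x * sqn (r x - (A ^+ 2)%:C%C)) <= _); last first.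
    by rewrite lerDr !mulr_ge0.
  have -> : eta ^+ 2 * (walk J.*2 x * walk J x) = walk J x * (walk J.*2 x * eta ^+ 2) by ring.
  exact: ler_pM w1 (mulr_ge0 w2 (sqr_ge0 _)) (le1 x Gx) (ler_wpM2l w2 hE2).
have v1 := walk_variance J; have v2 := walk_variance J.*2.
rewrite -/A in v1; have EA : rho ^+ J.*2 = A ^+ 2 by rewrite -muln2 exprM.
rewrite EA in v2 *; rewrite -/p.
have w0 := walk_ge0 (3 * J) 1%g.
have h1 : (A * theta) ^+ 2 <= (2 * eta) ^+ 2.
  have t0' := ltW t0; have e2 : 0 <= 2 * eta by rewrite mulr_ge0.
  by apply: lerXn2r => //; rewrite nnegrE ?mulr_ge0.
have h2 : Delta * (eta ^+ 2 * walk (3 * J) 1%g) <= p * ((20 * J ^ 2)%N%:R * theta ^+ 2).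
  apply: le_trans (ler_wpM2l (ltW D0) bound) _; rewrite mulrDr mulrCA [X in _ + X]mulrCA -mulrDr.
  rewrite ler_wpM2l //; apply: le_trans (lerD v1 v2) _.
  have -> : (20 * J ^ 2 = J.*2 ^ 2 + J.*2.*2 ^ 2)%N by clear; rewrite -!mul2n; ring.
  by rewrite natrD mulrDl.
have t2 : 0 < theta ^+ 2 by rewrite exprn_gt0.
rewrite -(ler_pM2l t2).
have -> : theta ^+ 2 * (Delta * A ^+ 2 * walk (3 * J) 1%g) =
  Delta * walk (3 * J) 1%g * (A * theta) ^+ 2 by ring.
apply: le_trans (ler_wpM2l (mulr_ge0 (ltW D0) w0) h1) _.
have -> : Delta * walk (3 * J) 1%g * (2 * eta) ^+ 2 =
  4 * (Delta * (eta ^+ 2 * walk (3 * J) 1%g)) by ring.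
apply: le_trans (ler_wpM2l (ler0n _ 4) h2) _.
apply: le_of_eq.
by rewrite (_ : 80 = 4 * 20)%N // -mulnA natrM; ring.
Qed.

(** Apply [walk_decay] at times growing by factors of 3, with [80 * (2 * 3 ^ i) ^ 2 = 320 * 9 ^ i].
    The mass at 1 starts at most 1, loses about [Delta * rho ^+ (4 * 3 ^ I)] each time, and stays at
    least [1 / #|G|]. If [Delta] is a power of [#|G|] and [I] a large multiple of the inverse
    exponent, [rho] must be small. *)
Lemma corr_decay I : (Delta * rho ^+ (4 * 3 ^ I)) ^+ I <= #|G|%:R * (320 * 9 ^ I)%N%:R ^+ I.
Proof.
pose c i := walk ((3 ^ i).*2) 1%g.
have c0 i : 0 <= c i by apply: walk_ge0.
have x0 : 0 <= Delta * rho ^+ (4 * 3 ^ I) by rewrite mulr_ge0 ?exprn_ge0 // ltW.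
have step i : (i < I)%N -> Delta * rho ^+ (4 * 3 ^ I) * c i.+1 <= (320 * 9 ^ I)%N%:R * c i.
  move=> iI; apply: le_trans (_ : Delta * rho ^+ ((3 ^ i).*2.*2) * c i.+1 <= _).
    rewrite ler_wpM2r // ler_wpM2l ?(ltW D0) // ler_wiXn2l ?(ltW rho1) //.
    by rewrite -!mul2n mulnA leq_mul2l leq_pexp2l // ltnW.
  have := @walk_decay (3 ^ i) (expn_gt0 _ _).
  rewrite -doubleMr -expnS => h; apply: le_trans h _.
  apply: ler_wpM2r; first exact: walk_ge0.
  rewrite ler_nat.
  rewrite -mul2n expnMn mulnA leq_mul2l /= -expnM mulnC expnM (_ : 3 ^ 2 = 9)%N //.
  by rewrite leq_pexp2l // ltnW.
have iter k : (k <= I)%N -> (Delta * rho ^+ (4 * 3 ^ I)) ^+ k * c k <=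
  (320 * 9 ^ I)%N%:R ^+ k * c 0.
  elim: k => [|k IH] kI; first by rewrite !expr0.
  rewrite exprSr -mulrA; apply: le_trans (ler_wpM2l (exprn_ge0 _ x0) (step _ kI)) _.
  by rewrite mulrCA exprS -mulrA ler_wpM2l // IH // ltnW.
have c01 : c 0 <= 1.
  rewrite /c; move: (3 ^ 0)%N.*2 => k; have [w0 w1 _ _] := walk_spread k.
  by rewrite -w1 (bigD1 1%g) ?group1 // lerDl sumr_ge0.
have := iter I (leqnn I); have := walk_1_ge (3 ^ I); rewrite -/(c I) => h1 h2.
have h3 : (320 * 9 ^ I)%N%:R ^+ I * c 0 <= (320 * 9 ^ I)%N%:R ^+ I by rewrite ler_piMr // exprn_ge0.
set X := _ ^+ I in h2 *; have X0 : 0 <= X by apply: exprn_ge0.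
apply: le_trans (_ : X * (#|G|%:R * c I) <= _); first by rewrite ler_peMr.
by rewrite mulrCA ler_wpM2l // (le_trans h2).
Qed.

End Decay.

(** The common eigenvector theorem for the restrictions of the operators to [W], written in a row
    basis of [W]. *)
Lemma common_eigenvector_sub (C : numClosedFieldType) n (W : 'M[C]_n) (As : seq 'M[C]_n) :
  W != 0 -> {in As &, forall A B, comm_mx A B} -> all (fun A => stablemx W A) As ->
  exists v : 'rV_n, [/\ v != 0, (v <= W)%MS & all (fun A => stablemx v A) As].
Proof.
move=> W0 cAs /allP sW.
have [|| v v0 /allP vP] := @common_eigenvector C (\rank W) [seq restrictmx W B | B <- As].
- by rewrite lt0n mxrank_eq0.
- move=> _ _ /mapP[A hA ->] /mapP[B hB ->].
  rewrite /comm_mx -!conjmxM ?inE ?stablemx_row_base ?sW //.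
  by rewrite (cAs A B).
exists (v *m row_base W); split.
- by rewrite mulmx_free_eq0 ?row_base_free.
- by rewrite mulmx_sub // eq_row_base.
apply/allP => B hB; rewrite -stablemx_restrict ?sW //.
by apply: vP; apply: map_f.
Qed.

(** * Central laws *)

Section ClassEigenvector.
Variables (R : rcfType) (gT : finGroupType) (G : {group gT}).
Local Notation C := R[i]%C.
Implicit Types f : gT -> C.

Definition class_op (y : gT) f (x : gT) : C := \sum_(h in G) f ((y ^ h)^-1 * x)%g.

Lemma class_opC y z f x : y \in G -> z \in G ->
  class_op y (class_op z f) x = class_op z (class_op y f) x.
Proof.
move=> Gy Gz; rewrite /class_op [RHS]exchange_big /=; apply: eq_bigr => h Gh.
rewrite -[LHS](sum_mulgr _ (groupJ Gy Gh)) /=; apply: eq_bigr => k _.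
congr f; rewrite conjgM; move: (z ^ k)%g (y ^ h)%g => a b.
by rewrite -conjVg conjgE !mulgA mulgK.
Qed.

(** Products of class sums are sums of class sums, so the span of all [class_op y f] is stable under
    every [class_op z]. *)
Lemma class_op_comp y z f x : y \in G -> z \in G ->
  class_op z (class_op y f) x = \sum_(h in G) class_op (z ^ h * y)%g f x.
Proof.
move=> Gy Gz; rewrite /class_op exchange_big [RHS]exchange_big /=; apply: eq_bigr => k Gk.
rewrite -[LHS](sum_mulgr _ Gk) /=; apply: eq_bigr => h _.
by rewrite conjMg conjgM; move: (_ ^ k)%g (y ^ k)%g => a b; rewrite invMg mulgA.
Qed.

Variable phi : gT -> R.
Hypothesis phiJ : forall x g, g \in G -> phi (x ^ g)%g = phi x.

Definition class_eigenfunction (d : R) f :=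
  [/\ forall x, x \notin G -> f x = 0,
      forall x g, g \in G -> f (x ^ g)%g = f x,
      \sum_(x in G) f x = 0 &
      forall x, \sum_(y in G) (phi y)%:C%C * f (y^-1 * x)%g = d%:C%C * f x].

Lemma class_op_eigenfunction d y f : y \in G -> class_eigenfunction d f ->
  class_eigenfunction d (class_op y f).
Proof.
move=> Gy [fG fJ f0 fphi]; rewrite /class_op; split.
- by move=> x nGx; rewrite big1 // => h Gh; rewrite fG // groupMl // groupV groupJ.
- move=> x g Gg; rewrite -[LHS](sum_mulgr _ Gg) /=; apply: eq_bigr => h Gh.
  by rewrite conjgM -conjVg -conjMg fJ.
- rewrite exchange_big big1 //= => h Gh.
  by rewrite (sum_mulgl f) ?groupV ?groupJ.
move=> x; under eq_bigr do rewrite mulr_sumr.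
rewrite exchange_big mulr_sumr /=; apply: eq_bigr => h Gh.
have Gyh : (y ^ h)%g \in G by rewrite groupJ.
rewrite -fphi [LHS](reindex_inj (conjg_inj (y ^ h)^-1%g)) /=.
apply: eq_big => [w|w _]; first by rewrite groupJr ?groupV.
rewrite phiJ ?groupV //; congr (_ * f _).
move: (y ^ h)%g => b; by rewrite -conjVg conjgE invgK !mulgA mulVg mul1g.
Qed.

(** Class sums commute and preserve the class eigenfunctions of [phi] for [d], so they have a common
    eigenvector among these. Once it is normalised, pairing the eigenvalue equation with [z]
    identifies the eigenvalue as [#|G|] times [corr z y]. *)
Lemma class_eigenvector_exists d f : class_eigenfunction d f -> (exists x, f x != 0) ->
  exists2 z : gT -> C, class_eigenfunction d z /\ \sum_x sqn (z x) = 1 &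
    forall y x, y \in G -> \sum_(h in G) z ((y ^ h)^-1 * x)%g = #|G|%:R * corr z y * z x.
Proof.
move=> ef [x0 fx0].
pose N := #|gT|; pose ev (v : 'rV[C]_N) (x : gT) := v 0 (enum_rank x).
pose op y : 'M[C]_N := \matrix_(i, j) \sum_(h in G) (enum_val i == (y ^ h)^-1 * enum_val j)%g%:R.
have evop v y x : ev (v *m op y) x = class_op y (ev v) x.
  rewrite /ev /class_op mxE; under eq_bigr do rewrite mxE mulr_sumr.
  rewrite exchange_big /=; apply: eq_bigr => h Gh.
  rewrite (bigD1 (enum_rank ((y ^ h)^-1 * x)%g)) //= !enum_rankK eqxx mulr1.
  rewrite big1 ?addr0 // => j nj; case: eqP => [e|]; last by rewrite mulr0.
  by case/eqP: nj; rewrite -e enum_valK.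
have ev_inj v w : ev v =1 ev w -> v = w.
  by move=> e; apply/rowP => i; have := e (enum_val i); rewrite /ev enum_valK.
(* The rows of [W] are the functions [class_op y f]; the row of 1 is [#|G|] times [f], so [W] is
   nonzero. *)
pose W : 'M[C]_N := \matrix_(i, j)
  (if enum_val i \in G then class_op (enum_val i) f (enum_val j) else 0).
have rowW y : y \in G -> ev (row (enum_rank y) W) =1 class_op y f.
  by move=> Gy x; rewrite /ev !mxE enum_rankK Gy enum_rankK.
have rowW0 y : y \notin G -> ev (row (enum_rank y) W) =1 fun=> 0.
  by move=> Gy x; rewrite /ev !mxE enum_rankK (negPf Gy).
have evD v w x : ev (v + w) x = ev v x + ev w x by rewrite /ev mxE.
have ev_sum (I : finType) (P : pred I) (F : I -> 'rV_N) x :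
    ev (\sum_(i | P i) F i) x = \sum_(i | P i) ev (F i) x by rewrite /ev summxE.
pose As := [seq op y | y <- enum G].
have [fG fJ f0 fphi] := ef.
have W0 : W != 0.
  apply/eqP => W0; have := rowW 1%g (group1 G) x0; rewrite W0 /ev !mxE /class_op.
  under eq_bigr do rewrite conj1g invg1 mul1g.
  rewrite sumr_const => /esym /eqP; rewrite mulrn_eq0 (negPf fx0) orbF.
  by rewrite eqn0Ngt cardG_gt0.
have cAs : {in As &, forall A B, comm_mx A B}.
  move=> _ _ /mapP[y Gy ->] /mapP[z Gz ->]; rewrite !mem_enum in Gy Gz.
  rewrite /comm_mx; apply/row_matrixP => i; rewrite !row_mul; apply: ev_inj => x.
  have opop a b : row i (op a) *m op b = delta_mx 0 i *m op a *m op b by rewrite -rowE.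
  rewrite !opop !evop.
  transitivity (class_op z (class_op y (ev (delta_mx 0 i))) x).
    by apply: eq_bigr => h _; rewrite evop.
  by rewrite class_opC //; apply: eq_bigr => h _; rewrite evop.
have sW : all (fun A => stablemx W A) As.
  apply/allP => _ /mapP[z Gz ->]; rewrite mem_enum in Gz.
  apply/row_subP => i; rewrite row_mul -(enum_valK i); set y := enum_val i.
  have [Gy|nGy] := boolP (y \in G); last first.
    suff -> : row (enum_rank y) W *m op z = 0 by apply: sub0mx.
    apply: ev_inj => x; rewrite evop [RHS]mxE /class_op big1 // => h _.
    exact: rowW0.
  have -> : row (enum_rank y) W *m op z = \sum_(h in G) row (enum_rank (z ^ h * y)%g) W.
    apply: ev_inj => x; rewrite evop ev_sum.
    transitivity (class_op z (class_op y f) x).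
      by apply: eq_bigr => h _; rewrite rowW.
    rewrite class_op_comp //; apply: eq_bigr => h Gh.
    by rewrite rowW // groupM // groupJ.
  by apply: summx_sub => h _; apply: row_sub.
have [v [v0 vW /allP sv]] := common_eigenvector_sub W0 cAs sW.
have eigv : class_eigenfunction d (ev v).
  have [u ->] := submxP vW.
  have E x : ev (u *m W) x = \sum_(i | enum_val i \in G) u 0 i * class_op (enum_val i) f x.
    rewrite /ev mxE [RHS]big_mkcond /=; apply: eq_bigr => i _; rewrite mxE enum_rankK.
    by case: ifP => // _; rewrite mulr0.
  have ce i : enum_val i \in G -> class_eigenfunction d (class_op (enum_val i) f).
    by move=> Gi; apply: class_op_eigenfunction.
  split.
  - by move=> x nGx; rewrite E big1 // => i /ce[h _ _ _]; rewrite h // mulr0.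
  - by move=> x g Gg; rewrite !E; apply: eq_bigr => i /ce[_ h _ _]; rewrite h.
  - under eq_bigr do rewrite E; rewrite exchange_big big1 //= => i /ce[_ _ h _].
    by rewrite -mulr_sumr h mulr0.
  move=> x; under eq_bigr do rewrite E mulr_sumr.
  rewrite exchange_big E mulr_sumr /=; apply: eq_bigr => i /ce[_ _ _ h].
  by under eq_bigr do rewrite mulrCA; rewrite -mulr_sumr h mulrCA.
pose nv := \sum_x sqn (ev v x).
have nv0 : 0 < nv.
  rewrite lt0r sumr_ge0 ?andbT => [|x _]; last exact: sqn_ge0.
  apply: contra v0 => /eqP nv0; apply/eqP; apply: ev_inj => x; rewrite [RHS]mxE.
  apply/eqP; rewrite -sqn_eq0; apply/eqP; apply: (psumr_eq0P _ nv0) => // w _.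
  exact: sqn_ge0.
pose s := (Num.sqrt nv)^-1; pose z x := s%:C%C * ev v x.
have ez : class_eigenfunction d z.
  have [h1 h2 h3 h4] := eigv; split.
  - by move=> x nGx; rewrite /z h1 // mulr0.
  - by move=> x g Gg; rewrite /z h2.
  - by rewrite -mulr_sumr h3 mulr0.
  by move=> x; rewrite /z; under eq_bigr do rewrite mulrCA; rewrite -mulr_sumr h4 mulrCA.
have z1 : \sum_x sqn (z x) = 1.
  under eq_bigr do rewrite sqnM sqnR.
  by rewrite -mulr_sumr exprVn sqr_sqrtr ?(ltW nv0) // mulVf // lt0r_neq0.
exists z => // y x Gy.
have [c vc] : exists c, forall w, class_op y z w = c * z w.
  have /sub_rVP[c vc] : (v *m op y <= v)%MS by apply: sv; apply: map_f; rewrite mem_enum.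
  exists c => w; transitivity (s%:C%C * class_op y (ev v) w).
    by rewrite /class_op mulr_sumr.
  by rewrite -evop vc /z /ev mxE mulrCA.
rewrite -/(class_op y z x) vc; congr (_ * _).
have [_ zJ _ _] := ez.
have z1C : \sum_x z x * (z x)^* = 1.
  by under eq_bigr do rewrite -sqnE; rewrite -sum_real_complex z1.
transitivity (c * \sum_x z x * (z x)^*); first by rewrite z1C mulr1.
rewrite mulr_sumr.
transitivity (\sum_(h in G) corr z (y ^ h)%g).
  rewrite /corr exchange_big /=; apply: eq_bigr => w _.
  by rewrite mulrA -vc /class_op mulr_suml.
under eq_bigr => h Gh do rewrite (corrJ zJ) //.
by rewrite sumr_const mulr_natl.
Qed.

End ClassEigenvector.

Lemma sqn_weighted_mean (R : rcfType) (T : finType) (P : pred T) (mu : T -> R) (f : T -> R[i]%C) :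
  (forall x, P x -> 0 <= mu x) ->
  sqn (\sum_(x | P x) (mu x)%:C%C * f x) <=
  (\sum_(x | P x) mu x) * \sum_(x | P x) mu x * sqn (f x).
Proof.
move=> mu0; rewrite sum_weighted_complex.
have ha := weighted_cauchy_schwarz (fun x => complex.Re (f x)) mu0.
have hb := weighted_cauchy_schwarz (fun x => complex.Im (f x)) mu0.
move: ha hb; set a := \sum_(x | P x) mu x * complex.Re _;
  set b := \sum_(x | P x) mu x * complex.Im _.
move=> ha hb; have -> : sqn (a%:C%C + 'i%C * b%:C%C) = a ^+ 2 + b ^+ 2 by rewrite /sqn /=; ring.
apply: le_trans (lerD ha hb) _; rewrite -mulrDr -big_split /=.
apply: le_of_eq; congr (_ * _).
by apply: eq_bigr => x _; rewrite -mulrDr.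
Qed.

Section CentralNorm.
Variables (R : rcfType) (gT : finGroupType) (G : {group gT}) (phi : gT -> R).
Local Notation C := R[i]%C.
Hypothesis phi_ge0 : forall x, 0 <= phi x.
Hypothesis phiJ : forall x g, g \in G -> phi (x ^ g)%g = phi x.
Hypothesis phiV : forall x, phi x^-1%g = phi x.
Hypothesis phi1 : \sum_(x in G) phi x = 1.

Let n : R := #|G|%:R.

Let n0 : n != 0.
Proof. by rewrite pnatr_eq0 -lt0n cardG_gt0. Qed.

(** Convolution by [phi] minus the projection to constants, extended by zero to a kernel on all of
    [gT]. *)
Let k (x y : gT) : C := if (x \in G) && (y \in G) then (phi (x * y^-1)%g - n^-1)%:C%C else 0.

Let kH x y : k y x = (k x y)^*.
Proof.
rewrite /k andbC; case: ifP => _; last by rewrite rmorph0.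
rewrite -[(y * _)%g]invgK phiV invMg invgK.
by apply/esym/CrealP/complex_realP; eexists.
Qed.

Let col_sum y : \sum_x k x y = 0.
Proof.
have [Gy|nGy] := boolP (y \in G); last first.
  by apply: big1 => x _; rewrite /k (negPf nGy) andbF.
transitivity (\sum_(x in G) (phi (x * y^-1)%g - n^-1)%:C%C).
  by rewrite [RHS]big_mkcond; apply: eq_bigr => x _; rewrite /k Gy andbT.
rewrite -sum_real_complex sumrB (sum_mulgr phi) ?groupV // phi1 sumr_const.
by rewrite -mulr_natl mulfV // subrr.
Qed.

Let kernel_norm (e : gT -> gT -> C) (d : gT -> R) (s : R) :
  (forall x y, \sum_i e i x * (e i y)^* = (x == y)%:R) ->
  (forall i x, \sum_y k x y * e i y = (d i)%:C%C * e i x) ->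
  (forall i, d i ^+ 2 <= s) -> forall f : gT -> C,
  \sum_x sqn (\sum_y k x y * f y) <= s * \sum_x sqn (f x).
Proof.
move=> e2 e3 ds f; rewrite -(parseval e2) -(parseval e2 f) mulr_sumr; apply: ler_sum => i _.
have -> : \sum_x e i x * (\sum_y k x y * f y)^* = (d i)%:C%C * \sum_x e i x * (f x)^*.
  rewrite mulr_sumr; under [RHS]eq_bigr do rewrite mulrA -e3 mulr_suml.
  rewrite exchange_big /=; apply: eq_bigr => x _.
  rewrite rmorph_sum mulr_sumr; apply: eq_bigr => y _.
  by rewrite rmorphM /= -kH; ring.
by rewrite sqnM sqnR ler_wpM2r ?sqn_ge0.
Qed.

Lemma conv_kernel (f : gT -> R) x : x \in G ->
  \sum_y k x y * (if y \in G then f y else 0)%:C%C =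
  (conv G phi f x - n^-1 * \sum_(y in G) f y)%:C%C.
Proof.
move=> Gx; transitivity (\sum_(y in G) ((phi (x * y^-1)%g - n^-1) * f y)%:C%C).
  rewrite [RHS]big_mkcond; apply: eq_bigr => y _; rewrite /k Gx /=.
  by case: ifP => _; rewrite ?mul0r // rmorphM.
rewrite -sum_real_complex; congr (_%:C%C).
under eq_bigr do rewrite mulrBl.
rewrite sumrB -mulr_sumr; congr (_ - _).
rewrite /conv -sum_invg -[RHS](sum_mulgl _ Gx) /=; apply: eq_bigr => y _.
by rewrite invgK invMg mulgKV.
Qed.

(** [s] is the largest squared eigenvalue of [k] and bounds the bilinear form. If it is nonzero, an
    eigenfunction is turned into a class function [z] with the same eigenvalue [d]; then [d] is the
    [phi]-average of [corr z], and its square is at most the average of the squared modulus. *)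
Lemma central_norm : exists2 s : R,
  0 <= s /\ forall f h : gT -> R,
    (\sum_(x in G) h x * conv G phi f x - n^-1 * (\sum_(x in G) f x) * (\sum_(x in G) h x)) ^+ 2
    <= s * (\sum_(x in G) f x ^+ 2) * (\sum_(x in G) h x ^+ 2) &
  s = 0 \/ exists d (z : gT -> C),
    [/\ class_eigenfunction G phi d z,
     \sum_x sqn (z x) = 1,
     forall y x, y \in G -> \sum_(h in G) z ((y ^ h)^-1 * x)%g = #|G|%:R * corr z y * z x &
     s <= \sum_(y in G) phi y * sqn (corr z y)].
Proof.
have [e [d [e1 e2 e3]]] := hermitian_spectral_fun kH.
have [i0 i0max] : exists i0, forall i, d i ^+ 2 <= d i0 ^+ 2.
  by case: (@arg_maxP _ _ _ 1%g predT (fun i => d i ^+ 2) isT) => i0 _ h0; exists i0 => i;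
    apply: h0.
exists (d i0 ^+ 2).
  split; first exact: sqr_ge0.
  move=> f h; pose f' x := (if x \in G then f x else 0)%:C%C;
    pose h' x := (if x \in G then h x else 0)%:C%C.
  have nE (u : gT -> R) : \sum_x sqn (if x \in G then u x else 0)%:C%C = \sum_(x in G) u x ^+ 2.
    by rewrite [RHS]big_mkcond; apply: eq_bigr => x _; rewrite sqnR; case: ifP => // _;
      rewrite expr0n.
  have := cauchy_schwarz predT (fun x => \sum_y k x y * f' y) h'.
  have -> : \sum_x (\sum_y k x y * f' y) * (h' x)^* =
    (\sum_(x in G) h x * conv G phi f x - n^-1 * (\sum_(x in G) f x) * (\sum_(x in G) h x))%:C%C.
    transitivity (\sum_(x in G) (h x * conv G phi f x - h x * (n^-1 * \sum_(y in G) f y))%:C%C).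
      rewrite [RHS]big_mkcond; apply: eq_bigr => x _; rewrite /h'.
      case: ifP => [Gx|_]; last by rewrite rmorph0 mulr0.
      rewrite conv_kernel // -mulrBr mulrC rmorphM; congr (_ * _).
      by apply/CrealP/complex_realP; eexists.
    rewrite -sum_real_complex sumrB -mulr_suml; congr (_%:C%C); ring.
  rewrite sqnR => h1; apply: le_trans h1 _; rewrite nE ler_wpM2r //.
    by apply: sumr_ge0 => x _; apply: sqr_ge0.
  by rewrite -nE; apply: (kernel_norm e2 e3).
have [d0|d0] := eqVneq (d i0) 0; first by left; rewrite d0 expr0n.
right.
have eG x : x \notin G -> e i0 x = 0.
  move=> nGx; have := e3 i0 x; rewrite big1 => [/esym/eqP|y _].
    by rewrite mulf_eq0 (fmorph_eq0 (real_complex R)) (negPf d0) => /eqP.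
  by rewrite /k (negPf nGx) mul0r.
have esum : \sum_x e i0 x = 0.
  have : (d i0)%:C%C * \sum_x e i0 x = 0.
    rewrite mulr_sumr; under eq_bigr do rewrite -e3.
    by rewrite exchange_big big1 //= => y _; rewrite -mulr_suml col_sum mul0r.
  by move/eqP; rewrite mulf_eq0 (fmorph_eq0 (real_complex R)) (negPf d0) => /eqP.
have esumG : \sum_(x in G) e i0 x = 0.
  rewrite -[RHS]esum [RHS](bigID [in G]) /= [X in _ = _ + X]big1 ?addr0 // => x; exact: eG.
have econv x : \sum_(y in G) (phi y)%:C%C * e i0 (y^-1 * x)%g = (d i0)%:C%C * e i0 x.
  have [Gx|nGx] := boolP (x \in G); last first.
    rewrite eG // mulr0 big1 // => y Gy; rewrite eG ?mulr0 // groupMl ?groupV //.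
  transitivity (\sum_(y in G) ((phi (x * y^-1)%g)%:C%C - (n^-1)%:C%C) * e i0 y).
    under [RHS]eq_bigr do rewrite mulrBl.
    rewrite sumrB -mulr_sumr esumG mulr0 subr0 -[LHS]sum_invg -[LHS](sum_mulgr _ (groupVr Gx)) /=.
    by apply: eq_bigr => y _; rewrite invgK mulgKV invMg invgK.
  rewrite -e3 big_mkcond; apply: eq_bigr => y _; rewrite /k Gx /=.
  by case: ifP => _; rewrite ?mul0r // rmorphB.
have [a ea] : exists a, e i0 a != 0.
  apply/existsP; apply: contraT; rewrite negb_exists => /forallP h.
  have := e1 i0 i0; rewrite big1 => [/esym/eqP|x _]; first by rewrite eqxx oner_eq0.
  by have := h x; rewrite negbK => /eqP ->; rewrite mul0r.
have Ga : a \in G by apply: contraR ea => /eG ->.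
(* Translate so that the value at 1 is nonzero, then average over conjugation; as [phi] is central,
   the eigenvalue is kept. *)
pose f x := \sum_(h in G) e i0 (x ^ h * a)%g.
have ef : class_eigenfunction G phi (d i0) f.
  split.
  - by move=> x nGx; apply: big1 => h Gh; rewrite eG // groupMr // groupJr.
  - move=> x g Gg; rewrite -[RHS](sum_mulgl _ Gg); apply: eq_bigr => h _.
    by rewrite conjgM.
  - rewrite exchange_big big1 //= => h Gh.
    rewrite -[RHS]esumG -[RHS](sum_mulgr _ Ga) [RHS](reindex_inj (conjg_inj h)) /=.
    by apply: eq_bigl => x; rewrite groupJr.
  move=> x; under eq_bigr do rewrite mulr_sumr.
  rewrite exchange_big mulr_sumr /=; apply: eq_bigr => h Gh; rewrite -econv.
  rewrite [RHS](reindex_inj (conjg_inj h)) /=; apply: eq_big => [y|y _]; first by rewrite groupJr.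
  by rewrite phiJ // conjMg conjVg -(mulgA (y ^ h)^-1)%g.
have f1 : exists x, f x != 0.
  exists 1%g; rewrite /f; under eq_bigr do rewrite conj1g mul1g.
  by rewrite sumr_const mulrn_eq0 (negPf ea) orbF -lt0n cardG_gt0.
have [z [ez z1] zr] := class_eigenvector_exists phiJ ef f1.
exists (d i0), z; split=> //; rewrite -sqnR.
have <- : \sum_(y in G) (phi y)%:C%C * corr z y = (d i0)%:C%C.
  have [_ _ _ h] := ez.
  transitivity (\sum_x (d i0)%:C%C * z x * (z x)^*).
    under [RHS]eq_bigr do rewrite -h mulr_suml.
    rewrite exchange_big /=; apply: eq_bigr => y _; rewrite /corr mulr_sumr.
    by apply: eq_bigr => x _; rewrite mulrA.
  under eq_bigr do rewrite -mulrA -sqnE.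
  by rewrite -mulr_sumr -sum_real_complex z1 rmorph1 mulr1.
by rewrite -[leRHS]mul1r -phi1; apply: sqn_weighted_mean.
Qed.

End CentralNorm.

(** * Central laws and Gowers' trick in a quasirandom group *)

Section Quasirandom.
Variables (R : rcfType) (gT : finGroupType) (G : {group gT}) (Delta : R).
Local Notation C := R[i]%C.
Hypothesis minD : min_degree G Delta.
Hypothesis Delta1 : 1 < Delta.

Let n0 : 0 < #|G|%:R :> R.
Proof. by rewrite ltr0n cardG_gt0. Qed.

Let D0 : 0 < Delta. Proof. exact: lt_trans Delta1. Qed.

(** By [corr_decay] and the size condition, [sqn (corr z y) <= rho] off the proper normal subgroup
    where it is 1. Take [N] maximal normal above that subgroup and bound the modulus by 1 on [N]. If
    [s = 0], any [N] serves. *)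
Lemma central_bound (phi : gT -> R) (rho : R) I :
  (forall x, 0 <= phi x) -> (forall x g, g \in G -> phi (x ^ g)%g = phi x) ->
  (forall x, phi x^-1%g = phi x) -> \sum_(x in G) phi x = 1 -> G :!=: 1%g ->
  0 <= rho -> #|G|%:R * (320 * 9 ^ I)%N%:R ^+ I < (Delta * rho ^+ (4 * 3 ^ I)) ^+ I ->
  exists2 N : {group gT}, maxnormal N G G & forall f h : gT -> R,
    (\sum_(x in G) h x * conv G phi f x - #|G|%:R^-1 * (\sum_(x in G) f x) * (\sum_(x in G) h
      x)) ^+ 2
    <= (rho + \sum_(x in N) phi x) * (\sum_(x in G) f x ^+ 2) * (\sum_(x in G) h x ^+ 2).
Proof.
move=> phi0 phiJ phiV phi1 G1 rho0 big.
have maxN (K : {group gT}) : K \proper G -> (G \subset 'N(K))%g ->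
    exists2 N : {group gT}, maxnormal N G G & K \subset N.
  move=> pK nK; pose gP := [pred N : {group gT} | (N \proper G) && (G \subset 'N(N))%g].
  have gK : gP K by rewrite /= pK.
  by have [N mN KN] := maxgroup_exists gK; exists N.
have [s [s0 hs] hz] := central_norm phi0 phiJ phiV phi1.
have fin (N : {group gT}) : s <= rho + \sum_(x in N) phi x -> forall f h : gT -> R,
    (\sum_(x in G) h x * conv G phi f x - #|G|%:R^-1 * (\sum_(x in G) f x) * (\sum_(x in G) h
      x)) ^+ 2
    <= (rho + \sum_(x in N) phi x) * (\sum_(x in G) f x ^+ 2) * (\sum_(x in G) h x ^+ 2).
  move=> sN f h; apply: le_trans (hs f h) _.
  by rewrite !ler_wpM2r // sumr_ge0 // => x _; apply: sqr_ge0.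
case: hz => [s00|[d [z [[zG zJ z0 _] z1 zr hsz]]]].
  have p1 : 1%G \proper G by rewrite proper1G.
  have [N mN _] := maxN 1%G p1 (normal_norm (normal1 G)).
  by exists N => //; apply: fin; rewrite s00 addr_ge0 // sumr_ge0.
have kN := corr_ker_normal zJ; have kP := corr_ker_proper minD Delta1 zG zJ z0 z1.
have [N mN kerN] := maxN (corr_ker_Group G z1) kP (normal_norm kN).
exists N => //; apply: fin; apply: le_trans hsz _.
have /andP[NG _] := maxnormal_normal mN.
rewrite (bigID [in N]) /= addrC lerD //.
  apply: le_trans (_ : \sum_(y in G) phi y * rho <= _).
    rewrite [leRHS](bigID [in N]) /= ler_wpDl //; first by rewrite sumr_ge0 // => y _;
      rewrite mulr_ge0.
    apply: ler_sum => y /andP[Gy nNy]; rewrite ler_wpM2l // leNgt; apply/negP => lt.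
    have r1 : sqn (corr z y) < 1.
      rewrite lt_neqAle corr_le1 // andbT; apply: contra nNy => e1.
      by apply: (subsetP kerN); rewrite inE Gy.
    have := corr_decay D0 (corr1 z1) (corrV z) (sum_corrJ zr) (mean_sqn_corrJ minD Delta1 zJ z1
      zr) Gy r1 I.
    apply/negP; rewrite -ltNge; apply: lt_le_trans big _.
    rewrite lerXn2r ?nnegrE ?mulr_ge0 ?exprn_ge0 ?sqn_ge0 // ?(ltW D0) //.
    by rewrite ler_wpM2l ?(ltW D0) // lerXn2r ?nnegrE ?sqn_ge0 // ltW.
  by rewrite -mulr_suml phi1 mul1r.
apply: le_trans (_ : \sum_(y in G | y \in N) phi y <= _).
  by apply: ler_sum => y _; rewrite ler_piMr // corr_le1.
apply: le_of_eq; apply: eq_bigl => y.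
by rewrite andbC; case Ny: (y \in N) => //=; apply: (subsetP NG).
Qed.

(** If [g] is not in [A * A * A], then for [c] and [b] in [A] the element [g c^-1 b^-1] is not in
    [A]. So [#|A|] translates of the balanced indicator [f] have correlation exactly [- a ^ 2 / n]
    with the indicator of [A^-1], too many for mixing. *)
Lemma gowers_trick (A : {set gT}) : A \subset G ->
  #|G|%:R ^+ 3 < Delta * #|A|%:R ^+ 3 -> (A * A * A)%g = G.
Proof.
move=> AG big; apply/eqP; rewrite eqEsubset !mul_subG //=.
apply/subsetP => g Gg; apply: contraLR big => ng; rewrite -leNgt.
pose a : R := #|A|%:R; pose n : R := #|G|%:R.
pose f (w : gT) : C := if w \in G then ((w \in A)%:R - a / n)%:C%C else 0.
pose h (w : gT) : C := ((w^-1%g \in A)%:R : R)%:C%C.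
have sumA : \sum_(x in G) (x \in A)%:R = a.
  rewrite -natr_sum /a -sum1_card big_mkcond [in RHS]big_mkcond /=; congr (_%:R).
  apply: eq_bigr => x _; case: (boolP (x \in A)) => [Ax|_]; last by case: ifP.
  by rewrite (subsetP AG).
have f0 w : \sum_(x in G) f (x * w)%g = 0.
  have [Gw|nGw] := boolP (w \in G); last first.
    by apply: big1 => x Gx; rewrite /f groupMl // (negPf nGw).
  rewrite sum_mulgr // /f; transitivity (\sum_(x in G) ((x \in A)%:R - a / n)%:C%C).
    by apply: eq_bigr => x ->.
  rewrite -sum_real_complex sumrB sumA sumr_const -mulr_natr divfK ?subrr //.
  by rewrite lt0r_neq0.
have := @mixing _ _ G _ minD _ (fun x w => x * w)%g (fun w => mul1g w)
  (fun x y _ _ w => esym (mulgA x y w)) f f0 h (ltW D0).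
have nh : \sum_w sqn (h w) = a.
  rewrite (reindex_inj invg_inj) /=; under eq_bigr do rewrite /h invgK sqnR -natrX.
  rewrite -natr_sum /a -sum1_card [in RHS]big_mkcond /=; congr (_%:R).
  by apply: eq_bigr => x _; case: (x \in A).
have nf : \sum_w sqn (f w) <= a.
  apply: le_trans (_ : \sum_(w in G) ((w \in A)%:R - a / n) ^+ 2 <= _).
    apply: le_of_eq; rewrite [RHS]big_mkcond /=; apply: eq_bigr => w _; rewrite /f /=;
      case: ifP => _; [exact: sqnR | exact: sqn0].
  apply: le_trans (_ : \sum_(w in G) ((w \in A)%:R - 2 * (a / n) * (w \in A)%:R +
    (a / n) ^+ 2) <= _).
    by apply: ler_sum => w _; case: (w \in A) => /=; apply: le_of_eq; ring.
  rewrite big_split sumrB /= -mulr_sumr sumA sumr_const -[_ *+ #|G|]mulr_natr -/n.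
  have -> : (a / n) ^+ 2 * n = a / n * a by field; rewrite lt0r_neq0.
  have : 0 <= a / n * a by rewrite !mulr_ge0 ?invr_ge0 ?ler0n.
  move: (a / n) => u; nra.
move=> mix; have {mix} : Delta * \sum_(x in G) sqn (\sum_w f (x * w)%g * (h w)^*) <= n * a * a.
  by apply: le_trans mix _; rewrite nh ler_wpM2r ?ler0n // ler_wpM2l ?ler0n.
have lower : a * (a * a / n) ^+ 2 <= \sum_(x in G) sqn (\sum_w f (x * w)%g * (h w)^*).
  apply: le_trans (_ : \sum_(c in A) (a * a / n) ^+ 2 <= _).
    by rewrite sumr_const mulr_natl.
  rewrite [leRHS](reindex_inj (mulgI g)) /= [leRHS](reindex_inj invg_inj) /=.
  rewrite [leRHS](bigID [in A]) /= ler_wpDr ?sumr_ge0 // => [x _|]; first exact: sqn_ge0.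
  rewrite big_mkcond [leRHS]big_mkcond /=; apply: ler_sum => c _.
  case Ac: (c \in A); last by rewrite andbF.
  have Gc := subsetP AG c Ac; rewrite groupM ?groupV //=.
  suff -> : \sum_w f (g * c^-1 * w)%g * (h w)^* = (- (a * a / n))%:C%C by rewrite sqnR sqrrN.
  rewrite (reindex_inj invg_inj) /=.
  transitivity (\sum_(b in A) (- (a / n))%:C%C).
    rewrite [RHS]big_mkcond; apply: eq_bigr => b _; rewrite /h invgK.
    case Ab: (b \in A); last by rewrite !rmorph0 mulr0.
    rewrite !rmorph1 mulr1 /f !groupM ?groupV ?(subsetP AG b) //.
    case Au: (_ \in A); last by rewrite sub0r.
    case/negP: ng; apply/mulsgP; exists (g * c^-1 * b^-1 * b)%g c => //; last by rewrite !mulgKV.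
    exact: mem_mulg.
  by rewrite sumr_const -mulr_natl -(rmorph_nat (real_complex R)) -rmorphM; congr (_%:C%C); ring.
move=> up; have H := le_trans (ler_wpM2l (ltW D0) lower) up.
have [a0|a0] := eqVneq a 0; first by rewrite -/a a0 expr0n /= mulr0 exprn_ge0 ?ltW.
have {}a0 : 0 < a by rewrite lt0r a0 ler0n.
rewrite -/a -/n.
have n2 : 0 < n ^+ 2 by rewrite exprn_gt0.
have a2 : 0 < a ^+ 2 by rewrite exprn_gt0.
rewrite -(ler_pM2l a2).
have -> : a ^+ 2 * (Delta * a ^+ 3) = Delta * (a * (a * a / n) ^+ 2) * n ^+ 2 by field;
  rewrite lt0r_neq0.
have -> : a ^+ 2 * n ^+ 3 = n * a * a * n ^+ 2 by ring.
by rewrite ler_pM2r.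
Qed.

(** Gowers' trick is applied to the preimage of [Y], so that only [G] itself has to be
    quasirandom. *)
Lemma quotient_gowers (Dl : nat) (N : {group gT}) (Y : {set coset_of N}) :
  Dl%:R <= Delta -> maxnormal N G G -> Y \subset (G / N)%g ->
  (#|G / N|%g ^ 3 < Dl * #|Y| ^ 3)%N -> (Y ^+ 3)%g = (G / N)%g.
Proof.
move=> DlD mN YQ big; have NG := maxnormal_normal mN; have nN := normal_norm NG.
pose A := (coset N @*^-1 Y)%g.
have AG : A \subset G by rewrite -(quotientGK NG) morphpreS.
have cA : (#|Y| * #|N| <= #|A|)%N.
  rewrite -[leqRHS]mul1n; apply: (@fiber_card_ge _ _ (coset N)) => b Yb.
  have /morphimP[x Nx Gx bE] := subsetP YQ b Yb; rewrite /= in bE.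
  rewrite mul1n -(card_lcoset N x); apply: subset_leq_card; apply/subsetP => w.
  rewrite mem_lcoset => Nw; have wE : coset N w = b by rewrite -(mulKVg x w) coset_kerr.
  have nw : w \in 'N(N)%g by rewrite -(mulKVg x w) groupM // (subsetP (normG N)).
  by rewrite in_set wE eqxx andbT mem_morphpre //= wE.
have bigG : #|G|%:R ^+ 3 < Delta * #|A|%:R ^+ 3.
  apply: lt_le_trans (_ : Dl%:R * #|A|%:R ^+ 3 <= _); last by rewrite ler_wpM2r ?exprn_ge0.
  rewrite -!natrX -natrM ltr_nat -(Lagrange (normal_sub NG)) -card_quotient // mulnC.
  apply: leq_trans (_ : Dl * (#|Y| * #|N|) ^ 3 <= _)%N; last first.
    by rewrite leq_mul2l leq_exp2r ?cA ?orbT.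
  by rewrite !expnMn mulnA ltn_pmul2r // expn_gt0 cardG_gt0.
have <- : (A / N)%g = Y by apply: cosetpreK.
have nA : A \subset 'N(N)%g by apply: subset_trans nN.
rewrite -[in RHS](gowers_trick AG bigG) !quotientMl ?mul_subG //.
by rewrite !expgS expg0 mulg1 mulgA.
Qed.

(** A proper subgroup equals its own cube, so Gowers' trick must fail for it. *)
Lemma maxnormal_index (N : {group gT}) : maxnormal N G G ->
  Delta * #|N|%:R ^+ 3 <= #|G|%:R ^+ 3.
Proof.
move=> mN; rewrite leNgt; apply/negP => big.
have /andP[/andP[NG nGN] _] := maxgroupp mN.
have := gowers_trick NG big; rewrite !mulGid => NE.
by move: nGN; rewrite NE subxx.
Qed.

End Quasirandom.

(** * Random conjugates of a set and their mass on an approximate group *)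

Section RandomConjugate.
Variables (R : rcfType) (gT : finGroupType) (G : {group gT}) (Y : {set gT}).
Hypothesis YG : Y \subset G.
Hypothesis Y0 : (0 < #|Y|)%N.
Hypothesis sY : (Y^-1)%g = Y.

(** The law of a uniformly random conjugate of a uniformly random element of [Y]. *)
Definition random_conjugate (x : gT) : R :=
  (#|G|%:R * #|Y|%:R)^-1 * \sum_(h in G) (x ^ h \in Y)%g%:R.
Local Notation phi := random_conjugate.

Lemma random_conjugate_ge0 x : 0 <= phi x.
Proof. by rewrite mulr_ge0 ?invr_ge0 ?mulr_ge0 ?sumr_ge0. Qed.

Lemma random_conjugateJ x g : g \in G -> phi (x ^ g)%g = phi x.
Proof.
move=> Gg; rewrite /phi -[in RHS](sum_mulgl _ Gg); congr (_ * _).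
by apply: eq_bigr => h _; rewrite conjgM.
Qed.

Lemma random_conjugateV x : phi x^-1%g = phi x.
Proof.
by congr (_ * _); apply: eq_bigr => h _; rewrite conjVg -mem_invg sY.
Qed.

Lemma random_conjugate_set (A : {set gT}) :
  \sum_(x in A) phi x = (#|G|%:R * #|Y|%:R)^-1 * \sum_(h in G) #|(A :^ h :&: Y)%g|%:R.
Proof.
rewrite -mulr_sumr exchange_big /=; congr (_ * _); apply: eq_bigr => h _.
rewrite -natr_sum; congr (_%:R); rewrite -sum1_card.
rewrite big_mkcond [RHS]big_mkcond /= [RHS](reindex_inj (conjg_inj h)) /=.
by apply: eq_bigr => x _; rewrite inE memJ_conjg; case: (x \in A); case: (_ \in Y).
Qed.

Lemma random_conjugate_total : \sum_(x in G) phi x = 1.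
Proof.
rewrite random_conjugate_set.
have -> : \sum_(h in G) #|(G :^ h :&: Y)%g|%:R = \sum_(h in G) #|Y|%:R :> R.
  by apply: eq_bigr => h Gh; rewrite conjGid // (setIidPr YG).
rewrite sumr_const -[#|Y|%:R *+ _]mulr_natl mulVf // mulf_neq0 // pnatr_eq0 -lt0n //.
Qed.

Lemma random_conjugate_normal (N : {group gT}) : (N <| G)%g ->
  \sum_(x in N) phi x = #|Y :&: N|%:R / #|Y|%:R.
Proof.
move=> /andP[NG nN]; rewrite random_conjugate_set.
have -> : \sum_(h in G) #|(N :^ h :&: Y)%g|%:R = \sum_(h in G) #|Y :&: N|%:R :> R.
  by apply: eq_bigr => h Gh; rewrite (normsP nN) // setIC.
rewrite sumr_const -[#|_ :&: _|%:R *+ _]mulr_natl; field.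
by rewrite !pnatr_eq0 -!lt0n Y0 cardG_gt0.
Qed.

End RandomConjugate.

(** [central_bound] is tested on the indicators of [D] and [D ^+ 5]. Translating [D] by a point of
    [D ^+ 4] stays in [D ^+ 5], so the form is at least [#|D|] times the mass of [D ^+ 4], and the
    main term is at most half of this because [D] is small. Fullness of [X] bounds the mass of
    [N]. *)
Lemma uniform_conjugates_bound (R : rcfType) (gT : finGroupType) (G : {group gT}) (Delta rho : R)
    (I K KX t : nat) (D X : {set gT}) :
  min_degree G Delta -> 1 < Delta -> G :!=: 1%g ->
  0 <= rho -> #|G|%:R * (320 * 9 ^ I)%N%:R ^+ I < (Delta * rho ^+ (4 * 3 ^ I)) ^+ I ->
  approx K 9 D -> D \subset G -> approx KX 9 X -> X \subset G -> full G X ->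
  {in G, forall g, (#|X| <= t * #|(D ^+ 4 :&: (X :^ g) ^+ 4)%g|)%N} ->
  (2 * K * t * KX * #|D| <= #|G|)%N ->
  exists2 N : {group gT}, maxnormal N G G &
    1 <= (4 * K * (t * KX) ^ 2)%N%:R * (rho + KX%:R * #|N|%:R / #|G|%:R) :> R.
Proof.
move=> minD D1 G1 rho0 big aD DG aX XG fX Xt small.
have [oneD sD _] := aD; have [oneX sX _] := aX.
pose Y := (X ^+ 4)%g.
have YG : Y \subset G by apply: expg_subG.
have oneY : 1%g \in Y by apply: expg_mem1.
have Y0 : (0 < #|Y|)%N by rewrite (cardD1 1%g) oneY.
have sY : (Y^-1)%g = Y by apply: expg_inv.
have D0 : (0 < #|D|)%N by rewrite (cardD1 1%g) oneD.
have X0 : (0 < #|X|)%N by rewrite (cardD1 1%g) oneX.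
pose phi := random_conjugate R G Y.
have [N mN hN] := central_bound minD D1 (random_conjugate_ge0 R G Y) (random_conjugateJ R Y)
  (random_conjugateV R G sY) (random_conjugate_total R YG Y0) G1 rho0 big.
exists N => //; rewrite -/phi in hN.
have nN := maxnormal_normal mN.
pose n : R := #|G|%:R; pose d : R := #|D|%:R; pose y : R := #|Y|%:R; pose x : R := #|X|%:R.
have n0 : 0 < n by rewrite ltr0n cardG_gt0.
have d0 : 0 < d by rewrite ltr0n.
have y0 : 0 < y by rewrite ltr0n.
have x0 : 0 < x by rewrite ltr0n.
have YX : y <= KX%:R * x by rewrite -natrM ler_nat (approx_le aX).
have t0 : (0 < t)%N.
  by rewrite lt0n; apply: contraTneq (Xt 1%g (group1 G)) => ->; rewrite mul0n -ltnNge.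
have KX0 : (0 < KX)%N.
  rewrite lt0n; apply: contraTneq YX => ->; rewrite mul0r -ltNge //.
pose al : R := (t * KX)%N%:R^-1.
have al0 : 0 < al by rewrite invr_gt0 ltr0n muln_gt0 t0.
(* Every conjugate of [Y] has at least [#|X| / t] points in [D ^+ 4], out of [#|Y| <= KX * #|X|]. *)
have phiD : al <= \sum_(z in (D ^+ 4)%g) phi z.
  rewrite random_conjugate_set.
  apply: le_trans (_ : (n * y)^-1 * (n * (x / t%:R)) <= _).
    rewrite /al natrM (_ : (n * y)^-1 * (n * (x / t%:R)) = x / (t%:R * y)); last first.
      by field; rewrite !lt0r_neq0 ?ltr0n.
    rewrite -div1r ler_pdivrMr ?mulr_gt0 ?ltr0n // mulrAC ler_pdivlMr ?mulr_gt0 ?ltr0n // mul1r.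
    have -> : x * (t%:R * KX%:R) = t%:R * (KX%:R * x) by ring.
    by rewrite ler_wpM2l.
  have -> : n * (x / t%:R) = \sum_(h in G) x / t%:R by rewrite sumr_const mulr_natl.
  rewrite ler_wpM2l ?invr_ge0 ?mulr_ge0 ?ler0n //.
  apply: ler_sum => h Gh; rewrite ler_pdivrMr ?ltr0n // mulrC -natrM ler_nat.
  apply: leq_trans (Xt h^-1%g (groupVr Gh)) _; rewrite leq_mul2l; apply/orP; right.
  by rewrite -(cardJg _ h) conjIg -!conjsXg -conjsgM mulVg conjsg1.
(* [#|Y :&: N| * #|G / N| <= #|X ^+ 5| <= KX * #|X|], and [#|X| <= #|Y|]. *)
have phiN : \sum_(z in N) phi z <= KX%:R * #|N|%:R / n.
  rewrite random_conjugate_normal // -/y ler_pdivrMr // mulrAC ler_pdivlMr //.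
  have := card_expg_cap_quotient 4 mN XG fX.
  rewrite card_quotient ?normal_norm // -(leq_pmul2l (cardG_gt0 N)) mulnCA Lagrange ?normal_sub //.
  move=> h; rewrite -!natrM ler_nat; apply: leq_trans h _;
    rewrite [leqRHS]mulnAC [leqRHS]mulnC leq_mul2l.
  rewrite (leq_trans (approx_le aX (_ : 5 <= 9)%N)) ?orbT // leq_mul2l.
  by rewrite subset_leq_card ?orbT // -{1}[X]expg1 expg_leS.
pose f (z : gT) : R := (z \in D)%:R; pose h (z : gT) : R := (z \in D ^+ 5)%g%:R.
have ind (A : {set gT}) : A \subset G -> \sum_(z in G) (z \in A)%:R = #|A|%:R :> R.
  move=> AG; rewrite -natr_sum -sum1_card big_mkcond [in RHS]big_mkcond /=; congr (_%:R).
  apply: eq_bigr => z _; case: (boolP (z \in A)) => [Az|_]; last by case: ifP.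
  by rewrite (subsetP AG).
have ind2 (A : {set gT}) : A \subset G -> \sum_(z in G) ((z \in A)%:R : R) ^+ 2 = #|A|%:R.
  by move=> AG; rewrite -ind //; apply: eq_bigr => z _; case: (z \in A); rewrite ?expr1n ?expr0n.
have D5G : (D ^+ 5)%g \subset G by apply: expg_subG.
have := hN f h; rewrite !ind // !ind2 //.
set S := \sum_(z in G) h z * _.
have SD : al * d <= S.
  apply: le_trans (ler_wpM2r (ltW d0) phiD) _.
  rewrite /S /conv; under [leRHS]eq_bigr do rewrite mulr_sumr.
  rewrite exchange_big /= mulr_suml.
  apply: le_trans (_ : \sum_(z in G | z \in (D ^+ 4)%g) phi z * d <= _).
    apply: le_of_eq; apply: eq_bigl => z.
    by case: (boolP (z \in _)) => [Dz|_]; rewrite ?andbF // andbT (subsetP (expg_subG 4 DG)).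
  rewrite [leRHS](bigID [in (D ^+ 4)%g]) /= ler_wpDr //.
    apply: sumr_ge0 => z _; apply: sumr_ge0 => w _.
    exact: mulr_ge0 (ler0n _ _) (mulr_ge0 (random_conjugate_ge0 _ _ _ _) (ler0n _ _)).
  apply: ler_sum => z /andP[Gz Dz].
  rewrite -[leRHS](sum_mulgl _ Gz) /d -(ind D DG) mulr_sumr; apply: ler_sum => w _.
  rewrite mulKg mulrCA -/(f w) ler_wpM2l ?random_conjugate_ge0 //.
  rewrite /f /h; case Dw: (w \in D); last by rewrite mulr0.
  by rewrite expgSr mem_mulg // mulr1.
have D5 : #|(D ^+ 5)%g|%:R <= K%:R * d by rewrite -natrM ler_nat (approx_le aD).
set d5 : R := #|(D ^+ 5)%g|%:R in D5 *.
have d50 : 0 <= d5 by apply: ler0n.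
have half : n^-1 * d * d5 <= al * d / 2.
  have : 2 * K%:R * d <= al * n.
    rewrite /al [leRHS]mulrC ler_pdivlMr ?ltr0n ?muln_gt0 ?t0 //.
    by rewrite -!natrM ler_nat; apply: leq_trans small; apply: eq_leq; ring.
  move=> h1; rewrite -(ler_pM2l n0) -(ler_pM2l (ltr0n R 2)).
  have -> : 2 * (n * (n^-1 * d * d5)) = d * (2 * d5) by field; rewrite lt0r_neq0.
  have -> : 2 * (n * (al * d / 2)) = d * (al * n) by field.
  rewrite ler_pM2l //; apply: le_trans h1; rewrite -mulrA ler_pM2l //.
move=> sq.
have low : (al * d / 2) ^+ 2 <= (S - n^-1 * d * d5) ^+ 2.
  have ad : 0 <= al * d / 2 by rewrite ltW // divr_gt0 // mulr_gt0.
  rewrite lerXn2r ?nnegrE //; lra.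
have s0 : 0 <= rho + KX%:R * #|N|%:R / n by rewrite addr_ge0 // divr_ge0 ?mulr_ge0 ?(ltW n0).
have := le_trans low sq => {low sq} sq.
have {}sq : (al * d / 2) ^+ 2 <= (rho + KX%:R * #|N|%:R / n) * d * (K%:R * d).
  apply: le_trans sq _; apply: ler_pM => //.
    by rewrite mulr_ge0 ?(ltW d0) // addr_ge0 // sumr_ge0 // => z _; apply: random_conjugate_ge0.
  by rewrite ler_wpM2r ?(ltW d0) // lerD2l.
have d2 : 0 < d ^+ 2 by rewrite exprn_gt0.
have al2 : 0 < al ^+ 2 by rewrite exprn_gt0.
rewrite -(ler_pM2l d2) -(ler_pM2l al2) mulr1.
have alE : al ^+ 2 * (4 * K * (t * KX) ^ 2)%N%:R = 4 * K%:R :> R.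
  rewrite /al !natrM; field.
  by rewrite !pnatr_eq0 -!lt0n t0 KX0.
set u := rho + _ in sq s0 *.
have -> : al ^+ 2 * (d ^+ 2 * ((4 * K * (t * KX) ^ 2)%N%:R * u)) =
  (al ^+ 2 * (4 * K * (t * KX) ^ 2)%N%:R) * (d ^+ 2 * u) by ring.
rewrite alE; move: sq; rewrite !exprMn; lra.
Qed.

(** * From slow walks to approximate groups *)

Section SymmetricWalk.
Variables (R : rcfType) (gT : finGroupType) (G : {group gT}).
Implicit Types u v f : gT -> R.

Definition nrm u : R := \sum_(x in G) u x ^+ 2.
Definition dot u v : R := \sum_(x in G) u x * v x.

Lemma nrm_ge0 u : 0 <= nrm u.
Proof. by apply: sumr_ge0 => x _; apply: sqr_ge0. Qed.

Lemma dot_cauchy u v : dot u v ^+ 2 <= nrm u * nrm v.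
Proof. exact: real_cauchy_schwarz. Qed.

Section Operator.
Variable w : gT -> R.
Hypothesis w_ge0 : forall x, 0 <= w x.
Hypothesis wV : {in G, revf w =1 w}.
Hypothesis w1 : \sum_(x in G) w x = 1.
Local Notation T := (conv G w).

Lemma conv_selfadjoint u v : dot (T u) v = dot u (T v).
Proof.
rewrite /dot /conv; under eq_bigr do rewrite mulr_suml.
under [RHS]eq_bigr do rewrite mulr_sumr.
rewrite exchange_big [RHS]exchange_big /= -[RHS]sum_invg; apply: eq_bigr => y Gy.
rewrite -[LHS](sum_mulgl _ Gy) /=; apply: eq_bigr => x _.
by rewrite mulKg invgK; have := wV Gy; rewrite /revf => ->; ring.
Qed.

Lemma conv_contraction u : nrm (T u) <= nrm u.
Proof.
apply: le_trans (_ : \sum_(x in G) \sum_(y in G) w y * u (y^-1 * x)%g ^+ 2 <= _).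
  apply: ler_sum => x _.
  have := weighted_cauchy_schwarz (fun y => u (y^-1 * x)%g) (fun y (_ : y \in G) => w_ge0 y).
  by rewrite w1 mul1r.
rewrite exchange_big /= -[leRHS]mul1r -w1 mulr_suml; apply: ler_sum => y Gy.
by rewrite -mulr_sumr (sum_mulgl (fun x => u x ^+ 2)) ?groupV.
Qed.

Fixpoint steps j u : gT -> R := if j is i.+1 then T (steps i u) else u.

(** By self-adjointness the middle norm is the inner product of [steps j u] and [steps j.+2 u]. Thus
    the ratios of consecutive norms are nondecreasing. *)
Lemma nrm_steps_convex j u : nrm (steps j.+1 u) ^+ 2 <= nrm (steps j u) * nrm (steps j.+2 u).
Proof.
apply: le_trans (dot_cauchy _ _); apply: le_of_eq.
congr (_ ^+ 2); rewrite -[RHS]conv_selfadjoint.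
by apply: eq_bigr => x _; rewrite expr2.
Qed.

Lemma nrm_steps_ratio c u i k : 0 <= c -> c * nrm (steps i u) <= nrm (steps i.+1 u) ->
  c * nrm (steps (i + k) u) <= nrm (steps (i + k).+1 u).
Proof.
move=> c0 h; elim: k => [|k IH]; first by rewrite addn0.
rewrite addnS; set a := nrm (steps (i + k) u) in IH; set b := nrm (steps (i + k).+1 u) in IH *.
have hc := nrm_steps_convex (i + k) u; rewrite -/a -/b in hc.
have a0 : 0 <= a by apply: nrm_ge0. have b0 : 0 <= b by apply: nrm_ge0.
have [bz|bn] := eqVneq b 0; first by rewrite bz mulr0 nrm_ge0.
have {}bn : 0 < b by rewrite lt0r bn.
have an : 0 < a.
  rewrite lt0r a0 andbT; apply/eqP => az; move: hc; rewrite az mul0r => hb.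
  by have := lt_le_trans (exprn_gt0 2 bn) hb; rewrite ltxx.
set d := nrm _ in hc *.
rewrite -(ler_pM2l an); apply: le_trans hc.
by rewrite mulrCA mulrA expr2 ler_pM2r.
Qed.

Lemma nrm_steps_lower c u i k : 0 <= c -> c * nrm (steps i u) <= nrm (steps i.+1 u) ->
  c ^+ k * nrm (steps i u) <= nrm (steps (i + k) u).
Proof.
move=> c0 h; elim: k => [|k IH]; first by rewrite expr0 mul1r addn0.
rewrite exprS -mulrA addnS; apply: le_trans (ler_wpM2l c0 IH) _.
exact: nrm_steps_ratio.
Qed.

Lemma nrm_steps_mono u i j : (i <= j)%N -> nrm (steps j u) <= nrm (steps i u).
Proof.
move/subnKC => <-; elim: (j - i)%N => [|k IH]; first by rewrite addn0.
by rewrite addnS; apply: le_trans IH; apply: conv_contraction.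
Qed.

(* Contrapositive of [nrm_steps_ratio]: a small ratio at the end forces small ratios before. *)
Lemma nrm_steps_drop c u i k : 0 <= c ->
  nrm (steps (i + k).+1 u) < c * nrm (steps (i + k) u) ->
  nrm (steps (i + k) u) <= c ^+ k * nrm (steps i u).
Proof.
move=> c0; elim: k => [|k IH]; first by rewrite expr0 mul1r addn0.
rewrite addnS => h.
have h' : nrm (steps (i + k).+1 u) < c * nrm (steps (i + k) u).
  rewrite ltNge; apply/negP => h2; have := nrm_steps_ratio 1 c0 h2.
  by rewrite addn1 leNgt h.
apply: le_trans (ltW h') _; rewrite exprS -mulrA ler_wpM2l //; exact: IH.
Qed.

Definition walk_law j := steps j (@delta1 R gT).

Lemma steps_conv j u x : steps j u x = conv G (walk_law j) u x.
Proof.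
elim: j x => [|j IH] x; first by rewrite /walk_law /= conv_delta1.
by rewrite /walk_law /= -convA; apply: eq_conv.
Qed.

Lemma walk_lawD i j x : walk_law (i + j) x = conv G (walk_law i) (walk_law j) x.
Proof.
by rewrite -steps_conv /walk_law; elim: i x => //= i IH x; apply: eq_conv.
Qed.

Lemma walk_law_rev j : {in G, revf (walk_law j) =1 walk_law j}.
Proof.
elim: j => [|j IH] x Gx.
  by rewrite /revf /walk_law /= /delta1 -[1%g in LHS]invg1 (inj_eq invg_inj).
rewrite [LHS](conv_rev _ _ Gx) (eq_conv_in IH wV) // -addn1 walk_lawD.
by apply: eq_conv_in => // z Gz; rewrite /walk_law /= conv_delta1r.
Qed.

Lemma walk_law_ge0 j x : 0 <= walk_law j x.
Proof.
elim: j x => [|j IH] x; first exact: ler0n.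
exact: conv_ge0.
Qed.

Lemma sum_walk_law j : \sum_(x in G) walk_law j x = 1.
Proof.
elim: j => [|j IH].
  by rewrite (bigD1 1%g) ?group1 //= /walk_law /= /delta1 eqxx big1 ?addr0 // => x /andP[_
    /negPf ->].
rewrite /walk_law /= /conv exchange_big /= -w1; apply: eq_bigr => y Gy.
by rewrite -mulr_sumr (sum_mulgl (walk_law j)) ?groupV // IH mulr1.
Qed.

Lemma walk_law_le j x : x \in G -> walk_law j.*2 x <= nrm (walk_law j).
Proof.
move=> Gx; rewrite /nrm -conv_rev_1 -addnn walk_lawD.
have -> : conv G (walk_law j) (walk_law j) x = conv G (walk_law j) (revf (walk_law j)) x.
  by apply: eq_conv_in => // z Gz; rewrite walk_law_rev.
exact: conv_rev_le.
Qed.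

Lemma nrm_walk_law_ge j : 1 <= #|G|%:R * nrm (walk_law j).
Proof.
have := dot_cauchy (fun=> 1) (walk_law j).
rewrite /dot /nrm; under eq_bigr do rewrite mul1r.
by rewrite sum_walk_law expr1n sumr_const.
Qed.

Variable Delta : R.
Hypothesis minD : min_degree G Delta.
Hypothesis Delta0 : 0 <= Delta.

(* Right translates of [f] behave like [f], so the mean zero function [f] contributes to
   [walk_law j] with multiplicity at least [Delta]. *)
Lemma walk_law_multiplicity f j : (forall x, x \notin G -> f x = 0) ->
  \sum_(x in G) f x = 0 ->
  Delta * nrm (steps j f) <= #|G|%:R * nrm f * nrm (walk_law j).
Proof.
move=> fG f0; pose fc x : R[i]%C := (f x)%:C%C.
pose p x : R[i]%C := (if x \in G then walk_law j x else 0)%:C%C.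
have f0' w0 : \sum_(x in G) fc (w0 * x^-1)%g = 0.
  have [Gw|nGw] := boolP (w0 \in G); last first.
    by apply: big1 => x Gx; rewrite /fc fG // groupMr ?groupV.
  rewrite -sum_invg; under eq_bigr do rewrite invgK.
  by rewrite (sum_mulgl fc) // -sum_real_complex f0.
have act1 w0 : (w0 * 1^-1)%g = w0 :> gT by rewrite invg1 mulg1.
have actM : {in G &, forall x y, forall w0, (w0 * (x * y)^-1)%g = (w0 * y^-1 * x^-1)%g}.
  by move=> x y _ _ w0; rewrite invMg mulgA.
have := @mixing _ _ G _ minD _ (fun x w0 => w0 * x^-1)%g act1 actM fc f0' p Delta0.
have -> : \sum_w0 sqn (fc w0) = nrm f.
  rewrite /nrm [RHS]big_mkcond; apply: eq_bigr => x _; rewrite sqnR.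
  by case: ifP => // /negbT /fG ->; rewrite expr0n.
have -> : \sum_w0 sqn (p w0) = nrm (walk_law j).
  rewrite /nrm [RHS]big_mkcond; apply: eq_bigr => x _; rewrite sqnR.
  by case: ifP => //; rewrite expr0n.
suff -> : \sum_(x in G) sqn (\sum_w0 fc (w0 * x^-1)%g * (p w0)^*) = nrm (steps j f) by [].
rewrite -sum_invg; apply: eq_bigr => x Gx; rewrite invgK.
have -> : \sum_w0 fc (w0 * x)%g * (p w0)^* = (steps j f x)%:C%C; last exact: sqnR.
rewrite steps_conv /conv -sum_invg sum_real_complex [RHS]big_mkcond; apply: eq_bigr => y _.
rewrite /p conj_real_complex invgK; case: ifP => Gy; last by rewrite rmorph0 mulr0.
by have := walk_law_rev j Gy; rewrite /revf => ->; rewrite rmorphM mulrC.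
Qed.

End Operator.

Section Lazy.
Variable S : {set gT}.
Hypothesis SG : S \subset G.
Hypothesis S0 : (0 < #|S|)%N.
Local Notation m := (#|S|%:R : R).

Definition step_law (x : gT) : R := (2 * m)^-1 * \sum_(s in S) ((x == s)%:R + (x == s^-1)%g%:R).
Definition lazy_law (x : gT) : R := (delta1 R x + step_law x) / 2.

Definition edge_energy u := \sum_(s in S) \sum_(x in G) (u (s * x)%g - u x) ^+ 2.

Let m0 : 0 < m. Proof. by rewrite ltr0n. Qed.

Lemma step_law_ge0 x : 0 <= step_law x.
Proof. by rewrite mulr_ge0 ?invr_ge0 ?mulr_ge0 ?sumr_ge0 // => s _; rewrite addr_ge0. Qed.

Lemma step_law_rev : {in G, revf step_law =1 step_law}.
Proof.
move=> x _; rewrite /revf /step_law; congr (_ * _); apply: eq_bigr => s _.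
have -> : (x^-1 == s)%g = (x == s^-1)%g by rewrite -(inj_eq invg_inj) invgK.
by rewrite (inj_eq invg_inj) addrC.
Qed.

Lemma conv_step_law u x : x \in G ->
  conv G step_law u x = (2 * m)^-1 * \sum_(s in S) (u (s^-1 * x)%g + u (s * x)%g).
Proof.
move=> Gx; rewrite /conv /step_law; under eq_bigr do rewrite -mulrA mulr_suml.
rewrite -mulr_sumr exchange_big /=; congr (_ * _); apply: eq_bigr => s Ss.
have Gs := subsetP SG s Ss.
have pick z : z \in G -> \sum_(y in G) (y == z)%:R * u (y^-1 * x)%g = u (z^-1 * x)%g.
  move=> Gz; rewrite (bigD1 z) //= eqxx mul1r big1 ?addr0 // => y /andP[_ /negPf ->].
  by rewrite mul0r.
under eq_bigr do rewrite mulrDl.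
by rewrite big_split /= !pick ?groupV // invgK.
Qed.

Lemma sum_step_law : \sum_(x in G) step_law x = 1.
Proof.
have := conv_step_law (fun=> 1) (group1 G); rewrite /conv.
under eq_bigr do rewrite mulr1; move=> ->.
rewrite sumr_const -mulr_natr; field; by rewrite lt0r_neq0.
Qed.

Lemma lazy_law_ge0 x : 0 <= lazy_law x.
Proof. by rewrite divr_ge0 // addr_ge0 ?step_law_ge0 // ler0n. Qed.

Lemma lazy_law_rev : {in G, revf lazy_law =1 lazy_law}.
Proof.
move=> x Gx; rewrite /revf /lazy_law; have := step_law_rev Gx; rewrite /revf => ->.
by rewrite /delta1 -[1%g in LHS]invg1 (inj_eq invg_inj).
Qed.

Lemma sum_lazy_law : \sum_(x in G) lazy_law x = 1.
Proof.
rewrite -mulr_suml big_split /= sum_step_law (bigD1 1%g) ?group1 //= /delta1 eqxx big1.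
  by rewrite /= addr0; field.
by move=> x /andP[_ /negPf ->].
Qed.

Lemma conv_lazy_law u x : conv G lazy_law u x = (u x + conv G step_law u x) / 2.
Proof.
rewrite -[u x in RHS](conv_delta1 G) /conv -big_split mulr_suml /=; apply: eq_bigr => y _.
by rewrite /lazy_law; field.
Qed.

Lemma dot_step_law u : dot (conv G step_law u) u = nrm u - (2 * m)^-1 * edge_energy u.
Proof.
have E s : s \in S -> \sum_(x in G) (u (s * x)%g - u x) ^+ 2 =
    2 * nrm u - \sum_(x in G) (u (s^-1 * x)%g + u (s * x)%g) * u x.
  move=> Ss; have Gs := subsetP SG s Ss.
  have e1 : \sum_(x in G) u (s^-1 * x)%g * u x = \sum_(x in G) u (s * x)%g * u x.
    rewrite -(sum_mulgl _ Gs) /=; apply: eq_bigr => x _; by rewrite mulKg mulrC.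
  have e2 : \sum_(x in G) u (s * x)%g ^+ 2 = nrm u by apply: (sum_mulgl (fun x => u x ^+ 2)).
  under [X in _ - X]eq_bigr do rewrite mulrDl.
  rewrite [X in _ - X]big_split /= e1.
  have -> : \sum_(x in G) (u (s * x)%g - u x) ^+ 2 = \sum_(x in G) (u (s * x)%g ^+ 2 +
     u x ^+ 2 - 2 * (u (s * x)%g * u x)) by apply: eq_bigr => x _; ring.
  by rewrite sumrB big_split /= e2 -mulr_sumr -/(nrm u); ring.
rewrite /edge_energy (eq_bigr _ E) sumrB sumr_const -[_ *+ #|S|]mulr_natr.
rewrite /dot; under eq_bigr => x Gx do rewrite conv_step_law // -mulrA mulr_suml.
rewrite -mulr_sumr exchange_big /=; field; by rewrite lt0r_neq0.
Qed.

Lemma dot_lazy_law u : dot (conv G lazy_law u) u = nrm u - (4 * m)^-1 * edge_energy u.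
Proof.
have -> : dot (conv G lazy_law u) u = (nrm u + dot (conv G step_law u) u) / 2.
  rewrite /dot /nrm -big_split mulr_suml; apply: eq_bigr => x _ /=.
  by rewrite conv_lazy_law; field.
by rewrite dot_step_law; field; rewrite lt0r_neq0.
Qed.

(** With [T = (1 + P) / 2] and [P] a contraction, the squared norm of [T u] is at most the form of
    [T] at [u]. Laziness is what excludes eigenvalues near -1. *)
Lemma nrm_lazy_law_le u : nrm (conv G lazy_law u) <= nrm u - (4 * m)^-1 * edge_energy u.
Proof.
rewrite -dot_lazy_law.
have -> : dot (conv G lazy_law u) u = (nrm u + dot (conv G step_law u) u) / 2.
  rewrite /dot /nrm -big_split mulr_suml; apply: eq_bigr => x _ /=.
  by rewrite conv_lazy_law; field.
have -> : nrm (conv G lazy_law u) =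
    (nrm u + 2 * dot (conv G step_law u) u + nrm (conv G step_law u)) / 4.
  rewrite /dot /nrm mulr_sumr -!big_split mulr_suml; apply: eq_bigr => x _ /=.
  by rewrite conv_lazy_law; field.
have := conv_contraction step_law_ge0 sum_step_law u; lra.
Qed.

End Lazy.
End SymmetricWalk.

(** [f] decays at rate at most [kappa], and its multiplicity keeps [b j] above about [Delta / #|G|]
    until time [2 ^ M * J], with [J] about [log nu / kappa']. One of the [M] doublings of [J] loses
    at most a factor [nu], since [#|G| <= nu ^ M]. At that scale the law is flat up to [nu], and by
    log-convexity one more step loses at most a proportion [kappa']. *)
Lemma flat_scale (R : rcfType) (gT : finGroupType) (G : {group gT}) (S : {set gT})
    (Delta kappa kappa' nu : R) (M : nat) (f : gT -> R) :
  min_degree G Delta -> 0 <= Delta -> S \subset G -> (0 < #|S|)%N ->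
  (forall x, x \notin G -> f x = 0) -> \sum_(x in G) f x = 0 -> 0 < nrm G f ->
  edge_energy G S f <= 2 * #|S|%:R * kappa * nrm G f ->
  0 <= kappa -> (2 ^ M)%N%:R * kappa <= kappa' -> 0 < kappa' <= 2^-1 ->
  1 < nu -> (0 < M)%N -> #|G|%:R <= nu ^+ M -> (exists J, (1 - kappa') ^+ J < nu^-1) ->
  exists u B, [/\ [/\ forall x, 0 <= u x, \sum_(x in G) u x = 1 & forall x, x \in G -> u x <= B],
    B <= nu * nrm G u, edge_energy G S u <= 4 * #|S|%:R * kappa' * nrm G u,
    Delta <= 2 * nu * #|G|%:R * nrm G u & 0 < nrm G u].
Proof.
move=> minD D0 SG S0 fG f0 nf Ef k0 kM /andP[k'0 k'h] nu1 M0 nM exJ.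
have m0 : 0 < #|S|%:R :> R by rewrite ltr0n.
have n0 : 0 < #|G|%:R :> R by rewrite ltr0n cardG_gt0.
have nu0 : 0 < nu by apply: lt_trans nu1.
have kk : kappa <= kappa'.
  apply: le_trans kM; rewrite ler_peMl // ler1n expn_gt0 //.
pose w := lazy_law R S.
have w0 := lazy_law_ge0 R S : forall x, 0 <= w x.
have wV := @lazy_law_rev R gT G S : {in G, revf w =1 w}.
have w1 := sum_lazy_law R SG S0 : \sum_(x in G) w x = 1.
pose b j := nrm G (walk_law G w j).
have fstep : (1 - kappa) * nrm G (steps G w 0 f) <= nrm G (steps G w 1 f).
  have e1 := dot_lazy_law SG S0 f; have c1 := dot_cauchy G (conv G w f) f.
  have d1 : (1 - kappa / 2) * nrm G f <= dot G (conv G w f) f.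
    rewrite e1 mulrBl mul1r lerD2l lerN2.
    apply: le_trans (ler_wpM2l _ Ef) _; first by rewrite invr_ge0 mulr_ge0 // ltW.
    by apply: le_of_eq; field; rewrite lt0r_neq0.
  rewrite /= -(ler_pM2r nf); apply: le_trans c1.
  have d0 : 0 <= (1 - kappa / 2) * nrm G f by rewrite mulr_ge0 ?(ltW nf) //; lra.
  apply: le_trans (_ : ((1 - kappa / 2) * nrm G f) ^+ 2 <= _); last first.
    by rewrite lerXn2r ?nnegrE // (le_trans d0).
  rewrite exprMn -mulrA -expr2 ler_wpM2r ?sqr_ge0 //.
  have := sqr_ge0 kappa; rewrite -subr_ge0.
  have -> : (1 - kappa / 2) ^+ 2 - (1 - kappa) = kappa ^+ 2 / 4 by field.
  by lra.
have k1 : 0 <= 1 - kappa by lra.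
have blow j : Delta * (1 - kappa) ^+ j <= #|G|%:R * b j.
  have h1 := nrm_steps_lower wV j k1 fstep.
  have h2 := walk_law_multiplicity wV minD D0 j fG f0.
  rewrite -(ler_pM2r nf) -mulrA; apply: le_trans (ler_wpM2l D0 h1) _.
  by apply: le_trans h2 _; rewrite mulrAC.
have bpos j : 0 < b j.
  have := nrm_walk_law_ge w1 j; rewrite -/(b j) => h.
  by rewrite -(pmulr_rgt0 _ n0); apply: lt_le_trans h.
have bmono i j : (i <= j)%N -> b j <= b i by apply: nrm_steps_mono.
have b01 : b 0 = 1.
  rewrite /b /nrm /walk_law /= (bigD1 1%g) ?group1 //= /delta1 eqxx big1 ?addr0 ?expr1n //.
  by move=> x /andP[_ /negPf ->]; rewrite expr0n.
(* Minimality of [J] supplies the matching lower bound [Jpred]. *)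
case: (ex_minnP exJ) => J JP Jmin.
have J0 : (0 < J)%N.
  rewrite lt0n; apply/eqP => J00; move: JP; rewrite J00 expr0.
  by rewrite ltNge invf_le1 // ltW.
have Jpred : nu^-1 <= (1 - kappa') ^+ J.-1.
  by rewrite leNgt; apply/negP => /Jmin; rewrite -ltnS prednK // ltnn.
have k'1 : 0 <= 1 - kappa' <= 1 by lra.
have k'1' : 0 <= 1 - kappa' by lra.
(* Otherwise [b] drops by more than [nu] at each of [M] doublings, from at most 1 to below
   [1 / #|G|]. *)
have [i iM hi] : exists2 i, (i < M)%N & b (2 ^ i * J)%N <= nu * b (2 ^ i.+1 * J)%N.
  have [/existsP[i hi]|/existsPn none] :=
    boolP [exists i : 'I_M, b (2 ^ i * J)%N <= nu * b (2 ^ i.+1 * J)%N].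
    by exists i.
  have dec i : (i < M)%N -> nu ^+ i.+1 * b (2 ^ i.+1 * J)%N < 1.
    elim: i => [|i IH] iM; have := none (Ordinal iM); rewrite -ltNge /= => h.
      rewrite expr1; apply: lt_le_trans h _; rewrite -b01; exact: bmono.
    rewrite exprS -mulrA mulrCA; apply: le_lt_trans (IH (ltnW iM)).
    by rewrite ler_wpM2l ?exprn_ge0 ?ltW.
  have := dec M.-1; rewrite prednK // => /(_ (leqnn _)); rewrite ltNge => /negP[].
  apply: le_trans (nrm_walk_law_ge w1 (2 ^ M * J)) _.
  by rewrite ler_wpM2r ?nrm_ge0.
set j := (2 ^ i * J)%N in hi.
have jE : (2 ^ i.+1 * J = j.*2)%N by rewrite expnS -mulnA mul2n.
rewrite jE in hi.
exists (walk_law G w j.*2), (b j); split=> //.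
- split=> [x||x Gx]; [exact: walk_law_ge0 | exact: sum_walk_law | exact: walk_law_le].
(* A larger loss at time [2 j] would force a loss by [(1 - kappa') ^+ j < 1 / nu] between the times
   [j] and [2 j]. *)
- have ratio : (1 - kappa') * b j.*2 <= b j.*2.+1.
    rewrite leNgt; apply/negP => lt.
    have := nrm_steps_drop wV (u := delta1 R (gT:=gT)) (i := j) (k := j) k'1'.
    rewrite addnn => /(_ lt) h.
    have Jj : (J <= j)%N by rewrite /j leq_pmull // expn_gt0.
    have p1 : (1 - kappa') ^+ j <= (1 - kappa') ^+ J by apply: ler_wiXn2l => //; case/andP: k'1.
    have : b j < b j; last by rewrite ltxx.
    apply: le_lt_trans hi _; apply: le_lt_trans (ler_wpM2l (ltW nu0) h) _.
    rewrite mulrA -[ltRHS]mul1r ltr_pM2r ?bpos //.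
    apply: le_lt_trans (ler_wpM2l (ltW nu0) p1) _.
    by rewrite -ltr_pdivlMl // mulr1.
  have := le_trans ratio (nrm_lazy_law_le SG S0 _); rewrite mulrBl mul1r lerD2l lerN2.
  by rewrite mulrC ler_pdivrMr ?mulr_gt0 // => h; apply: le_trans h _; rewrite mulrC mulrA.
apply: le_trans (_ : 2 * nu * (Delta * (1 - kappa) ^+ j.*2) <= _); last first.
  by rewrite -[leRHS]mulrA ler_wpM2l ?blow // mulr_ge0 // ltW.
(* Since [2 j <= 2 ^ M * J], Bernoulli and [2 ^ M * kappa <= kappa'] reduce this to
   [(1 - kappa') ^+ J], which is [(1 - kappa') ^+ J.-1] times a factor at least 1/2. *)
have : nu^-1 / 2 <= (1 - kappa) ^+ j.*2.
  apply: le_trans (_ : (1 - kappa') ^+ J <= _).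
    rewrite -(prednK J0) exprS mulrC; apply: ler_pM; rewrite ?invr_ge0 ?(ltW nu0) //; lra.
  apply: le_trans (_ : ((1 - kappa) ^+ (2 ^ M)) ^+ J <= _).
    rewrite lerXn2r ?nnegrE ?exprn_ge0 //.
    have := @bernoulli R (1 - kappa) (2 ^ M); rewrite k1 /= => /(_ _) h.
    have : 1 - (1 - kappa) ^+ (2 ^ M) <= (2 ^ M)%N%:R * (1 - (1 - kappa)) by apply: h; lra.
    have -> : 1 - (1 - kappa) = kappa by ring.
    lra.
  rewrite -exprM; apply: ler_wiXn2l => //; first by lra.
  by rewrite -jE leq_mul2r leq_pexp2l ?orbT.
move=> h; have := ler_wpM2l (mulr_ge0 (mulr_ge0 (ler0n R 2) (ltW nu0)) D0) h.
have -> : 2 * nu * Delta * (nu^-1 / 2) = Delta by field; rewrite lt0r_neq0.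
  by rewrite mulrA.
exact: bpos j.*2.
Qed.

(** * Regularising a nearly flat function by products of shifts *)

Section Homogenize.
Variables (R : rcfType) (gT : finGroupType) (G : {group gT}) (S : {set gT}) (tau : nat).
Hypothesis SG : S \subset G.
Implicit Types (u : gT -> R) (W : {set gT}).

Definition shifted u (g x : gT) : R := u x * u (x * g)%g.
Definition overlap W (g : gT) : {set gT} := (W :&: W :* g^-1)%g.
Definition sparse W (g : gT) := (tau * #|overlap W g| < #|W|)%N.

(** Up to a proportion [eta] of its mass, [u ^+ 2] lives on [W], where it varies by a factor at most
    [F]; [kappa] measures how far [u] moves under [S]. *)
Record flat_on u W (M : R) (F : nat) (eta kappa : R) : Prop := FlatOn {
  flat_ge0 : forall x, 0 <= u x;
  flat_sub : W \subset G;
  flat_pos : 0 < nrm G u;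
  flat_defect : \sum_(x in G | x \notin W) u x ^+ 2 <= eta * nrm G u;
  flat_max : forall x, x \in G -> u x ^+ 2 <= M;
  flat_min : forall x, x \in W -> M <= F%:R * u x ^+ 2;
  flat_energy : edge_energy G S u <= kappa * nrm G u }.

Lemma sum_sum_shift (V : comPzRingType) (a b : gT -> V) :
  \sum_(g in G) \sum_(x in G) a x * b (x * g)%g = (\sum_(x in G) a x) * \sum_(x in G) b x.
Proof.
rewrite exchange_big mulr_suml /=; apply: eq_bigr => x Gx.
by rewrite -mulr_sumr (sum_mulgl b).
Qed.

Lemma sum_defect_shifted u W eta : nrm G u != 0 ->
  \sum_(x in G | x \notin W) u x ^+ 2 <= eta * nrm G u ->
  \sum_(g in G) \sum_(x in G | x \notin overlap W g) shifted u g x ^+ 2 <= 2 * eta * nrm G u ^+ 2.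
Proof.
move=> Z0 def; pose o x : R := if x \in W then 0 else u x ^+ 2.
have oE : \sum_(x in G) o x = \sum_(x in G | x \notin W) u x ^+ 2.
  by rewrite [RHS]big_mkcondr; apply: eq_bigr => x _; rewrite /o; case: (x \in W).
have o0 x : 0 <= o x by rewrite /o; case: ifP => // _; apply: sqr_ge0.
apply: le_trans (_ : \sum_(g in G) \sum_(x in G) (o x * u (x * g)%g ^+ 2 +
  u x ^+ 2 * o (x * g)%g) <= _).
  apply: ler_sum => g Gg; rewrite big_mkcondr; apply: ler_sum => x Gx.
  have ge : 0 <= o x * u (x * g)%g ^+ 2 + u x ^+ 2 * o (x * g)%g.
    by apply: addr_ge0; apply: mulr_ge0 => //; apply: sqr_ge0.
  rewrite inE mem_rcoset invgK negb_and; case: ifP => // /orP[] nW.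
    by rewrite /shifted exprMn {1}/o (negPf nW) lerDl; apply: mulr_ge0 => //; apply: sqr_ge0.
  by rewrite /shifted exprMn {2}/o (negPf nW) lerDr; apply: mulr_ge0 => //; apply: sqr_ge0.
under eq_bigr do rewrite big_split /=.
rewrite big_split /= (sum_sum_shift o (fun x => u x ^+ 2)) (sum_sum_shift (fun x => u x ^+ 2) o).
rewrite oE -/(nrm G u); have := ler_wpM2r (nrm_ge0 G u) def; lra.
Qed.

Lemma sum_energy_shifted u :
  \sum_(g in G) edge_energy G S (shifted u g) <= 4 * edge_energy G S u * nrm G u.
Proof.
rewrite /edge_energy exchange_big /= -mulrA mulr_suml mulr_sumr; apply: ler_sum => s Ss.
have Gs := subsetP SG s Ss.
pose d x : R := (u (s * x)%g - u x) ^+ 2.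
apply: le_trans (_ : \sum_(g in G) \sum_(x in G)
    (2 * (d x * u (s * (x * g))%g ^+ 2) + 2 * (u x ^+ 2 * d (x * g)%g)) <= _).
  apply: ler_sum => g _; apply: ler_sum => x _; rewrite /shifted /d -!mulgA.
  move: (u (s * x)%g) (u x) (u (s * (x * g))%g) (u (x * g)%g) => a b c e.
  have := sqr_ge0 ((a - b) * c - b * (c - e)); lra.
have -> : \sum_(g in G) \sum_(x in G)
    (2 * (d x * u (s * (x * g))%g ^+ 2) + 2 * (u x ^+ 2 * d (x * g)%g)) =
    2 * (\sum_(g in G) \sum_(x in G) d x * u (s * (x * g))%g ^+ 2) +
    2 * (\sum_(g in G) \sum_(x in G) u x ^+ 2 * d (x * g)%g).
  rewrite !mulr_sumr -big_split; apply: eq_bigr => g _.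
  by rewrite !mulr_sumr -big_split.
rewrite (sum_sum_shift d (fun x => u (s * x)%g ^+ 2)).
rewrite (sum_sum_shift (fun x => u x ^+ 2) d) (sum_mulgl (fun x => u x ^+ 2)) // -/(nrm G u).
apply: le_of_eq; ring.
Qed.

(** Summed over all [g], the defects of the shifts are at most [2 * eta] and the energies at most
    [4 * kappa] times [nrm G u ^+ 2]. If every sparse [g] violated one of the two new bounds, the
    norms of the sparse shifts would add up to at most [4 / 800 + 2 / 400 = 1 / 100] of
    [nrm G u ^+ 2]. *)
Lemma flat_on_step u W M F eta kappa : flat_on u W M F eta kappa -> 0 < eta -> 0 < kappa ->
  nrm G u ^+ 2 / 100 < \sum_(g in G | sparse W g) nrm G (shifted u g) ->
  exists g, sparse W g /\
    flat_on (shifted u g) (overlap W g) (M ^+ 2) (F ^ 2) (400 * eta) (800 * kappa).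
Proof.
case=> u0 WG Z0 def uM Mu en eta0 kap0 big.
pose E g := edge_energy G S (shifted u g).
pose d g := \sum_(x in G | x \notin overlap W g) shifted u g x ^+ 2.
pose nu g := nrm G (shifted u g).
have E0 g : 0 <= E g by apply: sumr_ge0 => s _; apply: sumr_ge0 => x _; apply: sqr_ge0.
have d0 g : 0 <= d g by apply: sumr_ge0 => x _; apply: sqr_ge0.
have nu0 g : 0 <= nu g by apply: nrm_ge0.
have [/existsP[g /and5P[Gg sg nug Eg dg]]|/existsPn none] := boolP [exists g,
    [&& g \in G, sparse W g, 0 < nu g, E g <= 800 * kappa * nu g & d g <= 400 * eta * nu g]].
  exists g; split=> //; split=> //.
  - by move=> x; rewrite mulr_ge0.
  - by apply: subset_trans WG; apply: subsetIl.
  - by move=> x Gx; rewrite exprMn [M ^+ 2]expr2 ler_pM ?sqr_ge0 ?uM // groupM.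
  move=> x; rewrite inE mem_rcoset invgK => /andP[Wx Wxg].
  rewrite exprMn natrX [_%:R ^+ 2]expr2 mulrACA [M ^+ 2]expr2.
  have M0 : 0 <= M by apply: le_trans (uM x (subsetP WG x Wx)); apply: sqr_ge0.
  by apply: ler_pM => //; apply: Mu.
have ine g : g \in G -> sparse W g -> nu g <= E g / (800 * kappa) + d g / (400 * eta).
  move=> Gg sg; have := none g; rewrite Gg sg /=.
  have e1 : 0 <= E g / (800 * kappa) by rewrite divr_ge0 // mulr_ge0 // ltW.
  have e2 : 0 <= d g / (400 * eta) by rewrite divr_ge0 // mulr_ge0 // ltW.
  have [nz _|np] := eqVneq (nu g) 0; first by rewrite nz addr_ge0.
  have -> : 0 < nu g by rewrite lt0r np nu0.
  rewrite /= negb_and -!ltNge => /orP[] h.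
    have : nu g <= E g / (800 * kappa) by rewrite ler_pdivlMr ?mulr_gt0 // mulrC ltW.
    lra.
  have : nu g <= d g / (400 * eta) by rewrite ler_pdivlMr ?mulr_gt0 // mulrC ltW.
  lra.
exfalso; move: big; rewrite ltNge => /negP[].
apply: le_trans (_ : \sum_(g in G) (E g / (800 * kappa) + d g / (400 * eta)) <= _).
  rewrite [leRHS](bigID (sparse W)) /= ler_wpDr //.
    by apply: sumr_ge0 => g _; rewrite addr_ge0 // divr_ge0 // mulr_ge0 // ltW.
  by apply: ler_sum => g /andP[]; apply: ine.
rewrite big_split /= -!mulr_suml.
have h1 := sum_energy_shifted u; have h2 := sum_defect_shifted (lt0r_neq0 Z0) def.
have h3 : \sum_(g in G) E g <= 4 * kappa * nrm G u ^+ 2.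
  apply: le_trans h1 _; have := ler_wpM2r (ltW Z0) en; lra.
have h4 : (\sum_(g in G) E g) / (800 * kappa) <= nrm G u ^+ 2 / 200.
  rewrite ler_pdivrMr ?mulr_gt0 //; lra.
have h5 : (\sum_(g in G) d g) / (400 * eta) <= nrm G u ^+ 2 / 200.
  rewrite ler_pdivrMr ?mulr_gt0 //; apply: le_trans h2 _; lra.
lra.
Qed.

Lemma flat_on_weaken u W M F eta kappa F' eta' kappa' : flat_on u W M F eta kappa ->
  (F <= F')%N -> eta <= eta' -> kappa <= kappa' -> flat_on u W M F' eta' kappa'.
Proof.
case=> u0 WG Z0 def uM Mu en FF ee kk; split=> //.
- by apply: le_trans def _; rewrite ler_wpM2r // ltW.
- by move=> x Wx; apply: le_trans (Mu x Wx) _; rewrite ler_wpM2r ?sqr_ge0 // ler_nat.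
by apply: le_trans en _; rewrite ler_wpM2r // ltW.
Qed.

(** The squared norms of all shifts add up to [nrm G u ^+ 2]; sparse shifts carry at most a
    hundredth. *)
Definition dense u W :=
  \sum_(g in G | sparse W g) nrm G (shifted u g) <= nrm G u ^+ 2 / 100.

(** Each passage to a sparse overlap shrinks [W] by more than [tau], and an empty [W] is excluded by
    a defect below 1; so there are fewer than [r] passages. Each squares [F]. *)
Lemma homogenize r u W M F eta kappa : (#|W| < tau ^ r)%N -> (0 < F)%N ->
  0 < eta -> (400 ^ r)%N%:R * eta < 1 -> 0 < kappa -> flat_on u W M F eta kappa ->
  exists u' W' M', [/\ flat_on u' W' M' (F ^ (2 ^ r)) ((400 ^ r)%N%:R * eta) ((800 ^ r)%N%:R *
    kappa),
    dense u' W' & (#|W'| <= #|W|)%N].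
Proof.
elim: r u W M F eta kappa => [|r IH] u W M F eta kappa Wr F0 eta0 eta1 kap0 flat.
  have [u0 WG Z0 def _ _ _] := flat.
  have W0 : W = set0 by apply: cards0_eq; move: Wr; rewrite expn0 ltnS leqn0 => /eqP.
  move: def; rewrite W0 (eq_bigl [in G]) => [|x]; last by rewrite inE andbT.
  move: eta1; rewrite expn0 mul1r -/(nrm G u) => h h2.
  have lt : eta * nrm G u < nrm G u by rewrite gtr_pMl.
  by have := le_lt_trans h2 lt; rewrite /nrm ltxx.
have [dns|/negbTE/negbT] := boolP (dense u W).
  exists u, W, M; split=> //; apply: flat_on_weaken flat _ _ _.
  - by rewrite -{1}[F]expn1 leq_pexp2l // expn_gt0.
  - by rewrite ler_peMl ?(ltW eta0) // ler1n expn_gt0.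
  - by rewrite ler_peMl ?(ltW kap0) // ler1n expn_gt0.
rewrite /dense -ltNge => big.
have [g [sg flat']] := flat_on_step flat eta0 kap0 big.
have e400 : (400 ^ r)%N%:R * (400 * eta) = (400 ^ r.+1)%N%:R * eta by rewrite expnSr natrM mulrA.
have e800 : (800 ^ r)%N%:R * (800 * kappa) = (800 ^ r.+1)%N%:R * kappa
  by rewrite expnSr natrM mulrA.
have t0 : (0 < tau)%N by move: Wr; case: (tau) => //; rewrite exp0n.
have [] := IH _ _ _ _ _ _ _ _ _ _ _ flat'.
- rewrite -(ltn_pmul2l t0) -expnS; exact: ltn_trans sg Wr.
- by rewrite expn_gt0 F0.
- by rewrite mulr_gt0.
- by rewrite e400.
- by rewrite mulr_gt0.
move=> u' [W' [M' [flat2 dns le]]]; exists u', W', M'; split=> //.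
  by rewrite e400 e800 -expnM -expnS in flat2.
by apply: leq_trans le _; rewrite subset_leq_card // subsetIl.
Qed.

End Homogenize.

(** * The core of a regularised set *)

Section Core.
Variables (R : rcfType) (gT : finGroupType) (G : {group gT}) (S : {set gT}) (tau : nat).
Hypothesis SG : S \subset G.
Variables (u : gT -> R) (W : {set gT}) (M : R) (F : nat) (eta kappa : R).
Hypothesis flat : flat_on G S u W M F eta kappa.
Hypothesis dns : dense G tau u W.
Hypothesis eta1 : eta <= 1 / 10.
Hypothesis kappa1 : kappa <= 1 / 10.

Local Notation Z := (nrm G u).
Implicit Types A B : {set gT}.
Definition mass (A : {set gT}) : R := \sum_(x in A) u x ^+ 2.

Let WG : W \subset G. Proof. by case: flat. Qed.
Let Z0 : 0 < Z. Proof. by case: flat. Qed.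

Lemma mass_le A B : A \subset B -> mass A <= mass B.
Proof.
move=> AB; rewrite /mass [leRHS](big_setID A) /= (setIidPr AB) ler_wpDr //.
by apply: sumr_ge0 => x _; apply: sqr_ge0.
Qed.

Lemma mass_ge0 A : 0 <= mass A.
Proof. by apply: sumr_ge0 => x _; apply: sqr_ge0. Qed.

Lemma massG : mass G = Z. Proof. by []. Qed.

Lemma massD A B : mass A = mass (A :&: B) + mass (A :\: B).
Proof. exact: big_setID. Qed.

Lemma mass_cap A B : A \subset G -> B \subset G -> mass A + mass B - Z <= mass (A :&: B).
Proof.
move=> AG BG; rewrite (massD A B) -massG.
have := massD G B; rewrite (setIidPr BG) => ->.
have : mass (A :\: B) <= mass (G :\: B) by apply: mass_le; apply: setSD.
by have := mass_ge0 B; lra.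
Qed.

Let popular : {set gT} := [set g in G | ~~ sparse tau W g].

Definition popular_mass (x : gT) : R := \sum_(y in G | (x^-1 * y)%g \in popular) u y ^+ 2.
(** As in the Balog-Szemeredi-Gowers argument: the points of [W] from which most of the mass is
    reached by popular quotients. *)
Definition core : {set gT} := [set x in W | 9 / 10 * Z <= popular_mass x].

Let coreW : core \subset W. Proof. by apply/subsetP => x; rewrite inE => /andP[]. Qed.
Let coreG : core \subset G. Proof. exact: subset_trans coreW WG. Qed.

Lemma massW : 9 / 10 * Z <= mass W.
Proof.
have [_ _ _ def _ _ _] := flat.
have := massD G W; rewrite (setIidPr WG) massG.
have -> : mass (G :\: W) = \sum_(x in G | x \notin W) u x ^+ 2.
  by apply: eq_bigl => x; rewrite inE andbC.
have := ler_wpM2r (ltW Z0) eta1; move: def; lra.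
Qed.

(** Markov's inequality: a point of [W] outside the core sends more than [Z / 10] of the mass to
    sparse quotients, whose total is at most [Z ^+ 2 / 100] by [dns]. Such points carry at most
    [Z / 10]. *)
Lemma core_mass : 8 / 10 * Z <= mass core.
Proof.
have key : (mass (W :\: core)) * (Z / 10) <= Z ^+ 2 / 100.
  apply: le_trans dns; rewrite /mass mulr_suml.
  apply: le_trans (_ : \sum_(x in W :\: core) \sum_(y in G | (x^-1 * y)%g \notin popular) u x ^+
    2 * u y ^+ 2 <= _).
    apply: ler_sum => x; rewrite !inE => /andP[nA Wx]; rewrite Wx /= -ltNge in nA.
    rewrite -mulr_sumr ler_wpM2l ?sqr_ge0 //.
    have : Z = popular_mass x + \sum_(y in G | (x^-1 * y)%g \notin popular) u y ^+ 2.
      by rewrite /nrm (bigID (fun y => (x^-1 * y)%g \in popular)).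
    move: nA; lra.
  apply: le_trans (_ : \sum_(x in G) \sum_(y in G | (x^-1 * y)%g \notin popular) u x ^+ 2 * u y
    ^+ 2 <= _).
    have sWG : W :\: core \subset G by apply: subset_trans WG; apply: subsetDl.
    rewrite [leRHS](big_setID (W :\: core)) /= (setIidPr sWG) ler_wpDr //.
    by apply: sumr_ge0 => x _; apply: sumr_ge0 => y _; rewrite mulr_ge0 ?sqr_ge0.
  apply: le_of_eq.
  rewrite [RHS]exchange_big /=; apply: eq_bigr => x Gx.
  rewrite big_mkcondr [RHS]big_mkcondr /= -[LHS](sum_mulgl _ Gx) /=.
  apply: eq_bigr => g Gg; rewrite mulKg inE Gg /= negbK.
  by case: ifP => // _; rewrite /shifted exprMn.
have := massD W core; rewrite (setIidPr coreW).
have : mass (W :\: core) <= Z / 10.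
  have Z10 : 0 < Z / 10 by rewrite divr_gt0.
  by rewrite -(ler_pM2r Z10); apply: le_trans key _; apply: le_of_eq; field.
have := massW; lra.
Qed.

Let M0 : 0 < M.
Proof.
have [_ _ _ _ uM _ _] := flat; rewrite ltNge; apply/negP => M0.
have : Z <= 0 by apply: sumr_le0 => x Gx; apply: le_trans (uM x Gx) M0.
by rewrite leNgt Z0.
Qed.

Lemma mass_card A : A \subset G -> mass A <= #|A|%:R * M.
Proof.
have [_ _ _ _ uM _ _] := flat.
move=> AG; rewrite mulr_natl -sumr_const; apply: ler_sum => x Ax.
by apply: uM; apply: (subsetP AG).
Qed.

Lemma card_mass : #|W|%:R * M <= F%:R * Z.
Proof.
have [_ _ _ _ _ Mu _] := flat.
rewrite mulr_natl -sumr_const; apply: le_trans (_ : \sum_(x in W) F%:R * u x ^+ 2 <= _).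
  by apply: ler_sum => x; apply: Mu.
by rewrite -mulr_sumr ler_wpM2l // -massG; apply: mass_le.
Qed.

(** [M] bounds mass by size, and flatness bounds [#|W| * M] by [F * Z]. *)
Lemma card_ge_mass A k : A \subset G -> k%:R / 10 * Z <= mass A -> (k * #|W| <= 10 * F * #|A|)%N.
Proof.
move=> AG kA; rewrite -(ler_nat R) -(ler_pM2r M0) !natrM.
have := mass_card AG; have := card_mass.
have F0 : 0 <= F%:R :> R by []. have k0 : 0 <= k%:R :> R by [].
move=> h1 h2; have h3 := ler_wpM2l k0 h1; have h4 := ler_wpM2l F0 (le_trans kA h2).
move: h3 h4; set f := F%:R in F0 *; set w := #|W|%:R; set a := #|A|%:R; set k' := k%:R.
rewrite !mulrA; lra.
Qed.

Lemma core_card : (8 * #|W| <= 10 * F * #|core|)%N.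
Proof. by apply: card_ge_mass => //; exact: core_mass. Qed.

Lemma core_gt0 : (0 < #|core|)%N.
Proof.
rewrite lt0n cards_eq0; apply/eqP => c0; have := core_mass; rewrite c0 /mass big_set0.
by have := Z0; lra.
Qed.

Let popular_card : (0 < #|W|)%N -> (#|popular| <= tau * #|W|)%N.
Proof.
move=> W0; rewrite -(leq_pmul2r W0).
apply: leq_trans (_ : \sum_(g in popular) tau * #|overlap W g| <= _)%N.
  rewrite -sum_nat_const; apply: leq_sum => g; rewrite inE => /andP[_].
  by rewrite /sparse -leqNgt.
rewrite -big_distrr /= -mulnA leq_mul2l; apply/orP; right.
apply: leq_trans (_ : \sum_(g in G) \sum_(x in G) (x \in W) * (x * g \in W)%g <= _)%N.
  rewrite [leqRHS](bigID [in popular]) /=; apply: leq_trans (leq_addr _ _).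
  apply: eq_leq; apply: eq_big => [g|g].
    by rewrite inE; case: (g \in G) => //=; rewrite andbb.
  rewrite inE => /andP[Gg _].
  rewrite -sum1_card big_mkcond [RHS]big_mkcond /=; apply: eq_bigr => x _.
  rewrite inE mem_rcoset invgK; case: (boolP (x \in W)) => [Wx|_]; last by rewrite mul0n; case: ifP.
  by rewrite (subsetP WG) //; case: (_ \in W).
rewrite exchange_big /= -sum_nat_const big_mkcond [leqRHS]big_mkcond /=; apply: leq_sum => x _.
case: ifP => Gx; last by case: ifP.
rewrite -big_distrr /= (sum_mulgl (fun y => (y \in W : nat))) //.
case: (x \in W); last by rewrite mul0n.
rewrite mul1n -sum1_card big_mkcond [leqRHS]big_mkcond; apply: leq_sum => y _.
by case: (y \in W); case: (y \in G).
Qed.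

(** For [a], [b] in the core, the [y] in [W] with [a^-1 y] and [b^-1 y] popular carry 7/10 of the
    mass, being common to three sets of mass 9/10; so there are at least [7 * #|W| / (10 * F)] of
    them. Each writes [a^-1 b] as a quotient of two popular elements, of which there are at most
    [tau * #|W|]. *)
Lemma core_quotient_card : (#|core^-1 * core|%g <= 2 * tau ^ 2 * F ^ 2 * #|core|)%N.
Proof.
have c0 := core_gt0.
have W0 : (0 < #|W|)%N by apply: leq_trans c0 _; apply: subset_leq_card.
have B : (#|(core^-1 * core)%g| * (7 * #|W|) <= 10 * F * (#|popular| * #|popular|))%N.
  rewrite -cardsX.
  have fib (q : gT) : q \in (core^-1 * core)%g ->
      (7 * #|W| <= 10 * F * #|[set p in setX popular popular | (p.1 * p.2^-1)%g == q]|)%N.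
    case/mulsgP => a' b; rewrite mem_invg => Aa Ab ->; set a := a'^-1%g in Aa.
    have Ga := subsetP coreG _ Aa; have Gb := subsetP coreG _ Ab.
    pose Pa x := [set y in G | (x^-1 * y)%g \in popular].
    have mP x : x \in core -> 9 / 10 * Z <= mass (Pa x).
      rewrite inE => /andP[_ h]; apply: le_trans h _; apply: le_of_eq.
      by apply: eq_bigl => y; rewrite !inE.
    have PG x : Pa x \subset G by apply/subsetP => y; rewrite inE => /andP[].
    have m7 : 7%:R / 10 * Z <= mass (W :&: (Pa a :&: Pa b)).
      have h1 := mass_cap (PG a) (PG b); have h2 := mP a Aa; have h3 := mP b Ab.
      have h4 := mass_cap WG (subset_trans (subsetIl (Pa a) (Pa b)) (PG a)).
      have := massW; lra.
    apply: leq_trans (card_ge_mass _ m7) _; first by apply: subset_trans WG; apply: subsetIl.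
    rewrite leq_mul2l; apply/orP; right.
    rewrite -(@card_in_imset _ _ (fun y => (a^-1 * y, b^-1 * y)%g)); last first.
      by move=> y z _ _ [] /mulgI.
    apply: subset_leq_card; apply/subsetP => _ /imsetP[y Yy ->].
    move: Yy; rewrite !inE => /and3P[Wy /andP[_ /andP[_ h1]] /andP[_ /andP[_ h2]]].
    have Gy := subsetP WG y Wy.
    apply/andP; split; last by rewrite /= invMg invgK /a invgK mulgA mulgK.
    apply/and3P; split; [apply/andP; split; last exact: h1 | | exact: h2].
      exact: groupM (groupVr Ga) Gy.
    exact: groupM (groupVr Gb) Gy.
  exact: fiber_card_ge fib.
have P := popular_card W0; have C := core_card.
have B2 : (#|(core^-1 * core)%g| * (7 * #|W|) <= 10 * F * (tau * #|W| * (tau * #|W|)))%N.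
  by apply: leq_trans B _; rewrite leq_mul2l leq_mul ?orbT.
have B3 : (7 * #|(core^-1 * core)%g| <= 10 * F * tau ^ 2 * #|W|)%N.
  rewrite -(leq_pmul2r W0).
  have -> : (7 * #|(core^-1 * core)%g| * #|W| = #|(core^-1 * core)%g| * (7 * #|W|))%N by ring.
  by apply: leq_trans B2 _; apply: eq_leq; ring.
have B4 : (56 * #|(core^-1 * core)%g| <= 10 * F * tau ^ 2 * (10 * F * #|core|))%N.
  rewrite (_ : 56 = 8 * 7)%N // -mulnA; apply: leq_trans (leq_mul (leqnn 8) B3) _.
  by rewrite mulnCA leq_mul2l C orbT.
rewrite -(leq_pmul2l (_ : 0 < 56)%N) //; apply: leq_trans B4 _.
have -> : (10 * F * tau ^ 2 * (10 * F * #|core|) = 100 * (tau ^ 2 * F ^ 2 * #|core|))%N by ring.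
have -> : (56 * (2 * tau ^ 2 * F ^ 2 * #|core|) = 112 * (tau ^ 2 * F ^ 2 * #|core|))%N by ring.
by rewrite leq_mul2r orbT.
Qed.

(** Since [u (s x) ^+ 2 >= u x ^+ 2 / 2 - (u (s x) - u x) ^+ 2], small energy gives [s *: core] mass
    at least 4/10 - 1/10; with the 8/10 of the core this forces an overlap of mass 1/10. *)
Lemma core_shift s : s \in S -> (#|core| <= 10 * F * #|core :&: (s *: core)%g|)%N.
Proof.
move=> Ss; have Gs := subsetP SG s Ss.
have [_ _ _ _ _ _ en] := flat.
have Es : \sum_(x in G) (u (s * x)%g - u x) ^+ 2 <= Z / 10.
  apply: le_trans (_ : edge_energy G S u <= _).
    rewrite /edge_energy [leRHS](bigD1 s) //= ler_wpDr // sumr_ge0 // => t _.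
    by apply: sumr_ge0 => x _; apply: sqr_ge0.
  by apply: le_trans en _; have := ler_wpM2r (ltW Z0) kappa1; lra.
have sG : (s *: core)%g \subset G.
  by apply/subsetP => x; rewrite mem_lcoset => /(subsetP coreG); rewrite groupMl ?groupV.
have m3 : 3 / 10 * Z <= mass (s *: core)%g.
  have -> : mass (s *: core)%g = \sum_(x in core) u (s * x)%g ^+ 2.
    rewrite /mass (reindex_inj (mulgI s)) /=; apply: eq_bigl => x.
    by rewrite mem_lcoset mulKg.
  have : \sum_(x in core) (u x ^+ 2 / 2 - (u (s * x)%g - u x) ^+ 2) <=
    \sum_(x in core) u (s * x)%g ^+ 2.
    apply: ler_sum => x _; move: (u x) (u (s * x)%g) => a b.
    have := sqr_ge0 (2 * b - a); lra.
  rewrite sumrB -mulr_suml -/(mass core).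
  have : \sum_(x in core) (u (s * x)%g - u x) ^+ 2 <= \sum_(x in G) (u (s * x)%g - u x) ^+ 2.
    rewrite [leRHS](big_setID core) /= (setIidPr coreG) ler_wpDr //.
    by apply: sumr_ge0 => x _; apply: sqr_ge0.
  have := core_mass; lra.
have m1 : 1%:R / 10 * Z <= mass (core :&: (s *: core)%g).
  have := mass_cap coreG sG; have := core_mass; move: m3; lra.
apply: leq_trans (card_ge_mass _ m1); last by apply: subset_trans coreG; apply: subsetIl.
by rewrite mul1n; apply: subset_leq_card.
Qed.

End Core.

(** The reverse triangle inequality for Euclidean norms, squared. *)
Lemma sqrt_sum_diff (R : rcfType) (T : finType) (P : pred T) (a b : T -> R) :
  (Num.sqrt (\sum_(i | P i) a i ^+ 2) - Num.sqrt (\sum_(i | P i) b i ^+ 2)) ^+ 2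
  <= \sum_(i | P i) (a i - b i) ^+ 2.
Proof.
set A := \sum_(i | P i) a i ^+ 2; set B := \sum_(i | P i) b i ^+ 2.
have A0 : 0 <= A by apply: sumr_ge0 => i _; apply: sqr_ge0.
have B0 : 0 <= B by apply: sumr_ge0 => i _; apply: sqr_ge0.
have cs : \sum_(i | P i) a i * b i <= Num.sqrt A * Num.sqrt B.
  rewrite -sqrtrM //; apply: le_trans (ler_norm _) _; rewrite -sqrtr_sqr ler_sqrt ?mulr_ge0 //.
  exact: real_cauchy_schwarz.
have -> : \sum_(i | P i) (a i - b i) ^+ 2 = A + B - 2 * \sum_(i | P i) a i * b i.
  rewrite /A /B mulr_sumr -big_split -sumrB; apply: eq_bigr => i _ /=; ring.
have -> : (Num.sqrt A - Num.sqrt B) ^+ 2 =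
  Num.sqrt A ^+ 2 + Num.sqrt B ^+ 2 - 2 * (Num.sqrt A * Num.sqrt B) by ring.
rewrite !sqr_sqrtr //; lra.
Qed.

Lemma large_part_arith (R : realFieldType) (Z x y c U1 U2 V1 V2 : R) :
  0 < Z -> 0 <= c -> U1 + U2 = Z -> 8 / 10 * Z <= U1 -> V2 <= V1 -> V1 <= Z / 10 ->
  V1 = Z - (x + y) * c -> y * c <= 2 * U2 + 2 * V2 -> x + y <= 3 * x.
Proof.
move=> Z0 c0 UE U1Z V21 V1Z V1E yc.
have c_neq0 : c != 0 by apply/eqP => cz; move: V1E; rewrite cz mulr0; lra.
have c_gt0 : 0 < c by rewrite lt0r c_neq0.
by rewrite -(ler_pM2r c_gt0); lra.
Qed.

(** [U] is the Euclidean norm of [u] on each coset. Taking norms does not increase the energy, so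
    the gap of [G / N] makes [U] nearly constant, and a set with 8/10 of the mass must meet at least
    a third of the cosets. *)
Lemma quotient_mass (R : realType) (gT : finGroupType) (G N : {group gT}) (S A : {set gT})
    (u : gT -> R) (kappa gamma : R) :
  S \subset G -> (0 < #|S|)%N -> maxnormal N G G -> A \subset G -> 0 < nrm G u ->
  8 / 10 * nrm G u <= \sum_(x in A) u x ^+ 2 ->
  edge_energy G S u <= kappa * nrm G u -> 0 < gamma -> gamma <= quotient_gap R G N S ->
  10 * kappa <= 2 * #|S|%:R * gamma ->
  (#|G / N|%g <= 3 * #|A / N|%g)%N.
Proof.
move=> SG S0 mN AG Z0 mA en g0 gg kg.
have NG := maxnormal_normal mN; have nN := normal_norm NG.
set Z := nrm G u in Z0 mA en *; pose Q := (G / N)%g.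
pose cs := [seq coset N x | x <- enum S].
have sH : {subset cs <= (G / N)%G}.
  move=> q /mapP[x Sx ->{q}]; rewrite mem_enum in Sx.
  by apply: mem_quotient; apply: (subsetP SG).
have s0 : (0 < size cs)%N by rewrite size_map -cardE.
have H1 : (1 < #|(G / N)%G|)%N.
  rewrite cardG_gt1; apply/trivgPn; have /andP[/andP[pNG nGN] _] := maxgroupp mN.
  have /subsetPn[x Gx nNx] := nGN; exists (coset N x); first by rewrite mem_quotient.
  by apply: contra nNx => /eqP h; apply: coset_idr h; apply: (subsetP nN).
pose U q : R := Num.sqrt (\sum_(g in G | coset N g == q) u g ^+ 2).
have U2 q : U q ^+ 2 = \sum_(g in G | coset N g == q) u g ^+ 2.
  by rewrite sqr_sqrtr // sumr_ge0 // => g _; apply: sqr_ge0.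
have part (f : gT -> R) : \sum_(g in G) f g = \sum_(q in Q) \sum_(g in G | coset N g == q) f g.
  by rewrite (partition_big (coset N) [in Q]) //= => g Gg; apply: mem_quotient.
have sumU2 : \sum_(q in Q) U q ^+ 2 = Z by rewrite /Z /nrm part; apply: eq_bigr => q _; rewrite U2.
have q0 : 0 < #|Q|%:R :> R by rewrite ltr0n cardG_gt0.
pose mu := (\sum_(q in Q) U q) / #|Q|%:R; pose V q := U q - mu.
have V0 : \sum_(q in Q) V q = 0.
  by rewrite sumrB sumr_const -mulr_natr divfK ?subrr // lt0r_neq0.
have poin := gap_poincare sH s0 H1 V0.
have enV : \sum_(x <- cs) \sum_(q in Q) (V (x * q)%g - V q) ^+ 2 <= edge_energy G S u.
  rewrite big_map big_enum; apply: ler_sum => s Ss.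
  have Gs := subsetP SG s Ss.
  rewrite [leRHS]part; apply: ler_sum => q Qq.
  have -> : V (coset N s * q)%g - V q = U (coset N s * q)%g - U q by rewrite /V; ring.
  have -> : U (coset N s * q)%g = Num.sqrt (\sum_(g in G | coset N g == q) u (s * g)%g ^+ 2).
    congr Num.sqrt; rewrite (reindex_inj (mulgI s)) /=; apply: eq_bigl => g.
    rewrite groupMl //; case Gg: (g \in G) => //=.
    by rewrite morphM ?(subsetP nN) //= (inj_eq (mulgI _)).
  exact: sqrt_sum_diff.
have szE : size cs = #|S| by rewrite size_map -cardE.
have V2 : \sum_(q in Q) V q ^+ 2 <= Z / 10.
  have v0 : 0 <= \sum_(q in Q) V q ^+ 2 by apply: sumr_ge0 => q _; apply: sqr_ge0.
  have m0 : 0 < #|S|%:R :> R by rewrite ltr0n.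
  have mg : 0 < 2 * #|S|%:R * gamma by rewrite !mulr_gt0.
  rewrite -(ler_pM2l mg); apply: le_trans (_ : kappa * Z <= _).
    apply: le_trans (le_trans poin (le_trans enV en)).
    by rewrite szE ler_wpM2r // ler_wpM2l // mulr_ge0 // ltW.
  have -> : 2 * #|S|%:R * gamma * (Z / 10) = 2 * #|S|%:R * gamma / 10 * Z by rewrite mulrA mulrAC.
  by rewrite ler_wpM2r ?(ltW Z0) // ler_pdivlMr // mulrC.
have VE : \sum_(q in Q) V q ^+ 2 = Z - #|Q|%:R * mu ^+ 2.
  transitivity (\sum_(q in Q) (U q ^+ 2 - 2 * mu * U q + mu ^+ 2)).
    by apply: eq_bigr => q _; rewrite /V; ring.
  rewrite big_split sumrB /= -mulr_sumr sumU2 sumr_const -[_ *+ #|_|]mulr_natl.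
  have -> : \sum_(q in Q) U q = #|Q|%:R * mu by rewrite /mu mulrC divfK // lt0r_neq0.
  by ring.
pose QA := (A / N)%g; have QAQ : QA \subset Q by apply: quotientS.
have massQA : 8 / 10 * Z <= \sum_(q in QA) U q ^+ 2.
  apply: le_trans mA _; rewrite (partition_big (coset N) [in QA]) /=; last first.
    by move=> x Ax; apply: mem_morphim => //; apply: (subsetP nN); apply: (subsetP AG).
  apply: ler_sum => q _; rewrite U2 [leLHS]big_mkcond [leRHS]big_mkcond /=.
  apply: ler_sum => x _; case: (boolP (x \in A)) => [Ax|_] /=.
    by rewrite (subsetP AG).
  by case: ifP => _ //; apply: sqr_ge0.
have outV : \sum_(q in Q :\: QA) V q ^+ 2 <= \sum_(q in Q) V q ^+ 2.
  rewrite [leRHS](big_setID QA) /= ler_wpDl // sumr_ge0 // => q _; exact: sqr_ge0.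
have out : #|Q :\: QA|%:R * mu ^+ 2 <=
    2 * (\sum_(q in Q :\: QA) U q ^+ 2) + 2 * (\sum_(q in Q :\: QA) V q ^+ 2).
  rewrite mulr_natl -sumr_const !mulr_sumr -big_split; apply: ler_sum => q _ /=.
  rewrite /V -subr_ge0.
  have -> : 2 * U q ^+ 2 + 2 * (U q - mu) ^+ 2 - mu ^+ 2 = (2 * U q - mu) ^+ 2 by ring.
  exact: sqr_ge0.
have cQ : #|Q|%:R = #|QA|%:R + #|Q :\: QA|%:R :> R.
  by rewrite -natrD -(cardsID QA Q) (setIidPr QAQ).
have UE : \sum_(q in QA) U q ^+ 2 + \sum_(q in Q :\: QA) U q ^+ 2 = Z.
  by rewrite -sumU2 [RHS](big_setID QA) /= (setIidPr QAQ).
rewrite -(ler_nat R) natrM -/Q -/QA cQ; rewrite cQ in VE.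
exact: large_part_arith Z0 (sqr_ge0 mu) UE massQA outV V2 VE out.
Qed.

(** Energy and squared norm are sums over the real and imaginary parts, so one of the parts
    satisfies the bound. *)
Lemma gap_real_vector (R : realType) (gT : finGroupType) (G : {group gT}) (S : {set gT}) :
  S \subset G -> (0 < #|S|)%N -> (1 < #|G|)%N -> exists f : gT -> R,
  [/\ forall x, x \notin G -> f x = 0, \sum_(x in G) f x = 0, 0 < nrm G f &
      edge_energy G S f <= 2 * #|S|%:R * gap R G (enum S) * nrm G f].
Proof.
move=> SG S0 G1.
have sH : {subset enum S <= G} by move=> x; rewrite mem_enum; apply: (subsetP SG).
have s0 : (0 < size (enum S))%N by rewrite -cardE.
have [f [fG f0 nf df]] := gap_vector R sH s0 G1.
pose a x := complex.Re (f x); pose b x := complex.Im (f x).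
have fE x : f x = (a x)%:C%C + 'i%C * (b x)%:C%C by rewrite {1}(complexE (f x)).
have nE : \sum_(g in G) sqn (f g) = nrm G a + nrm G b by rewrite /nrm -big_split.
have dE : displacement G (enum S) f = edge_energy G S a + edge_energy G S b.
  rewrite /displacement /edge_energy -big_split big_enum; apply: eq_bigr => s _.
  rewrite -big_split; apply: eq_bigr => x _ /=.
  by rewrite /sqn /a /b; case: (f (s * x)%g) => ? ?; case: (f x).
have [sa sb] : \sum_(x in G) a x = 0 /\ \sum_(x in G) b x = 0.
  have : \sum_(x in G) f x = (\sum_(x in G) a x)%:C%C + 'i%C * (\sum_(x in G) b x)%:C%C.
    by rewrite !sum_real_complex mulr_sumr -big_split; apply: eq_bigr => x _; apply: fE.
  rewrite f0 => /eqP; rewrite eq_complex /= => /andP[/eqP h1 /eqP h2].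
  by split; move: h1 h2; lra.
move: nf df; rewrite nE dE -cardE; set c := 2 * _ * _ => nf df.
have na := nrm_ge0 G a; have nb := nrm_ge0 G b.
have [ha|ha] := boolP ((0 < nrm G a) && (edge_energy G S a <= c * nrm G a)).
  case/andP: ha => h1 h2; exists a; split=> //.
  by move=> x /fG; rewrite /a => ->.
exists b; have bz x : x \notin G -> b x = 0 by move=> /fG; rewrite /b => ->.
have [a0|ap] := eqVneq (nrm G a) 0.
  have ea : edge_energy G S a = 0.
    have az x : x \in G -> a x = 0.
      move=> Gx; apply/eqP; rewrite -sqrf_eq0; apply/eqP.
      by apply: (psumr_eq0P _ a0) => // y _; apply: sqr_ge0.
    apply: big1 => s Ss; apply: big1 => x Gx.
    by rewrite !az ?subrr ?expr0n // groupM // (subsetP SG).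
  by split=> //; move: nf df; rewrite a0 ea !add0r.
have {}ap : 0 < nrm G a by rewrite lt0r ap.
move: ha; rewrite ap /= -ltNge => ha.
have db : edge_energy G S b < c * nrm G b by move: df; lra.
split=> //; last exact: ltW.
rewrite lt0r nb andbT; apply/eqP => b0; move: db; rewrite b0 mulr0 ltNge => /negP[].
by apply: sumr_ge0 => s _; apply: sumr_ge0 => x _; apply: sqr_ge0.
Qed.

(** * Construction of the approximate group *)

Section ApproximateGroup.
Variables (R : realType) (gT : finGroupType) (G : {group gT}) (S : {set gT}).
Hypothesis SG : S \subset G.
Hypothesis S0 : (0 < #|S|)%N.
Hypothesis G1 : (1 < #|G|)%N.
Variables (Delta : R) (Dl : nat).
Hypothesis minD : min_degree G Delta.
Hypothesis Delta1 : 1 < Delta.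
Hypothesis DlD : Dl%:R <= Delta.
Variables (gamma kappa' eta : R) (nu M tau I F0 : nat).
Local Notation kappa := (gap R G (enum S)).
Hypothesis gamma0 : 0 < gamma.
Hypothesis gammaN : forall N : {group gT}, maxnormal N G G -> gamma <= quotient_gap R G N S.
Hypothesis kM : (2 ^ M)%N%:R * kappa <= kappa'.
Hypothesis k'0 : 0 < kappa' <= 2^-1.
Hypothesis k'g : 10 * ((800 ^ I)%N%:R * (4 * #|S|%:R * kappa')) <= 2 * #|S|%:R * gamma.
Hypothesis k'1 : (800 ^ I)%N%:R * (4 * #|S|%:R * kappa') <= 1 / 10.
Hypothesis nu1 : (1 < nu)%N.
Hypothesis M0 : (0 < M)%N.
Hypothesis nM : (#|G| <= nu ^ M)%N.
Hypothesis tI : (#|G| < tau ^ I)%N.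
Hypothesis eta0 : 0 < eta.
Hypothesis eta1 : (400 ^ I)%N%:R * eta <= 1 / 10.
Hypothesis F00 : (0 < F0)%N.
Hypothesis nuF : nu%:R ^+ 2 <= F0%:R * eta ^+ 2.

Let F := (F0 ^ (2 ^ I))%N.
Let K1 := (2 * tau ^ 2 * F ^ 2)%N.
Let K2 := (2 * (10 * F) ^ 2 * K1)%N.

Hypothesis KDl : ((3 * K1 * K2 ^ 2) ^ 3 < Dl)%N.

(** [W] collects the points where the flat law [u] is at least [eta * Z]. The rest contributes at
    most [eta * Z] as [u] sums to 1; the ratio of [B] to [eta * Z] is at most [nu / eta], whose
    square [F0] absorbs; and [#|W| * eta * Z <= 1] with the lower bound on [Z] makes [W] small. *)
Lemma initial_flat : exists u W B, [/\ flat_on G S u W B F0 eta (4 * #|S|%:R * kappa') &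
  #|W|%:R * eta * Delta <= 2 * nu%:R * #|G|%:R].
Proof.
have [f [fG f0 nf ef]] := gap_real_vector R SG S0 G1.
have sH : {subset enum S <= G} by move=> x; rewrite mem_enum; apply: (subsetP SG).
have s0 : (0 < size (enum S))%N by rewrite -cardE.
have /andP[k0 _] := gap_bounds R sH s0 G1.
have nuR : 1 < nu%:R :> R by rewrite ltr1n.
have nMR : #|G|%:R <= nu%:R ^+ M :> R by rewrite -natrX ler_nat.
have exJ : exists J, (1 - kappa') ^+ J < nu%:R^-1.
  case/andP: k'0 => h1 h2.
  pose J := Num.truncn (nu%:R / kappa') ; exists J.+1.
  have hJ : nu%:R < J.+1%:R * kappa'.
    rewrite -ltr_pdivrMr //; have /andP[_] := truncn_itv (divr_ge0 (ler0n R nu) (ltW h1)).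
    by [].
  have e1 : (1 - kappa') ^+ J.+1 * (1 + kappa') ^+ J.+1 <= 1.
    rewrite -exprMn; apply: exprn_ile1; [have := sqr_ge0 kappa'; nra | have := sqr_ge0 kappa'; lra].
  have e2 : 1 + J.+1%:R * kappa' <= (1 + kappa') ^+ J.+1.
    elim: (J.+1) => [|j IH]; first by rewrite mul0r addr0 expr0.
    rewrite exprS; apply: le_trans (_ : (1 + kappa') * (1 + j%:R * kappa') <= _); last first.
      by rewrite ler_wpM2l //; lra.
    rewrite -[in leLHS]natr1; have := mulr_ge0 (ler0n R j) (sqr_ge0 kappa'); lra.
  have q0 : 0 <= (1 - kappa') ^+ J.+1 by apply: exprn_ge0; lra.
  rewrite -[ltRHS]mul1r ltr_pdivlMr ?(lt_trans ltr01) //.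
  have q1 : 0 < (1 - kappa') ^+ J.+1 by apply: exprn_gt0; lra.
  apply: lt_le_trans e1; rewrite ltr_pM2l //; lra.
have [u [B [[u0 u1 uB] BZ eu DZ Z0]]] := flat_scale minD (ltW (lt_trans ltr01 Delta1)) SG S0 fG
  f0 nf ef
  k0 kM k'0 nuR M0 nMR exJ.
set Z := nrm G u in BZ eu DZ Z0.
pose W := [set x in G | eta * Z <= u x].
exists u, W, (B ^+ 2); split.
  split=> //.
  - by apply/subsetP => x; rewrite inE => /andP[].
  - apply: le_trans (_ : \sum_(x in G | x \notin W) eta * Z * u x <= _).
      apply: ler_sum => x /andP[Gx]; rewrite inE Gx /= -ltNge => h.
      by rewrite expr2 ler_wpM2r // ltW.
    rewrite -mulr_sumr -[leRHS]mulr1 ler_wpM2l ?mulr_ge0 ?(ltW Z0) ?(ltW eta0) //.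
    rewrite -u1 [leRHS](bigID [in W]) /= ler_wpDl // sumr_ge0 //.
  - move=> x Gx; have := uB x Gx => h; have B0 := le_trans (u0 x) h.
    by rewrite lerXn2r ?nnegrE.
  move=> x; rewrite inE => /andP[Gx h].
  have B0 : 0 <= B by apply: le_trans (u0 x) (uB x Gx).
  have e2 : 0 < eta ^+ 2 by rewrite exprn_gt0.
  apply: le_trans (_ : (nu%:R * Z) ^+ 2 <= _).
    by rewrite lerXn2r ?nnegrE // mulr_ge0 // ltW.
  rewrite -(ler_pM2l e2) exprMn.
  apply: le_trans (_ : nu%:R ^+ 2 * u x ^+ 2 <= _).
    rewrite mulrCA ler_wpM2l ?exprn_ge0 // -exprMn lerXn2r ?nnegrE // mulr_ge0 // ltW //.
  have -> : eta ^+ 2 * (F0%:R * u x ^+ 2) = F0%:R * eta ^+ 2 * u x ^+ 2 by ring.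
  by rewrite ler_wpM2r ?sqr_ge0.
have cW : #|W|%:R * (eta * Z) <= 1.
  rewrite mulr_natl -sumr_const -[leRHS]u1.
  apply: le_trans (_ : \sum_(x in W) u x <= _).
    by apply: ler_sum => x; rewrite inE => /andP[].
  have WG : W \subset G by apply/subsetP => x; rewrite inE => /andP[].
  by rewrite [leRHS](big_setID W) /= (setIidPr WG) ler_wpDr // sumr_ge0.
apply: le_trans (_ : #|W|%:R * eta * (2 * nu%:R * #|G|%:R * Z) <= _).
  by rewrite ler_wpM2l // mulr_ge0 // ltW.
have n0 : 0 <= 2 * nu%:R * #|G|%:R :> R by rewrite !mulr_ge0.
by have := ler_wpM2l n0 cW; lra.
Qed.

(** The set is the sixth power of the popular differences of the core: their square fills a fixed
    proportion of each [G / N], and Gowers' trick asks for a cube of that. *)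
Lemma approximate_group k : (0 < k)%N -> exists D : {set gT},
  [/\ approx (K2 ^ 2 * (K1 * K2) ^ (6 * k)) k D, D \subset G, full G D,
      {in S, forall s, #|D| <= (K2 ^ 2 * (K1 * K2) ^ (6 * k)) * #|(D :&: D :^ s)%g|}%N &
      #|D|%:R * eta * Delta <= (K2 * (K1 * K2) ^ 5)%N%:R * (2 * nu%:R * #|G|%:R)].
Proof.
move=> k0; have [u0 [W0 [B0 [flat0 cW0]]]] := initial_flat.
have W0I : (#|W0| < tau ^ I)%N.
  by apply: leq_ltn_trans tI; apply: subset_leq_card; case: flat0.
have e1 : (400 ^ I)%N%:R * eta < 1 by apply: le_lt_trans eta1 _; lra.
have kap0 : 0 < 4 * #|S|%:R * kappa' by case/andP: k'0 => h _; rewrite !mulr_gt0 // ltr0n.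
have [u [W [B [flat dns WW]]]] := homogenize SG W0I F00 eta0 e1 kap0 flat0.
pose A := core G tau u W.
have AW : A \subset W by apply/subsetP => x; rewrite inE => /andP[].
have AG : A \subset G by apply: subset_trans AW _; case: flat.
have A0 : (0 < #|A|)%N by apply: (core_gt0 flat dns eta1).
have A1 : (#|(A^-1 * A)%g| <= K1 * #|A|)%N by apply: (core_quotient_card flat dns eta1).
have F_gt0 : (0 < F)%N by rewrite expn_gt0 F00.
have K00 : (0 < 10 * F)%N by rewrite muln_gt0.
have As s : s \in S -> (#|A| <= 10 * F * #|A :&: (s *: A)%g|)%N
  by apply: (core_shift SG flat dns eta1 k'1).
pose D := popular_differences G A (10 * F) K1 A.
have D1 : 1%g \in D := popular_differences1 G A0 K00 A1.
have sD : (D^-1)%g = D := popular_differencesV G A (10 * F) K1.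
have DG : D \subset G := popular_differences_sub _ _ _ _ _.
have AD : (#|A| <= K2 * #|D|)%N.
  apply: (card_popular_differences AG A0 A1) => //.
  by rewrite leq_pmull.
have Ds s : s \in S -> (#|A| <= K2 * #|(D :&: D :^ s)%g|)%N.
  by move=> Ss; apply: (card_popular_conj AG A0 A1) (As s Ss); apply: (subsetP SG).
have Dk j : (#|(D ^+ j.+1)%g| <= K2 * (K1 * K2) ^ j * #|A|)%N := @card_expgS_popular gT G A (10
  * F) K1 A0 A1 j.
have D60 : (D \subset D ^+ 6)%g by rewrite -{1}[D]expg1 expg_leS.
have K10 : (0 < K1)%N by rewrite lt0n; apply: contraTneq A1 => ->; rewrite mul0n -ltnNge card_gt0;
   have /card_gt0P[a Aa] := A0; apply/set0Pn; exists (a^-1 * a)%g;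
     rewrite mem_mulg // mem_invg invgK.
have K20 : (0 < K2)%N by rewrite lt0n; apply: contraTneq AD => ->; rewrite mul0n -ltnNge.
have K120 : (0 < K1 * K2)%N by rewrite muln_gt0 K10.
have lift j (Y : {set gT}) : (j <= 6 * k)%N -> (#|A| <= K2 * #|Y|)%N ->
    (K2 * (K1 * K2) ^ j * #|A| <= K2 ^ 2 * (K1 * K2) ^ (6 * k) * #|Y|)%N.
  move=> jk AY; apply: leq_trans (leq_mul (leqnn _) AY) _.
  have -> : (K2 * (K1 * K2) ^ j * (K2 * #|Y|) = K2 ^ 2 * (K1 * K2) ^ j * #|Y|)%N by ring.
  by rewrite leq_mul2r leq_mul2l leq_pexp2l ?orbT.
exists (D ^+ 6)%g; split.
- split; [exact: expg_mem1 | exact: expg_inv |].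
  rewrite -expgM -(prednK (_ : 0 < 6 * k)%N) ?muln_gt0 //.
  apply: leq_trans (Dk _) _; rewrite prednK ?muln_gt0 //.
  apply: lift; first exact: leq_pred.
  by apply: leq_trans AD _; rewrite leq_mul2l subset_leq_card ?orbT.
- exact: expg_subG.
- move=> N mN; have nN := normal_norm (maxnormal_normal mN).
  have nD j : (D ^+ j)%g \subset 'N(N)%g by apply: subset_trans nN; apply: expg_subG.
  have QA : (#|G / N|%g <= 3 * #|A / N|%g)%N.
    have [_ _ Z0 _ _ _ en] := flat.
    exact: (quotient_mass SG S0 mN AG Z0 (core_mass flat dns eta1) en gamma0 (gammaN mN) k'g).
  have D0 : D != finset.set0 by apply/set0Pn; exists 1%g.
  (* [A^-1] lies in at most [K1 * K2 ^ 2] translates of [D ^+ 2] and [A] meets a third of the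
     cosets, so [D ^+ 2] fills a proportion [1 / (3 * K1 * K2 ^ 2)] of [G / N]. *)
  have [Z [ZA cZ cover]] := ruzsa_cover (A^-1)%g D0.
  have cardZ : (#|Z| <= K1 * K2 ^ 2)%N.
    have Dpos : (0 < #|D|)%N by rewrite card_gt0.
    rewrite -(leq_pmul2r Dpos); apply: leq_trans cZ _.
    have -> : #|(A^-1 * D)%g| = #|(D * A)%g|.
      by rewrite -card_invg invMg invgK sD.
    have h : (#|(D * A)%g| <= K1 * K2 * #|A|)%N.
      by have := @card_expg_popular gT G A (10 * F) K1 A0 A1 1; rewrite expg1 expn1.
    apply: leq_trans h _; apply: leq_trans (leq_mul (leqnn _) AD) _.
    by apply: eq_leq; ring.
  have AZ : (#|A / N|%g <= K1 * K2 ^ 2 * #|((D ^+ 2) / N)%g|)%N.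
    apply: leq_trans (_ : #|Z| * #|((D ^+ 2) / N)%g| <= _)%N; last by rewrite leq_mul2r cardZ orbT.
    have sub : ((A / N)^-1 \subset [set coset N p.1 * p.2 | p in setX Z (D ^+ 2 / N)])%g.
      apply/subsetP => q; rewrite mem_invg => /morphimP[a Na Aa qE].
      have : (a^-1 \in A^-1)%g by rewrite mem_invg invgK.
      move/(subsetP cover); rewrite sD => /mulsgP[z d Zz Dd aE].
      have Nd : d \in 'N(N)%g by apply: (subsetP (nD 2)); rewrite expgS expg1.
      have Nz : z \in 'N(N)%g.
        have := subsetP ZA z Zz; rewrite mem_invg => Az; rewrite -groupV.
        by apply: (subsetP nN); apply: (subsetP AG).
      apply/imsetP; exists (z, coset N d).
        rewrite in_setX Zz /=; apply: mem_morphim => //; by rewrite expgS expg1.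
      rewrite /= -morphM // -aE morphV //=; apply: invg_inj; rewrite invgK qE //.
    rewrite -[#|(A / N)%g|]card_invg; apply: leq_trans (subset_leq_card sub) _.
    by apply: leq_trans (leq_imset_card _ _) _; rewrite cardsX.
  have big : (#|(G / N)%g| ^ 3 < Dl * #|((D ^+ 2) / N)%g| ^ 3)%N.
    apply: leq_ltn_trans (_ : (3 * K1 * K2 ^ 2 * #|((D ^+ 2) / N)%g|) ^ 3 < _)%N.
      rewrite leq_exp2r //; apply: leq_trans QA _.
      by apply: leq_trans (leq_mul (leqnn 3) AZ) _; rewrite !mulnA.
    rewrite expnMn ltn_pmul2r // expn_gt0 card_gt0; apply/orP; left; apply/set0Pn.
    by exists (coset N 1); apply: mem_morphim; rewrite ?group1 ?expg_mem1.
  have := quotient_gowers minD Delta1 DlD mN (quotientS N (expg_subG 2 DG)) big.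
  have -> : (((D ^+ 2) / N) ^+ 3 = (D ^+ 6) / N)%g.
    rewrite (_ : 6 = 2 * 3)%N // expgM !expgS expg0 !mulg1.
    by rewrite !quotientMl // -?(expgS D 1) ?mulgA ?expg1 // (nD 1).
  by [].
- move=> s Ss; apply: leq_trans (Dk 5) _; apply: lift;
  first by apply: (@leq_trans (6 * 1)) => //; rewrite leq_mul2l.
  apply: leq_trans (Ds s Ss) _; rewrite leq_mul2l subset_leq_card ?orbT // setISS //.
  by rewrite conjSg.
apply: le_trans (_ : (K2 * (K1 * K2) ^ 5)%N%:R * (#|W0|%:R * eta * Delta) <= _); last first.
  by rewrite ler_wpM2l.
have eD : 0 <= eta * Delta by rewrite mulr_ge0 // ltW // (lt_trans ltr01).
rewrite -mulrA -[#|W0|%:R * _ * _]mulrA [leRHS]mulrA ler_wpM2r // -natrM ler_nat.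
apply: leq_trans (Dk 5) _; rewrite leq_mul2l (leq_trans _ WW) ?orbT //.
exact: subset_leq_card.
Qed.

End ApproximateGroup.

(** * Conclusion *)

Section SmallGroup.
Variables (R : realType) (gT : finGroupType) (G : {group gT}) (S : {set gT}).
Hypothesis SG : S \subset G.
Hypothesis genS : (<<S>> = G)%g.

Let B k : {set gT} := ((1 |: S) ^+ k)%g.

Let B1 : 1%g \in (1 |: S)%g. Proof. exact: setU11. Qed.

Let BG k : B k \subset G.
Proof. by apply: expg_subG; rewrite subUset sub1set group1. Qed.

Lemma ball_exhausts : B #|G| = G.
Proof.
have grow k : B k = G \/ (k < #|B k|)%N.
  elim: k => [|k [IH|IH]]; first by right; rewrite /B expg0 cards1.
    left; apply/eqP; rewrite eqEsubset BG -{1}IH; exact: expg_leS.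
  have sub : B k \subset B k.+1 by apply: expg_leS.
  have [e|ne] := eqVneq (B k.+1) (B k); last first.
    right; apply: leq_ltn_trans IH _; apply: proper_card.
    by rewrite properEneq eq_sym ne.
  left; have stab j : B (j + k) = B k.
    by elim: j => // j IHj; rewrite addSn /B expgS -/(B (j + k)) IHj -expgS.
  have [j jE] := gen_expgs S.
  apply/eqP; rewrite e eqEsubset BG -(stab j) -genS jE; apply: expg_leS => //.
  exact: leq_addr.
case: (grow #|G|) => // h; have := subset_leq_card (BG #|G|).
by rewrite leqNgt h.
Qed.

(** Each letter costs a factor 4, from the inequality [(a + b) ^ 2 <= 2 a ^ 2 + 2 b ^ 2] and
    [2 * 4 ^ k + 2 <= 4 ^ k.+1]. *)
Lemma translate_energy f k g : g \in B k ->
  \sum_(x in G) (f (g * x)%g - f x) ^+ 2 <= (4 ^ k)%N%:R * edge_energy G S f :> R.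
Proof.
have E0 : 0 <= edge_energy G S f.
  by apply: sumr_ge0 => s _; apply: sumr_ge0 => x _; apply: sqr_ge0.
elim: k g => [|k IH] g.
  rewrite /B expg0 => /set1P ->; rewrite mul1r big1 // => x _.
  by rewrite mul1g subrr expr0n.
rewrite /B expgSr => /mulsgP[h s Bh Ss ->].
have Gs : s \in G.
  by case/setU1P: Ss => [->|/(subsetP SG) //]; apply: group1.
have hs : \sum_(x in G) (f (s * x)%g - f x) ^+ 2 <= edge_energy G S f.
  case/setU1P: Ss => [->|Ss].
    by rewrite big1 // => x _; rewrite mul1g subrr expr0n.
  rewrite /edge_energy [leRHS](bigD1 s) //= ler_wpDr // sumr_ge0 // => t _.
  by apply: sumr_ge0 => x _; apply: sqr_ge0.
have hh : \sum_(x in G) (f (h * (s * x))%g - f (s * x)%g) ^+ 2 <= (4 ^ k)%N%:R * edge_energy G S f.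
  by rewrite (sum_mulgl (fun x => (f (h * x)%g - f x) ^+ 2)) //; apply: IH.
apply: le_trans (_ : \sum_(x in G) (2 * (f (h * (s * x))%g - f (s * x)%g) ^+ 2
    + 2 * (f (s * x)%g - f x) ^+ 2) <= _).
  apply: ler_sum => x _; rewrite -mulgA; move: (f (h * _)%g) (f (s * x)%g) (f x) => a b c.
  have := sqr_ge0 (a - b - (b - c)); lra.
rewrite big_split /= -!mulr_sumr expnS natrM.
have : 1 <= (4 ^ k)%N%:R :> R by rewrite ler1n expn_gt0.
move: hs hh; set q := (4 ^ k)%N%:R; set E := edge_energy G S f in E0 *.
move=> hs hh q1; have := mulr_ge0 (_ : 0 <= q - 1) E0; rewrite subr_ge0 => /(_ q1); lra.
Qed.

(** For mean zero [f] the squared displacement by [g], averaged over [G], is [2 * nrm G f], and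
    every [g] lies in the ball of radius [#|G|]. *)
Lemma gap_ge_small : (0 < #|S|)%N -> (1 < #|G|)%N ->
  1 <= #|S|%:R * (4 ^ #|G|)%N%:R * gap R G (enum S).
Proof.
move=> S0 G1; have [f [fG f0 nf ef]] := gap_real_vector R SG S0 G1.
have n0 : 0 < #|G|%:R :> R by rewrite ltr0n cardG_gt0.
have e1 : \sum_(g in G) \sum_(x in G) (f (g * x)%g - f x) ^+ 2 = 2 * #|G|%:R * nrm G f.
  transitivity (\sum_(g in G) \sum_(x in G) (f (g * x)%g ^+ 2 +
    f x ^+ 2 - 2 * (f x * f (g * x)%g))).
    by apply: eq_bigr => g _; apply: eq_bigr => x _; ring.
  rewrite exchange_big /=.
  transitivity (\sum_(x in G) (nrm G f + #|G|%:R * f x ^+ 2)).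
    apply: eq_bigr => x Gx.
    have e3 : \sum_(g in G) 2 * (f x * f (g * x)%g) = 0.
      by rewrite -mulr_sumr -mulr_sumr (sum_mulgr f) // f0 !mulr0.
    rewrite sumrB big_split /= e3 subr0 (sum_mulgr (fun y => f y ^+ 2)) //.
    by rewrite sumr_const mulr_natl.
  by rewrite big_split /= -mulr_sumr sumr_const -/(nrm G f) -[_ *+ #|G|]mulr_natl; ring.
have e2 : 2 * #|G|%:R * nrm G f <= #|G|%:R * ((4 ^ #|G|)%N%:R * edge_energy G S f).
  rewrite -e1 mulr_natl -sumr_const; apply: ler_sum => g Gg.
  by apply: translate_energy; rewrite ball_exhausts.
have n2 : 0 < 2 * #|G|%:R * nrm G f by rewrite !mulr_gt0.
rewrite -(ler_pM2l n2) mulr1; apply: le_trans e2 _.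
apply: le_trans (ler_wpM2l (ltW n0) (ler_wpM2l (ler0n _ _) ef)) _.
apply: le_of_eq; ring.
Qed.

End SmallGroup.

(** * Large groups and the choice of the constants *)

Section LargeGroup.
Variables (R : realType) (gT : finGroupType) (G : {group gT}) (S : {set gT}).
Hypothesis SG : S \subset G.
Hypothesis genS : (<<S>> = G)%g.
Hypothesis S0 : (0 < #|S|)%N.
Hypothesis G1 : (1 < #|G|)%N.
Variable Delta : R.
Hypothesis minD : min_degree G Delta.

(* [e] is the reciprocal of the quasirandomness exponent, and [omega = v ^ (a * C)] is the
   unit in which all sizes are measured: [#|G|] is about [omega ^ L] and [Delta] at least
   [omega ^ E]. *)
Variables (e v Ic E L k C I a : nat).
Hypothesis IcE : Ic = (8 * e)%N.
Hypothesis EE : E = (50 * 3 ^ Ic)%N.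
Hypothesis LE : L = (2 * e * E)%N.
Hypothesis kE : k = (9 * 13 ^ L.+1)%N.
Hypothesis CE : C = ((8 + 42 * k) * (L + 6))%N.
Hypothesis IE : I = (C * L).+1.
Hypothesis aE : a = (6 * 2 ^ I).+1.
Let omega := (v ^ (a * C))%N.
Let M := (a * C * L)%N.

Hypothesis e0 : (0 < e)%N.
Hypothesis vbig : (320 * 9 ^ Ic + 100 * 400 ^ (2 * I) + 200 <= v)%N.
Hypothesis nv : (#|G| <= v ^ M)%N.
Hypothesis DeltaE : (omega ^ E)%N%:R <= Delta.

Variable gamma : R.
Hypothesis gamma0 : 0 < gamma.
Hypothesis gamma2 : gamma <= 2.
Hypothesis gammaN : forall N : {group gT}, maxnormal N G G -> gamma <= quotient_gap R G N S.

Let v200 : (200 <= v)%N. Proof. by apply: leq_trans vbig; apply: leq_addl. Qed.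
Let v0 : (0 < v)%N. Proof. exact: leq_trans v200. Qed.
Let v1 : (1 < v)%N. Proof. exact: leq_trans v200. Qed.

Let E30 : (150 <= E)%N.
Proof.
rewrite EE; apply: (@leq_trans (50 * 3)) => //; rewrite leq_mul2l /= -{1}(expn1 3) leq_pexp2l //.
by rewrite IcE muln_gt0.
Qed.

Let a0 : (0 < a)%N. Proof. by rewrite aE. Qed.
Let k_gt0 : (0 < k)%N. Proof. by rewrite kE muln_gt0 expn_gt0. Qed.
Let C0 : (50 <= C)%N.
Proof.
rewrite CE; apply: (@leq_trans ((8 + 42 * 1) * 1)) => //; apply: leq_mul.
  by rewrite leq_add2l leq_mul2l.
by rewrite addnS.
Qed.

Let y := (v ^ a)%N.
Let y0 : (0 < y)%N. Proof. by rewrite expn_gt0 v0. Qed.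
Let omegaE : omega = (y ^ C)%N. Proof. by rewrite /omega expnM. Qed.
Let vy : (v <= y)%N. Proof. by rewrite /y -{1}[v]expn1 leq_pexp2l. Qed.
Let yomega : (y <= omega)%N.
Proof. by rewrite omegaE -{1}[y]expn1 leq_pexp2l //; apply: leq_trans C0. Qed.
Let vomega : (v <= omega)%N. Proof. exact: leq_trans vy yomega. Qed.
Let omega0 : (0 < omega)%N. Proof. exact: leq_trans vomega. Qed.

(** [F0 * eta ^+ 2] has to dominate [v ^ 2], and [vbig] gives [eta ^- 2 <= v]. *)
Let F0 := (v ^ 3)%N.
Let F := (F0 ^ (2 ^ I))%N.
Let K1 := (2 * y ^ 2 * F ^ 2)%N.
Let K2 := (2 * (10 * F) ^ 2 * K1)%N.
Let K := (K2 ^ 2 * (K1 * K2) ^ (6 * k))%N.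

(** The reason for [a = 6 * 2 ^ I + 1]: one factor [v] of [y] is left over for numerical
    constants. *)
Let F2E : (F ^ 2 = v ^ a.-1)%N.
Proof. by rewrite /F /F0 -!expnM; congr (_ ^ _)%N; rewrite aE succnK; ring. Qed.

Let vF : (v * F ^ 2 = y)%N. Proof. by rewrite F2E -expnS prednK. Qed.

Let K1y : (K1 <= y ^ 3)%N.
Proof.
have -> : (y ^ 3 = v * y ^ 2 * F ^ 2)%N by rewrite -vF; ring.
by rewrite /K1 !leq_mul2r (leq_trans _ v200) ?orbT.
Qed.

Let K2y : (K2 <= y ^ 4)%N.
Proof.
have -> : (y ^ 4 = v * F ^ 2 * y ^ 3)%N by rewrite vF; ring.
have -> : (K2 = 200 * F ^ 2 * K1)%N by rewrite /K2; ring.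
by rewrite leq_mul // leq_mul2r v200 orbT.
Qed.

Let K_gt0 : (0 < K)%N.
Proof. by rewrite /K /K2 /K1 /F /F0 !(muln_gt0, expn_gt0) v0. Qed.

(** The origin of [C]: [K1 <= y ^ 3] and [K2 <= y ^ 4] give [K <= y ^ (8 + 42 * k)], and products of
    up to [L + 6] factors [K] have to fit into [omega]. *)
Let Komega : (K ^ (L + 6) <= omega)%N.
Proof.
rewrite omegaE CE expnM leq_exp2r ?addn_gt0 ?orbT //.
have -> : (y ^ (8 + 42 * k) = (y ^ 4) ^ 2 * (y ^ 3 * y ^ 4) ^ (6 * k))%N.
  by rewrite -!expnD -!expnM -expnD; congr (_ ^ _)%N; ring.
apply: leq_mul; first by rewrite leq_exp2r.
by rewrite leq_exp2r ?muln_gt0 // leq_mul.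
Qed.

Let Kpow j : (j <= L + 6)%N -> (K ^ j <= omega)%N.
Proof. by move=> h; apply: leq_trans Komega; rewrite leq_pexp2l. Qed.

Let nomega : (#|G| <= omega ^ L)%N.
Proof. by rewrite /omega -expnM. Qed.

Let eta : R := ((10 * 400 ^ I)%N%:R)^-1.

Let ratio_bound (x : R) : 0 <= x -> Delta * x ^+ 3 <= 1 -> x <= (omega ^ 10)%N%:R^-1.
Proof.
move=> x0 h; rewrite leNgt; apply/negP => lt.
have w0 : 0 < (omega ^ 10)%N%:R :> R by rewrite ltr0n expn_gt0 omega0.
have w1 : 1 < (omega ^ 10)%N%:R * x by rewrite -ltr_pdivrMl // mulr1.
have : 1 < ((omega ^ 10)%N%:R * x) ^+ 3 by rewrite exprn_egt1.
rewrite exprMn -natrX -expnM ltNge => /negP[].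
apply: le_trans h; rewrite ler_wpM2r ?exprn_ge0 //; apply: le_trans DeltaE.
by rewrite ler_nat leq_pexp2l // (leq_trans _ E30).
Qed.

(** The constants are chosen without circularity: [Ic], [E], [L] from [e] alone, then [k] for the
    powers consumed by [L + 1] descents, then [C], then [I] with [#|G| < y ^ I] for the
    regularisations, then [a] for the flatness lost in them, and [v] last. Regularisation costs the
    gap [800 ^ I], the doublings of time cost [2 ^ M]. *)
Lemma gap_ge_large :
  gamma <= 800 ^+ I * (80 * #|S|%:R) * 2 ^+ M * gap R G (enum S).
Proof.
set kappa := gap R G (enum S); rewrite leNgt; apply/negP => small.
have m0 : 0 < #|S|%:R :> R by rewrite ltr0n.
have m1 : 1 <= #|S|%:R :> R by rewrite ler1n.
have p800 : 0 < 800 ^+ I :> R by apply: exprn_gt0.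
have p800' : 1 <= 800 ^+ I :> R by apply: exprn_ege1; rewrite ler1n.
(* Chosen so that the energy constant after [I] regularisations is [gamma / 20]. *)
pose kappa' := gamma / (800 ^+ I * (80 * #|S|%:R)).
have den0 : 0 < 800 ^+ I * (80 * #|S|%:R) :> R by rewrite !mulr_gt0.
have den80 : 80 <= 800 ^+ I * (80 * #|S|%:R) :> R.
  by rewrite mulrCA -[leLHS]mulr1 ler_wpM2l // -[leLHS]mulr1 ler_pM.
have k'E : 800 ^+ I * (80 * #|S|%:R) * kappa' = gamma.
  by rewrite /kappa' mulrC divfK // lt0r_neq0.
have kM : (2 ^ M)%N%:R * kappa <= kappa'.
  rewrite /kappa' ler_pdivlMr // natrX mulrAC -mulrA mulrC.
  by apply: le_trans (ltW small); apply: le_of_eq; ring.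
have k'0 : 0 < kappa' <= 2^-1.
  rewrite divr_gt0 //= /kappa' ler_pdivrMr //.
  apply: le_trans gamma2 _; rewrite ler_pdivlMl //; apply: le_trans den80; lra.
have kk : (800 ^ I)%N%:R * (4 * #|S|%:R * kappa') = gamma / 20.
  by rewrite natrX -k'E; field.
have k'g : 10 * ((800 ^ I)%N%:R * (4 * #|S|%:R * kappa')) <= 2 * #|S|%:R * gamma.
  rewrite kk; have h : gamma <= #|S|%:R * gamma by rewrite ler_peMl // ltW.
  have -> : 2 * #|S|%:R * gamma = 2 * (#|S|%:R * gamma) by rewrite mulrA.
  move: h gamma0; set mg := #|S|%:R * gamma; lra.
have k'1 : (800 ^ I)%N%:R * (4 * #|S|%:R * kappa') <= 1 / 10.
  by rewrite kk ler_pdivrMr //; apply: le_trans gamma2 _; lra.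
have eta_gt0 : 0 < eta by rewrite invr_gt0 ltr0n muln_gt0 expn_gt0.
have eta1 : (400 ^ I)%N%:R * eta <= 1 / 10.
  rewrite /eta natrM invfM mulrCA mulfV ?mulr1 ?mul1r // pnatr_eq0 -lt0n expn_gt0 //.
have nuF : v%:R ^+ 2 <= F0%:R * eta ^+ 2.
  rewrite /F0 natrX exprS [leRHS]mulrAC -[leLHS]mul1r ler_wpM2r ?sqr_ge0 //.
  rewrite /eta exprVn ler_pdivlMr ?exprn_gt0 ?ltr0n ?muln_gt0 ?expn_gt0 // mul1r -natrX ler_nat.
  rewrite expnMn -expnM mulnC [(I * 2)%N]mulnC mulnC; apply: leq_trans vbig.
  by rewrite -addnA (leq_trans _ (leq_addl _ _)) // leq_addr.
have M0 : (0 < M)%N.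
  rewrite /M LE !muln_gt0 a0 e0 /=; apply/andP; split; [exact: leq_trans C0 | exact: leq_trans E30].
have tI : (#|G| < y ^ I)%N.
  apply: leq_ltn_trans nomega _; rewrite omegaE -expnM.
  by rewrite IE ltn_exp2l // (leq_trans v1).
have D1 : 1 < Delta.
  apply: lt_le_trans DeltaE; rewrite ltr1n -{1}(expn0 omega) ltn_exp2l ?(leq_trans _ E30) //.
  exact: leq_trans vomega.
have KDl : ((3 * K1 * K2 ^ 2) ^ 3 < omega ^ E)%N.
  apply: leq_ltn_trans (_ : (y ^ 12) ^ 3 < _)%N.
    rewrite leq_exp2r //; have -> : (y ^ 12 = y * y ^ 3 * (y ^ 4) ^ 2)%N by ring.
    apply: leq_mul; last by rewrite leq_exp2r.
    apply: leq_mul => //; apply: leq_trans vy; exact: leq_trans v200.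
  rewrite omegaE -!expnM ltn_exp2l ?(leq_trans v1 vy) //.
  rewrite ltn_mul2l a0 /=; exact: leq_trans _ (leq_mul C0 E30).
have F00 : (0 < F0)%N by rewrite expn_gt0 v0.
have [D [aD DG fD DS Dcard]] := approximate_group SG S0 G1 minD D1 DeltaE gamma0 gammaN kM k'0
   k'g k'1 v1 M0 nv tI eta_gt0 eta1 F00 nuF KDl k_gt0.
rewrite -/F -/K1 -/K2 -/K {1}kE in aD DS Dcard.
have n0 : 0 < #|G|%:R :> R by rewrite ltr0n cardG_gt0.
have w0 : 0 < omega%:R :> R by rewrite ltr0n.
have w1 : (1 < omega)%N by apply: leq_trans vomega.
have KX1 : (K ^ (L.+1 + 1) <= omega)%N by apply: Kpow; rewrite addSnnS leq_add2l.
(* The descent with [sigma = omega], [t = omega ^ 2] and [L.+1] steps, as [#|G| <= omega ^ L]. *)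
have [X [aX XG fX hX]] : exists X, [/\ approx (K ^ (L.+1 + 1)) 9 X, X \subset G, full G X &
    {in G, forall g, #|X| <= omega ^ 2 * #|(D ^+ 4 :&: (X :^ g) ^+ 4)%g|}%N].
  apply: (@conjugate_intersections _ G S (omega ^ E) genS
    (fun N mN Y YQ big => quotient_gowers minD D1 DeltaE mN YQ big) L.+1 K (omega ^ 2) omega D)
      => //.
  - rewrite [leqRHS]expnS expn1 leq_mul2r; apply/orP; right; apply: Kpow.
    by rewrite addSnnS leq_add2l.
  - apply: leq_trans (_ : omega <= _)%N; first by apply: Kpow; rewrite addSnnS leq_add2l.
    by rewrite -expnM -{1}(expn1 omega) leq_pexp2l.
  - apply: leq_ltn_trans (_ : (omega * (omega ^ 2) ^ 3) ^ 3 < _)%N.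
      by rewrite leq_exp2r // leq_mul2r KX1 orbT.
    rewrite -expnM -expnS -expnM ltn_exp2l //; exact: leq_trans E30.
  - by apply: leq_ltn_trans nomega _; rewrite ltn_exp2l.
have KK : (K2 * (K1 * K2) ^ 5 <= omega)%N.
  apply: leq_trans (_ : K <= _)%N; last by rewrite -{1}(expn1 K) Kpow // !addnS.
  have K120 : (0 < K1 * K2)%N by move: K_gt0; rewrite /K; case: (K1 * K2)%N => //;
    rewrite exp0n ?muln0 // muln_gt0.
  have K20 : (0 < K2)%N by move: K120; rewrite muln_gt0 => /andP[].
  rewrite /K leq_mul //; first by rewrite -{1}(expn1 K2) leq_pexp2l.
  by rewrite leq_pexp2l //; apply: (@leq_trans (6 * 1)) => //; rewrite leq_mul2l.
have dE : (omega ^ 8 * #|D| <= omega ^ 4 * #|G|)%N.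
  rewrite -(ler_nat R) 2!natrM.
  apply: le_trans (_ : #|D|%:R * Delta <= _).
    rewrite mulrC ler_wpM2l //; apply: le_trans DeltaE; rewrite ler_nat leq_pexp2l //.
    exact: leq_trans E30.
  have eta_inv : eta^-1 <= omega%:R.
    rewrite /eta invrK ler_nat; apply: leq_trans vomega; apply: leq_trans vbig.
    rewrite -addnA (leq_trans _ (leq_addl _ _)) // (leq_trans _ (leq_addr _ _)) //.
    by rewrite leq_mul // leq_pexp2l // mul2n -addnn leq_addr.
  have -> : #|D|%:R * Delta = #|D|%:R * eta * Delta * eta^-1 by field; rewrite lt0r_neq0.
  apply: le_trans (_ : (omega%:R * (2 * v%:R * #|G|%:R)) * omega%:R <= _).
    apply: ler_pM => //.
    - by rewrite !mulr_ge0 ?(ltW eta_gt0) // ltW // (lt_trans ltr01).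
    - by rewrite invr_ge0 ltW.
    by apply: le_trans Dcard _; rewrite ler_wpM2r ?ler_nat // !mulr_ge0.
  rewrite -[2]/(2%:R) -!natrM ler_nat.
  have -> : (omega * (2 * v * #|G|) * omega = omega * omega * (2 * v) * #|G|)%N by ring.
  rewrite leq_mul2r; apply/orP; right.
  have -> : (omega ^ 4 = omega * omega * (omega * omega))%N by ring.
  by rewrite leq_mul2l leq_mul ?orbT.
have small3 : (2 * K * omega ^ 2 * K ^ (L.+1 + 1) * #|D| <= #|G|)%N.
  have w4 : (0 < omega ^ 4)%N by rewrite expn_gt0 omega0.
  apply: leq_trans (_ : omega ^ 4 * #|D| <= _)%N; last first.
    rewrite -(leq_pmul2l w4); apply: leq_trans dE.
    by rewrite mulnA -expnD.
  rewrite leq_mul2r; apply/orP; right.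
  have -> : (2 * K * omega ^ 2 * K ^ (L.+1 + 1) = 2 * K ^ (L.+1 + 1).+1 * omega ^ 2)%N.
    by rewrite [(K ^ (L.+1 + 1).+1)%N]expnS; ring.
  have -> : (omega ^ 4 = omega * omega * omega ^ 2)%N by ring.
  rewrite leq_mul2r; apply/orP; right; apply: leq_mul => //.
  by apply: Kpow; rewrite -addnS addSnnS leq_add2l.
(* As [E = 50 * 3 ^ Ic] and 50 - 9 * 4 = 14, this choice leaves [Delta * rho ^+ (4 * 3 ^ Ic) >=
   omega ^ (14 * 3 ^ Ic)]. With [Ic = 8 * e] its power [Ic] has exponent [112 * (e * 3 ^ Ic)],
   against [L + Ic <= 108 * (e * 3 ^ Ic)] on the other side. *)
pose rho : R := (omega ^ 9)%N%:R^-1.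
have rho0 : 0 <= rho by rewrite invr_ge0.
have big : #|G|%:R * (320 * 9 ^ Ic)%N%:R ^+ Ic < (Delta * rho ^+ (4 * 3 ^ Ic)) ^+ Ic.
  have h1 : (omega ^ (14 * 3 ^ Ic))%N%:R <= Delta * rho ^+ (4 * 3 ^ Ic).
    rewrite /rho exprVn -natrX -expnM ler_pdivlMr ?ltr0n ?expn_gt0 ?v0 //.
    rewrite -natrM -expnD; apply: le_trans DeltaE; rewrite ler_nat leq_pexp2l //.
    by rewrite EE mulnA -mulnDl.
  apply: (@lt_le_trans _ _ ((omega ^ (14 * 3 ^ Ic))%N%:R ^+ Ic)); last first.
    by rewrite lerXn2r ?nnegrE // (le_trans _ h1).
  rewrite -!natrX -natrM ltr_nat.
  apply: leq_ltn_trans (_ : omega ^ L * omega ^ Ic < _)%N.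
    apply: leq_mul; first exact: nomega.
    have Ic0 : (0 < Ic)%N by rewrite IcE muln_gt0.
    rewrite leq_exp2r //; apply: leq_trans vomega; apply: leq_trans vbig.
    by rewrite -addnA leq_addr.
  rewrite -expnD -expnM ltn_exp2l // LE EE.
  have t1 : (0 < 3 ^ Ic)%N by rewrite expn_gt0.
  apply: leq_ltn_trans (_ : 108 * (e * 3 ^ Ic) < _)%N.
    have -> : (2 * e * (50 * 3 ^ Ic) = 100 * (e * 3 ^ Ic))%N by ring.
    by rewrite (_ : 108 = 100 + 8)%N // mulnDl leq_add2l [leqLHS]IcE leq_mul2l /= leq_pmulr.
  have -> : (14 * 3 ^ Ic * Ic = 112 * (e * 3 ^ Ic))%N by rewrite {2}IcE; ring.
  by rewrite ltn_mul2r muln_gt0 e0 t1.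
have Gn1 : G :!=: 1%g by rewrite -cardG_gt1.
have k9 : (9 <= 9 * 13 ^ L.+1)%N by rewrite leq_pmulr // expn_gt0.
have [N mN] := uniform_conjugates_bound minD D1 Gn1 rho0 big (approx_leq aD (leqnn K) k9)
  DG aX XG fX hX small3.
pose x : R := #|N|%:R / #|G|%:R.
have x0 : 0 <= x by rewrite divr_ge0.
have xw : x <= (omega ^ 10)%N%:R^-1.
  apply: ratio_bound => //; have h := maxnormal_index minD D1 mN.
  have -> : Delta * x ^+ 3 = Delta * #|N|%:R ^+ 3 / #|G|%:R ^+ 3 by rewrite /x expr_div_n mulrA.
  by rewrite ler_pdivrMr ?exprn_gt0 // mul1r.
have c7 : (4 * K * (omega ^ 2 * K ^ (L.+1 + 1)) ^ 2 <= omega ^ 7)%N.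
  apply: leq_trans (_ : omega * (omega ^ 2) ^ 2 * omega ^ 2 <= _)%N; last first.
    by apply: eq_leq; ring.
  have -> : (4 * K * (omega ^ 2 * K ^ (L.+1 + 1)) ^ 2 =
      4 * (omega ^ 2) ^ 2 * (K ^ (L.+1 + 1) * K ^ (L.+1 + 1).+1))%N.
    by rewrite [(K ^ (L.+1 + 1).+1)%N]expnS; ring.
  apply: leq_mul.
    by rewrite leq_mul2r (leq_trans _ (leq_trans v200 vomega)) ?orbT.
  have -> : (omega ^ 2 = omega * omega)%N by [].
  by apply: leq_mul => //; apply: Kpow; rewrite -addnS addSnnS leq_add2l.
have KXw : (K ^ (L.+1 + 1))%N%:R * #|N|%:R / #|G|%:R <= (omega ^ 9)%N%:R^-1 :> R.
  apply: (@le_trans _ _ (omega%:R * (omega ^ 10)%N%:R^-1)).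
    by rewrite -mulrA; apply: ler_pM => //; rewrite ler_nat.
  rewrite [(omega ^ 10)%N]expnS natrM invfM mulrA mulfV ?mul1r //.
  by rewrite lt0r_neq0.
(* What has been derived reads [1 <= omega ^ 7 * (2 / omega ^ 9)], which is false. *)
rewrite leNgt => /negP[].
apply: le_lt_trans (_ : (omega ^ 7)%N%:R * ((omega ^ 9)%N%:R^-1 + (omega ^ 9)%N%:R^-1) < _).
  apply: ler_pM => //; first by rewrite addr_ge0 // !mulr_ge0 ?invr_ge0.
    by rewrite ler_nat.
  by rewrite lerD2l.
have w9 : (omega ^ 9)%N%:R = (omega ^ 7)%N%:R * omega%:R ^+ 2 :> R.
  by rewrite -natrX -natrM -expnD.
have w7 : 0 < (omega ^ 7)%N%:R :> R by rewrite ltr0n expn_gt0 omega0.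
rewrite w9; have -> : (omega ^ 7)%N%:R * (((omega ^ 7)%N%:R * omega%:R ^+ 2)^-1 +
   ((omega ^ 7)%N%:R * omega%:R ^+ 2)^-1) = 2 / omega%:R ^+ 2 :> R.
  by field; rewrite !lt0r_neq0.
rewrite ltr_pdivrMr ?exprn_gt0 // mul1r -natrX ltr_nat.
apply: (@leq_trans (2 ^ 2)) => //; rewrite leq_exp2r //.
Qed.

End LargeGroup.

Lemma quotient_gap_bounds (R : realType) (gT : finGroupType) (G N : {group gT}) (S : {set gT}) :
  S \subset G -> (0 < #|S|)%N -> maxnormal N G G -> 0 <= quotient_gap R G N S <= 2.
Proof.
move=> SG S0 mN; have NG := maxnormal_normal mN; have nN := normal_norm NG.
apply: gap_bounds; last 1 first.
- rewrite cardG_gt1; apply/trivgPn; have /andP[/andP[pNG nGN] _] := maxgroupp mN.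
  have /subsetPn[x Gx nNx] := nGN; exists (coset N x); first by rewrite mem_quotient.
  by apply: contra nNx => /eqP h; apply: coset_idr h; apply: (subsetP nN).
- move=> q /mapP[x Sx ->{q}]; rewrite mem_enum in Sx.
  by apply: mem_quotient; apply: (subsetP SG).
by rewrite size_map -cardE.
Qed.

Lemma min_quotient_gap_le (R : realType) (gT : finGroupType) (G N : {group gT}) (S : {set gT}) :
  S \subset G -> (0 < #|S|)%N -> maxnormal N G G -> min_quotient_gap R G S <= quotient_gap R G N S.
Proof.
move=> SG S0 mN; apply: ge_inf; last by exists N.
by exists 0 => _ [K mK <-]; have /andP[] := quotient_gap_bounds R SG S0 mK.
Qed.

Lemma min_quotient_gap_le2 (R : realType) (gT : finGroupType) (G : {group gT}) (S : {set gT}) :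
  S \subset G -> (0 < #|S|)%N -> G :!=: 1%g -> min_quotient_gap R G S <= 2.
Proof.
move=> SG S0 G1; pose gP := [pred N : {group gT} | (N \proper G) && (G \subset 'N(N))%g].
have gK : gP 1%G by rewrite /= proper1G G1 norms1.
have [N mN _] := maxgroup_exists gK.
apply: le_trans (min_quotient_gap_le R SG S0 mN) _.
by have /andP[] := quotient_gap_bounds R SG S0 mN.
Qed.

Theorem theorem1p1 (R : realType) (eps : R) (m : nat)
    (eps_gt0 : 0 < eps) (m_gt0 : (0 < m)%N) :
  exists2 c : R, 0 < c &
    forall (gT : finGroupType) (G : {group gT}) (S : {set gT}),
      G :!=: 1%g -> quasirandom eps G ->
      S \subset G -> #|S| = m -> <<S>>%g = G ->
      c * min_quotient_gap R G S <= gap R G (enum S).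
Proof.
have [e e0 eps_e] : exists2 e : nat, (0 < e)%N & 1 <= eps * e%:R.
  exists (Num.truncn eps^-1).+1 => //; rewrite mulrC -ler_pdivrMr // mul1r.
  have i0 : 0 <= eps^-1 by rewrite invr_ge0 ltW.
  by have /andP[_ h] := truncn_itv i0; apply: ltW.
(* Each constant is hidden behind an equation, so that no tactic unfolds these huge numbers. *)
have [Ic IcE] : exists Ic, Ic = (8 * e)%N by eexists.
have [E EE] : exists E, E = (50 * 3 ^ Ic)%N by eexists.
have [L LE] : exists L, L = (2 * e * E)%N by eexists.
have [k kE] : exists k, k = (9 * 13 ^ L.+1)%N by eexists.
have [C CE] : exists C, C = ((8 + 42 * k) * (L + 6))%N by eexists.
have [I IE] : exists I, I = (C * L).+1 by eexists.
have [a aE] : exists a, a = (6 * 2 ^ I).+1 by eexists.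
have [M ME] : exists M, M = (a * C * L)%N by eexists.
have [V VE] : exists V, V = (320 * 9 ^ Ic + 100 * 400 ^ (2 * I) + 200)%N by eexists.
have M0 : (0 < M)%N.
  by rewrite ME LE EE CE aE !muln_gt0 e0 !expn_gt0 addn_gt0 addnS.
have mR : 0 < m%:R :> R by rewrite ltr0n.
pose c1 : R := (800 ^+ I * (80 * m%:R) * 2 ^+ M)^-1.
pose c2 : R := (2 * (m%:R * (4 ^ (V ^ M))%N%:R))^-1.
have d1 : 0 < 800 ^+ I * (80 * m%:R) * 2 ^+ M :> R by rewrite !mulr_gt0 ?exprn_gt0.
have d2 : 0 < 2 * (m%:R * (4 ^ (V ^ M))%N%:R) :> R by rewrite !mulr_gt0 // ltr0n expn_gt0.
have c1_gt0 : 0 < c1 by rewrite invr_gt0.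
have c2_gt0 : 0 < c2 by rewrite invr_gt0.
exists (Num.min c1 c2); first by rewrite lt_min c1_gt0 c2_gt0.
move=> gT G S Gn1 quasi SG Sm genS.
have S0 : (0 < #|S|)%N by rewrite Sm.
have G1 : (1 < #|G|)%N by rewrite cardG_gt1.
have sH : {subset enum S <= G} by move=> x; rewrite mem_enum; apply: (subsetP SG).
have s0 : (0 < size (enum S))%N by rewrite -cardE.
have /andP[gap0 _] := gap_bounds R sH s0 G1.
set gamma := min_quotient_gap R G S.
have cmin0 : 0 <= Num.min c1 c2 by rewrite le_min !ltW.
have [gam_le0|gam_gt0] := leP gamma 0; first by apply: le_trans gap0; rewrite mulr_ge0_le0.
have gam2 : gamma <= 2 by apply: min_quotient_gap_le2.
have exv : exists v, (#|G| <= v ^ M)%N.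
  by exists #|G|; rewrite -{1}(expn1 #|G|) leq_pexp2l // cardG_gt0.
(* Minimality of [v] bounds [#|G|] from below by a power of the unit. If [v < V], the order of [G]
   is bounded in terms of [eps] and [gap_ge_small] applies. *)
case: (ex_minnP exv) => v nv vmin.
have [vV|vV] := leqP V v; last first.
  have nV : (#|G| <= V ^ M)%N by apply: leq_trans nv _; rewrite leq_exp2r // ltnW.
  have small := gap_ge_small R SG genS S0 G1; rewrite Sm in small.
  apply: le_trans (_ : c2 * 2 <= _).
    by apply: ler_pM => //; [exact: ltW | rewrite ge_min lexx orbT].
  have -> : c2 * 2 = (m%:R * (4 ^ (V ^ M))%N%:R)^-1.
    by rewrite /c2 invfM mulrC mulrA mulfV ?mul1r // pnatr_eq0.
  rewrite -[leLHS]mulr1 ler_pdivrMl; last by rewrite mulr_gt0 // ltr0n expn_gt0.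
  apply: le_trans small _.
  by rewrite ler_wpM2r // ler_wpM2l // ler_nat leq_pexp2l.
have v200 : (200 <= v)%N by apply: leq_trans vV; rewrite VE leq_addl.
pose Delta := powR #|G|%:R eps.
have n1 : 1 <= #|G|%:R :> R by rewrite ler1n cardG_gt0.
have De : #|G|%:R <= Delta ^+ e.
  rewrite -powR_mulrn ?powR_ge0 // -powRrM.
  by rewrite -[leLHS]powRr1 ?ler0n // ler_powR.
(* The factor 2 in [L = 2 * e * E] pays for rounding: [#|G| > v.-1 ^ M] and [v <= v.-1 ^ 2] bound
   [#|G|] below by [v ^ (a * C * E * e)], and [Delta ^+ e >= #|G|]. *)
have DeltaE : ((v ^ (a * C)) ^ E)%N%:R <= Delta.
  rewrite -(ler_pXn2r e0) ?nnegrE ?powR_ge0 //; apply: le_trans De.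
  rewrite -natrX ler_nat; apply: ltnW; rewrite ltnNge; apply/negP => h.
  have v1 : (v.-1 < v)%N by rewrite prednK // (leq_trans _ v200).
  have : (v <= v.-1)%N.
    apply: vmin; apply: leq_trans h _; rewrite ME LE.
    have -> : (a * C * (2 * e * E) = 2 * (a * C * E * e))%N by ring.
    rewrite -!expnM [leqRHS]expnM mulnA leq_exp2r.
      have w2 : (1 < v.-1)%N by rewrite -ltnS prednK ?(leq_trans _ v200).
      rewrite -mulnn -{1}(prednK (_ : 0 < v)%N); last exact: leq_trans v200.
      apply: (@leq_trans (v.-1 * 2)); last by rewrite leq_mul2l w2 orbT.
      by rewrite muln2 -addnn -addn1 leq_add2l ltnW.
    by rewrite EE CE aE !muln_gt0 e0 !expn_gt0 addn_gt0 addnS.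
  by rewrite leqNgt v1.
have minD : min_degree G Delta by [].
have vbig : (320 * 9 ^ Ic + 100 * 400 ^ (2 * I) + 200 <= v)%N by rewrite -VE.
have nv' : (#|G| <= v ^ (a * C * L))%N by rewrite -ME.
have large := gap_ge_large SG genS S0 G1 minD IcE EE LE kE CE IE aE e0 vbig nv' DeltaE gam_gt0 gam2
  (fun N mN => min_quotient_gap_le R SG S0 mN).
apply: le_trans (_ : c1 * gamma <= _).
  by rewrite ler_wpM2r ?(ltW gam_gt0) // ge_min lexx.
by rewrite /c1 mulrC ler_pdivrMr // mulrC ME -Sm.
Qed.
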